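(* Let $T=(O,M,\mathrm{dom},\mathrm{cod})$ be a monoidal signature. Then $\mathrm{FCsp}^+(\mathbb H,T)$ is the free strict symmetric traced category on $T$: for every strict symmetric traced category $\mathcal V$ and every monoidal signature homomorphism $F:T\to\mathcal V$ there is a unique (strict) symmetric traced functor $\widehat F:\mathrm{FCsp}^+(\mathbb H,T)\to\mathcal V$ such that $\widehat F\circ E=F$, where $E:T\to \mathrm{FCsp}^+(\mathbb H,T)$ is the canonical signature homomorphism.
   Context: Graphs are directed multigraphs $(V,E,s,t)$ and are finite. A monoidal signature $T=(O,M,\mathrm{dom},\mathrm{cod})$ consists of sets $O,M$ and functions $\mathrm{dom},\mathrm{cod}:M\to w(O)$, where $w(O)$ is the set of finite lists over $O$. A signature homomorphism $F$ from $T$ to a strict monoidal category $\mathcal V$ assigns to each $o\in O$ an object $F(o)$ and to each $f\in M$ with $\mathrm{dom}(f)=[a_1,\dots,a_m]$, $\mathrm{cod}(f)=[b_1,\dots,b_n]$ a morphism $F(f):F(a_1)\otimes\cdots\otimes F(a_m)\to F(b_1)\otimes\cdots\otimes F(b_n)$. String graphs. The derived typegraph $G_T$ has vertex set $O+M$ and edges: a self-loop $\mathrm{mid}_X$ at each $X\in O$; for $f\in M$ an edge $\mathrm{in}_{f,i}$ from $\mathrm{dom}(f)[i]$ to $f$ for each position $i$ of $\mathrm{dom}(f)$, and an edge $\mathrm{out}_{f,j}$ from $f$ to $\mathrm{cod}(f)[j]$ for each position $j$ of $\mathrm{cod}(f)$. For $(G,\tau:G\to G_T)$ in the slice category $\mathbf{Graph}/G_T$,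 a vertex $v$ is a wire-vertex if $\tau(v)\in O$ and a box-vertex if $\tau(v)\in M$; $N(v)=s^{-1}(v)\cup t^{-1}(v)$. $(G,\tau)$ is a string graph if every wire-vertex has at most one in-edge and at most one out-edge and for each box-vertex $b$ the map $N(b)\to N(\tau(b))$ induced by $\tau$ is a bijection. $\mathbf{SGraph}_T$ is the full subcategory of $\mathbf{Graph}/G_T$ on string graphs. A wire-vertex with no in-edge is an input, one with no out-edge an output; one with neither is isolated; $\mathrm{Bound}(G)$ is the set of inputs and outputs. A point graph is a string graph consisting only of isolated wire-vertices. Framed cospans. A framed point graph is a point graph $X$ with a total order on its vertices and a sign map $V_X\to\{+,-\}$; framed point graphs are identified with words in signed elements of $O$. It is positive if all signs are $+$. A framed cospan $X\xrightarrow{d}G\xleftarrow{c}Y$ in $\mathbf{SGraph}_T$ has $X,Y$ framed point graphs, $G$ without isolated wire-vertices, $[d,c]:X+Y\to G$ restricting to a bijection onto $\mathrm{Bound}(G)$, $d(v)$ an input iff $\mathrm{sgn}(v)=+$ (for $v\in V_X$), and $c(v)$ an output iff $\mathrm{sgn}(v)=+$ (for $v\in V_Y$). Cospans $X\to G\leftarrow Y$ and $Y\to H\leftarrow Z$ compose by the pushout of $G\leftarrow Y\to H$. Wire-homeomorphism is the equivalence relation on framed cospans generated by cospan isomorphism and the following splitting move: replace a wire-vertex $v$ of type $X$ by two wire-vertices $v',v''$ of type $X$ joined by an edge $v'\to v''$ of type $\mathrm{mid}_X$, the in-edge of $v$ (if any) now ending at $v'$ and the out-edge of $v$ (if any) now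 starting at $v''$; if $v$ was an input (output) then $v'$ ($v''$) takes its place in the boundary. $\mathrm{FCsp}(\mathbb H,T)$ has framed point graphs as objects and wire-homeomorphism classes $|G|$ of framed cospans as morphisms; $|H|\circ|G|=|H\circ G|$; the identity on $X$ is the class of the cospan whose graph has two copies of $V_X$ as vertices and, for each $v\in V_X$, one edge from the first to the second copy of $v$ if $\mathrm{sgn}(v)=+$ and from the second to the first if $\mathrm{sgn}(v)=-$. $\mathrm{FCsp}^+(\mathbb H,T)$ is the full subcategory on positive framed point graphs. The monoidal product is concatenation of words on objects and disjoint union on cospans; symmetries are crossing wires; the trace joins the traced outputs to the corresponding traced inputs by wires. The homomorphism $E$ sends $o\in O$ to the one-letter positive word $o$ and $f\in M$ to the class of the string graph consisting of one box-vertex of type $f$ and one separate wire-vertex for each of its inputs and outputs. *)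

(* Defs.v *)
(* Plain MathComp; classical choice picks representatives of classes. *)
From Stdlib Require Import Relation_Operators ClassicalEpsilon.
From mathcomp Require Import all_boot.

Set Implicit Arguments.
Unset Strict Implicit.
Unset Printing Implicit Defensive.

Declare Scope sst_scope.
Delimit Scope sst_scope with sst.

(* Tensoring is strictly associative and unital on objects; the laws on
   morphisms are in [is_sst]. *)
Record sst_data := SSTData {
  Ob : Type;
  Hom : Ob -> Ob -> Type;
  idm : forall A, Hom A A;
  compm : forall A B C, Hom B C -> Hom A B -> Hom A C;
  unitO : Ob;
  tensO : Ob -> Ob -> Ob;
  tensOA : forall A B C, tensO A (tensO B C) = tensO (tensO A B) C;
  tens1O : forall A, tensO unitO A = A;
  tensO1 : forall A, tensO A unitO = A;
  tensm : forall A A' B B',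
    Hom A B -> Hom A' B' -> Hom (tensO A A') (tensO B B');
  symm : forall A B, Hom (tensO A B) (tensO B A);
  trm : forall X A B, Hom (tensO A X) (tensO B X) -> Hom A B }.

Arguments idm {s} A.
Arguments compm {s A B C} g f.
Arguments unitO {s}.
Arguments tensO {s} A B.
Arguments tensOA {s} A B C.
Arguments tens1O {s} A.
Arguments tensO1 {s} A.
Arguments tensm {s A A' B B'} f g.
Arguments symm {s} A B.
Arguments trm {s} X {A B} f.

Notation "A ⊗ B" := (tensO A B) (at level 40, left associativity) : sst_scope.
Notation "f ⊠ g" := (tensm f g) (at level 40, left associativity) : sst_scope.
Notation "g ∘ f" := (compm g f) (at level 50, left associativity) : sst_scope.

Definition castm (C : sst_data) (A A' B B' : Ob C) (eA : A = A') (eB : B = B')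
    (f : Hom A B) : Hom A' B' :=
  match eA in _ = A1, eB in _ = B1 return Hom A1 B1 with
  | erefl, erefl => f
  end.

Local Open Scope sst_scope.

Record is_sst (C : sst_data) : Prop := IsSST {
  comp1m : forall (A B : Ob C) (f : Hom A B), idm B ∘ f = f;
  compm1 : forall (A B : Ob C) (f : Hom A B), f ∘ idm A = f;
  compmA : forall (A B D E : Ob C) (h : Hom D E) (g : Hom B D) (f : Hom A B),
    h ∘ (g ∘ f) = h ∘ g ∘ f;
  tensm_id : forall A B : Ob C, idm A ⊠ idm B = idm (A ⊗ B);
  tensm_comp : forall (A B D A' B' D' : Ob C) (g : Hom B D) (f : Hom A B)
      (g' : Hom B' D') (f' : Hom A' B'),
    (g ∘ f) ⊠ (g' ∘ f') = (g ⊠ g') ∘ (f ⊠ f');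
  tensmA : forall (A B A' B' A'' B'' : Ob C)
      (f : Hom A B) (g : Hom A' B') (h : Hom A'' B''),
    castm (tensOA A A' A'') (tensOA B B' B'') (f ⊠ (g ⊠ h)) = (f ⊠ g) ⊠ h;
  tens1m : forall (A B : Ob C) (f : Hom A B),
    castm (tens1O A) (tens1O B) (idm unitO ⊠ f) = f;
  tensm1 : forall (A B : Ob C) (f : Hom A B),
    castm (tensO1 A) (tensO1 B) (f ⊠ idm unitO) = f;
  symm_nat : forall (A B A' B' : Ob C) (f : Hom A B) (g : Hom A' B'),
    symm B B' ∘ (f ⊠ g) = (g ⊠ f) ∘ symm A A';
  symmK : forall A B : Ob C, symm B A ∘ symm A B = idm (A ⊗ B);
  symm_hexagon : forall A B D : Ob C,
    symm A (B ⊗ D) =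
      castm (erefl (B ⊗ (A ⊗ D))) (tensOA B D A) (idm B ⊠ symm A D)
      ∘ castm (esym (tensOA A B D)) (esym (tensOA B A D)) (symm A B ⊠ idm D);
  trm_natl : forall (X A A' B : Ob C) (f : Hom (A ⊗ X) (B ⊗ X)) (a : Hom A' A),
    trm X (f ∘ (a ⊠ idm X)) = trm X f ∘ a;
  trm_natr : forall (X A B B' : Ob C) (f : Hom (A ⊗ X) (B ⊗ X)) (b : Hom B B'),
    trm X ((b ⊠ idm X) ∘ f) = b ∘ trm X f;
  trm_slide : forall (X Y A B : Ob C) (f : Hom (A ⊗ X) (B ⊗ Y)) (k : Hom Y X),
    trm X ((idm B ⊠ k) ∘ f) = trm Y (f ∘ (idm A ⊠ k));
  trm_unit : forall (A B : Ob C) (f : Hom (A ⊗ unitO) (B ⊗ unitO)),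
    trm unitO f = castm (tensO1 A) (tensO1 B) f;
  trm_tens : forall (X Y A B : Ob C) (f : Hom (A ⊗ (X ⊗ Y)) (B ⊗ (X ⊗ Y))),
    trm (X ⊗ Y) f = trm X (trm Y (castm (tensOA A X Y) (tensOA B X Y) f));
  trm_super : forall (X A B D E : Ob C) (g : Hom D E) (f : Hom (A ⊗ X) (B ⊗ X)),
    trm X (castm (tensOA D A X) (tensOA E B X) (g ⊠ f)) = g ⊠ trm X f;
  trm_yank : forall X : Ob C, trm X (symm X X) = idm X }.

Record sst_functor (C D : sst_data) := SSTFunctor {
  fobj :> Ob C -> Ob D;
  fhom : forall A B, Hom A B -> Hom (fobj A) (fobj B);
  fhom_id : forall A, fhom (idm A) = idm (fobj A);
  fhom_comp : forall A B E (g : Hom B E) (f : Hom A B),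
    fhom (g ∘ f) = fhom g ∘ fhom f;
  fobj_unit : fobj unitO = unitO;
  fobj_tens : forall A B, fobj (A ⊗ B) = fobj A ⊗ fobj B;
  fhom_tens : forall A A' B B' (f : Hom A B) (g : Hom A' B'),
    castm (fobj_tens A A') (fobj_tens B B') (fhom (f ⊠ g)) = fhom f ⊠ fhom g;
  fhom_symm : forall A B,
    castm (fobj_tens A B) (fobj_tens B A) (fhom (symm A B))
      = symm (fobj A) (fobj B);
  fhom_tr : forall X A B (f : Hom (A ⊗ X) (B ⊗ X)),
    fhom (trm X f)
      = trm (fobj X) (castm (fobj_tens A X) (fobj_tens B X) (fhom f)) }.

Arguments fhom {C D} s {A B} f.

Section FullSub.
Variables (C : sst_data) (P : pred (Ob C)).
Hypotheses (P1 : P unitO) (PM : forall A B, P A -> P B -> P (A ⊗ B)).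

Lemma sub_ob_eq (A B : {A : Ob C | P A}) : sval A = sval B -> A = B.
Proof. exact: val_inj. Qed.

Definition sub_unit : {A : Ob C | P A} := exist _ unitO P1.
Definition sub_tens (A B : {A : Ob C | P A}) : {A : Ob C | P A} :=
  exist _ (sval A ⊗ sval B) (PM (svalP A) (svalP B)).

Definition full_sub : sst_data := @SSTData
  {A : Ob C | P A}
  (fun A B => Hom (sval A) (sval B))
  (fun A => idm (sval A))
  (fun A B D g f => g ∘ f)
  sub_unit
  sub_tens
  (fun A B D => @sub_ob_eq (sub_tens A (sub_tens B D)) (sub_tens (sub_tens A B) D)
                  (tensOA (sval A) (sval B) (sval D)))
  (fun A => @sub_ob_eq (sub_tens sub_unit A) A (tens1O (sval A)))
  (fun A => @sub_ob_eq (sub_tens A sub_unit) A (tensO1 (sval A)))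
  (fun A A' B B' f g => f ⊠ g)
  (fun A B => symm (sval A) (sval B))
  (fun X A B f => trm (sval X) f).
End FullSub.

Record signature := Signature {
  sobj : Type;
  smor : Type;
  sdom : smor -> seq sobj;
  scod : smor -> seq sobj }.

Definition tensl (C : sst_data) (l : seq (Ob C)) : Ob C :=
  foldr (fun A B => A ⊗ B) unitO l.

Record sighom (T : signature) (C : sst_data) := SigHom {
  so :> sobj T -> Ob C;
  sm : forall f : smor T,
    Hom (tensl [seq so a | a <- sdom f]) (tensl [seq so b | b <- scod f]) }.

Lemma fobj_tensl (C D : sst_data) (F : sst_functor C D) (S : Type)
    (g : S -> Ob C) (l : seq S) :
  F (tensl [seq g a | a <- l]) = tensl [seq F (g a) | a <- l].
Proof.
by elim: l => [|a l IHl] /=; rewrite ?fobj_unit // fobj_tens IHl.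
Qed.

Definition sighom_comp (T : signature) (C D : sst_data)
    (F : sst_functor C D) (h : sighom T C) : sighom T D :=
  @SigHom T D (fun a => F (h a))
    (fun f => castm (fobj_tensl F h (sdom f)) (fobj_tensl F h (scod f))
                    (fhom F (sm h f))).

Record graph := Graph {
  vertex : Type;
  edge : Type;
  src : edge -> vertex;
  tgt : edge -> vertex }.

Arguments src {g} e.
Arguments tgt {g} e.

Section StringGraphs.
Variable T : signature.

Inductive type_edge :=
| mid_edge of sobj T
| in_edge (f : smor T) of 'I_(size (sdom f))
| out_edge (f : smor T) of 'I_(size (scod f)).

Definition typegraph : graph := {|
  vertex := sobj T + smor T;
  edge := type_edge;
  src e := match e with
           | mid_edge X => inl X
           | in_edge f i => inl (tnth (in_tuple (sdom f)) i)
           | out_edge f _ => inr f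
           end;
  tgt e := match e with
           | mid_edge X => inl X
           | in_edge f _ => inr f
           | out_edge f j => inl (tnth (in_tuple (scod f)) j)
           end |}.

(* A letter is a sign, with [true] for +, and a type. *)
Notation letter := (bool * sobj T)%type.

(* A finite graph with a labelling of its vertices and edges in the typegraph
   and two lists of vertices.  For words [X] and [Y], a map from the point
   graph [X] to a graph is represented by the list of the images of the letters
   of [X] in order, so that [domf] and [codf] are the legs of a cospan
   X -> G <- Y.  All conditions are imposed in [framed]. *)
Record cospan := Cospan {
  cvert : finType;
  cedge : finType;
  csrc : cedge -> cvert;
  ctgt : cedge -> cvert;
  vtype : cvert -> vertex typegraph;
  etype : cedge -> edge typegraph;
  domf : seq cvert;
  codf : seq cvert }.

Arguments csrc {c} e.
Arguments ctgt {c} e.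
Arguments vtype {c} v.
Arguments etype {c} e.

Definition typed (G : cospan) : Prop :=
  forall e : cedge G,
    vtype (csrc e) = src (etype e) /\ vtype (ctgt e) = tgt (etype e).

Section Vertices.
Variable G : cospan.
Implicit Type v : cvert G.

Definition is_wire v : bool := if vtype v is inl _ then true else false.
Definition has_in v : bool := [exists e : cedge G, ctgt e == v].
Definition has_out v : bool := [exists e : cedge G, csrc e == v].
Definition is_input v : bool := is_wire v && ~~ has_in v.
Definition is_output v : bool := is_wire v && ~~ has_out v.
Definition is_bound v : bool := is_input v || is_output v.
Definition is_isolated v : bool := is_input v && is_output v.
End Vertices.

(* For a box-vertex [b] the last condition says that the labelling restricts
   to a bijection from N(b) to N(τ(b)). *)
Record string_graph (G : cospan) : Prop := StringGraph {
  sg_typed : typed G;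
  sg_in : forall e1 e2 : cedge G,
    is_wire (ctgt e1) -> ctgt e1 = ctgt e2 -> e1 = e2;
  sg_out : forall e1 e2 : cedge G,
    is_wire (csrc e1) -> csrc e1 = csrc e2 -> e1 = e2;
  sg_box : forall b : cvert G, ~~ is_wire b ->
    forall t : edge typegraph, src t = vtype b \/ tgt t = vtype b ->
    exists! e : cedge G, (csrc e = b \/ ctgt e = b) /\ etype e = t }.

Record framed (X Y : seq letter) (G : cospan) : Prop := Framed {
  fr_string : string_graph G;
  fr_isolated : forall v : cvert G, ~~ is_isolated v;
  fr_dom_type : [seq vtype v | v <- domf G] = [seq inl x.2 | x <- X];
  fr_cod_type : [seq vtype v | v <- codf G] = [seq inl y.2 | y <- Y];
  fr_uniq : uniq (domf G ++ codf G);
  fr_bound : forall v : cvert G, (v \in domf G ++ codf G) = is_bound v;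
  fr_dom_sign : [seq is_input v | v <- domf G] = [seq x.1 | x <- X];
  fr_cod_sign : [seq is_output v | v <- codf G] = [seq y.1 | y <- Y] }.

Definition fcospan (X Y : seq letter) := {G : cospan | framed X Y G}.

Definition cospan_iso (G H : cospan) : Prop :=
  exists (fv : cvert G -> cvert H) (fe : cedge G -> cedge H),
    [/\ bijective fv /\ bijective fe,
        forall e, csrc (fe e) = fv (csrc e) /\ ctgt (fe e) = fv (ctgt e),
        forall v, vtype (fv v) = vtype v,
        forall e, etype (fe e) = etype e
      & domf H = [seq fv v | v <- domf G] /\ codf H = [seq fv v | v <- codf G]].

(* Splitting the wire-vertex [v] of type [X]: v' is [Some v] and v'' is
   [None]; the new edge is [None]. *)
Definition split_wire (G : cospan) (v : cvert G) (X : sobj T) : cospan :=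
  let frame x := if (x == v) && is_output v then None else Some x in
  {| cvert := option (cvert G);
     cedge := option (cedge G);
     csrc e := if e is Some e' then
                 if csrc e' == v then None else Some (csrc e')
               else Some v;
     ctgt e := if e is Some e' then Some (ctgt e') else None;
     vtype x := if x is Some x' then vtype x' else inl X;
     etype e := if e is Some e' then etype e' else mid_edge X;
     domf := map frame (domf G);
     codf := map frame (codf G) |}.

Definition splits_to (G H : cospan) : Prop :=
  exists (v : cvert G) (X : sobj T),
    vtype v = inl X /\ cospan_iso (split_wire v X) H.

Definition wire_homeo (X Y : seq letter) : fcospan X Y -> fcospan X Y -> Prop :=
  clos_refl_sym_trans (fcospan X Y) (fun G H =>
    cospan_iso (sval G) (sval H) \/ splits_to (sval G) (sval H)).

(* The composite of X -> G <- Y -> H.  As Y has no edges, the pushout has as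
   edges the disjoint union of the edges, and as vertices the quotient of the
   disjoint union of the vertices by the equivalence generated by identifying
   the two images of each letter of Y; an equivalence class is represented by
   its canonical element. *)
Section Pushout.
Variables G H : cospan.

Definition glue_rel : rel (cvert G + cvert H) :=
  [rel u v | ((u, v) \in zip (map inl (codf G)) (map inr (domf H)))
          || ((v, u) \in zip (map inl (codf G)) (map inr (domf H)))].

Definition glue_vert := {u : cvert G + cvert H | u \in roots glue_rel}.

Lemma glue_sym : connect_sym glue_rel.
Proof. by apply: sym_connect_sym => u v; exact: orbC. Qed.

Definition glue_proj (u : cvert G + cvert H) : glue_vert :=
  exist _ (root glue_rel u) (roots_root glue_sym u).

Definition cospan_comp : cospan :=
  {| cvert := glue_vert;
     cedge := (cedge G + cedge H)%type;
     csrc e := match e with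
               | inl e' => glue_proj (inl (csrc e'))
               | inr e' => glue_proj (inr (csrc e'))
               end;
     ctgt e := match e with
               | inl e' => glue_proj (inl (ctgt e'))
               | inr e' => glue_proj (inr (ctgt e'))
               end;
     vtype u := match sval u with inl v => vtype v | inr v => vtype v end;
     etype e := match e with inl e' => etype e' | inr e' => etype e' end;
     domf := [seq glue_proj (inl v) | v <- domf G];
     codf := [seq glue_proj (inr v) | v <- codf H] |}.
End Pushout.

Definition cospan_id (X : seq letter) : cospan :=
  let x i := tnth (in_tuple X) i in
  {| cvert := ('I_(size X) + 'I_(size X))%type;
     cedge := 'I_(size X);
     csrc i := if (x i).1 then inl i else inr i;
     ctgt i := if (x i).1 then inr i else inl i;
     vtype u := match u with inl i => inl (x i).2 | inr i => inl (x i).2 end;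
     etype i := mid_edge (x i).2;
     domf := [seq inl i | i <- enum 'I_(size X)];
     codf := [seq inr i | i <- enum 'I_(size X)] |}.

Definition cospan_tens (G H : cospan) : cospan :=
  {| cvert := (cvert G + cvert H)%type;
     cedge := (cedge G + cedge H)%type;
     csrc e := match e with inl e' => inl (csrc e') | inr e' => inr (csrc e') end;
     ctgt e := match e with inl e' => inl (ctgt e') | inr e' => inr (ctgt e') end;
     vtype u := match u with inl v => vtype v | inr v => vtype v end;
     etype e := match e with inl e' => etype e' | inr e' => etype e' end;
     domf := map inl (domf G) ++ map inr (domf H);
     codf := map inl (codf G) ++ map inr (codf H) |}.

(* The wires of X and of Y, with the two blocks exchanged in the codomain. *)
Definition cospan_symm (X Y : seq letter) : cospan :=
  let W := cospan_tens (cospan_id X) (cospan_id Y) in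
  {| cvert := cvert W; cedge := cedge W; csrc := csrc; ctgt := ctgt;
     vtype := vtype; etype := etype;
     domf := domf W;
     codf := map inr (codf (cospan_id Y)) ++ map inl (codf (cospan_id X)) |}.

(* The entry ((s, o), (u, v)) of [trace_wires] stands for a wire of type [o]
   joining the vertex [u] of the domain frame and the vertex [v] of the
   codomain frame: from [v] to [u] if the sign [s] is +, and from [u] to [v]
   otherwise. *)
Definition trace_wires (U A B : seq letter) (G : cospan) :=
  zip U (zip (drop (size A) (domf G)) (drop (size B) (codf G))).

Definition cospan_tr (U A B : seq letter) (G : cospan) : cospan :=
  let l := in_tuple (trace_wires U A B G) in
  {| cvert := cvert G;
     cedge := (cedge G + 'I_(size (trace_wires U A B G)))%type;
     csrc e := match e with
               | inl e' => csrc e'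
               | inr i => let: (x, (u, v)) := tnth l i in if x.1 then v else u
               end;
     ctgt e := match e with
               | inl e' => ctgt e'
               | inr i => let: (x, (u, v)) := tnth l i in if x.1 then u else v
               end;
     vtype := vtype;
     etype e := match e with
                | inl e' => etype e'
                | inr i => mid_edge (tnth l i).1.2
                end;
     domf := take (size A) (domf G);
     codf := take (size B) (codf G) |}.

(* The box-vertex is [None]. *)
Definition cospan_box (f : smor T) : cospan :=
  let I := 'I_(size (sdom f)) in
  let J := 'I_(size (scod f)) in
  {| cvert := option (I + J);
     cedge := (I + J)%type;
     csrc e := match e with inl i => Some (inl i) | inr _ => None end;
     ctgt e := match e with inl _ => None | inr j => Some (inr j) end;
     vtype u := match u with
                | None => inr f
                | Some (inl i) => inl (tnth (in_tuple (sdom f)) i)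
                | Some (inr j) => inl (tnth (in_tuple (scod f)) j)
                end;
     etype e := match e with inl i => in_edge i | inr j => out_edge j end;
     domf := [seq Some (inl i) | i <- enum I];
     codf := [seq Some (inr j) | j <- enum J] |}.

Section SumSeq.
Variables A B : eqType.
Implicit Types (s : seq A) (t : seq B).

Lemma mem_inl s v : ((inl v : A + B) \in map inl s) = (v \in s).
Proof. by rewrite mem_map // => ? ? []. Qed.
Lemma mem_inr t v : ((inr v : A + B) \in map inr t) = (v \in t).
Proof. by rewrite mem_map // => ? ? []. Qed.
Lemma mem_inlr t v : ((inl v : A + B) \in map inr t) = false.
Proof. by apply/mapP => -[]. Qed.
Lemma mem_inrl s v : ((inr v : A + B) \in map inl s) = false.
Proof. by apply/mapP => -[]. Qed.
Lemma uniq_inlr s t : uniq ((map inl s : seq (A + B)) ++ map inr t) = uniq s && uniq t.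
Proof.
rewrite cat_uniq !map_inj_uniq; try by move=> ? ? [].
by congr andb; rewrite andbC (_ : ~~ _) ?andbT //; apply/hasPn => _ /mapP[i _ ->];
  rewrite mem_inrl.
Qed.
End SumSeq.

Lemma framed_id (X : seq letter) : framed X X (cospan_id X).
Proof.
set x := tnth (in_tuple X).
have hin i : has_in (G := cospan_id X) (inl i) = ~~ (x i).1.
  apply/existsP/idP => [[j]|h]; last by exists i; rewrite /= ifN.
  by rewrite /= -/x; case h: (x j).1 => //= /eqP[<-]; rewrite h.
have hin' i : has_in (G := cospan_id X) (inr i) = (x i).1.
  apply/existsP/idP => [[j]|h]; last by exists i; rewrite /= -/x h.
  by rewrite /= -/x; case h: (x j).1 => //= /eqP[<-]; rewrite h.
have hout i : has_out (G := cospan_id X) (inl i) = (x i).1.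
  apply/existsP/idP => [[j]|h]; last by exists i; rewrite /= -/x h.
  by rewrite /= -/x; case h: (x j).1 => //= /eqP[<-]; rewrite h.
have hout' i : has_out (G := cospan_id X) (inr i) = ~~ (x i).1.
  apply/existsP/idP => [[j]|h]; last by exists i; rewrite /= ifN.
  by rewrite /= -/x; case h: (x j).1 => //= /eqP[<-]; rewrite h.
have mapX (S : Type) (f : letter -> S) :
    [seq f (x i) | i <- enum 'I_(size X)] = [seq f y | y <- X].
  by rewrite map_comp map_tnth_enum.
split; first split.
- by move=> i; rewrite /= -/x; case: ifP.
- by move=> i j _ /=; rewrite -/x; case: ifP; case: ifP => // _ _ [].
- by move=> i j _ /=; rewrite -/x; case: ifP; case: ifP => // _ _ [].
- by case.
- by case=> i; rewrite /is_isolated /is_input /is_output ?hin ?hin' ?hout ?hout' /=;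
    case: (x i).1.
- by rewrite -map_comp -mapX; apply: eq_map.
- by rewrite -map_comp -mapX; apply: eq_map.
- by rewrite uniq_inlr -?enumT enum_uniq.
- case=> i; rewrite mem_cat ?mem_inl ?mem_inr ?mem_inlr ?mem_inrl mem_enum
    /is_bound /is_input /is_output ?hin ?hin' ?hout ?hout' /=.
    by case: (x i).1.
  by case: (x i).1.
- rewrite -map_comp -mapX; apply: eq_map => i.
  by rewrite /= /is_input hin negbK.
- rewrite -map_comp -mapX; apply: eq_map => i.
  by rewrite /= /is_output hout' negbK.
Qed.


Lemma framed_perm (X Y Y' : seq letter) (G : cospan) (c : seq (cvert G)) :
  framed X Y G -> perm_eq c (codf G) ->
  [seq vtype v | v <- c] = [seq inl y.2 | y <- Y'] ->
  [seq is_output v | v <- c] = [seq y.1 | y <- Y'] ->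
  framed X Y' (@Cospan (cvert G) (cedge G) csrc ctgt vtype etype (domf G) c).
Proof.
case=> -[? ? ? ?] ? ? ? un bd ? ? pc ? ?; split => //.
  by rewrite (perm_uniq (s2 := domf G ++ codf G)) // perm_cat2l.
by move=> v; rewrite mem_cat /= (perm_mem pc) -mem_cat bd.
Qed.

Section Tens.
Variables G H : cospan.
Let W := cospan_tens G H.

Lemma tens_in_l v : has_in (G := W) (inl v) = has_in v.
Proof.
apply/existsP/existsP => [[[e|e] //]|[e /eqP he]]; first by move=> /eqP[<-]; exists e.
by exists (inl e); rewrite /= he.
Qed.
Lemma tens_in_r v : has_in (G := W) (inr v) = has_in v.
Proof.
apply/existsP/existsP => [[[e|e] //]|[e /eqP he]]; first by move=> /eqP[<-]; exists e.
by exists (inr e); rewrite /= he.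
Qed.
Lemma tens_out_l v : has_out (G := W) (inl v) = has_out v.
Proof.
apply/existsP/existsP => [[[e|e] //]|[e /eqP he]]; first by move=> /eqP[<-]; exists e.
by exists (inl e); rewrite /= he.
Qed.
Lemma tens_out_r v : has_out (G := W) (inr v) = has_out v.
Proof.
apply/existsP/existsP => [[[e|e] //]|[e /eqP he]]; first by move=> /eqP[<-]; exists e.
by exists (inr e); rewrite /= he.
Qed.

Lemma framed_tens (X Y X' Y' : seq letter) :
  framed X Y G -> framed X' Y' H -> framed (X ++ X') (Y ++ Y') W.
Proof.
case=> -[tG iG oG bG] nG dtG ctG uG bdG dsG csG.
case=> -[tH iH oH bH] nH dtH ctH uH bdH dsH csH.
split; first split.
- by case=> e /=; [apply: tG | apply: tH].
- by case=> e1 [] e2 //= w [] h; congr (_ _); [apply: iG w h | apply: iH w h].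
- by case=> e1 [] e2 //= w [] h; congr (_ _); [apply: oG w h | apply: oH w h].
- case=> b wb t ht.
    have [e [[he te] ue]] := bG b wb t ht; exists (inl e); split.
      by split=> //=; case: he => ->; [left | right].
    case=> e' [[] //= [] he' te']; congr inl; apply: ue; split => //;
      by [left | right].
  have [e [[he te] ue]] := bH b wb t ht; exists (inr e); split.
    by split=> //=; case: he => ->; [left | right].
  case=> e' [[] //= [] he' te']; congr inr; apply: ue; split => //;
    by [left | right].
- case=> v; rewrite /is_isolated /is_input /is_output.
    by rewrite tens_in_l tens_out_l; apply: nG.
  by rewrite tens_in_r tens_out_r; apply: nH.
- by rewrite !map_cat -!map_comp -dtG -dtH.
- by rewrite !map_cat -!map_comp -ctG -ctH.
- have p : perm_eq (domf W ++ codf W)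
      (map inl (domf G ++ codf G) ++ map inr (domf H ++ codf H)).
    by rewrite /= !map_cat -!catA perm_cat2l perm_catCA perm_refl.
  by rewrite (perm_uniq p) uniq_inlr uG uH.
- case=> v; rewrite !mem_cat /is_bound /is_input /is_output.
    rewrite tens_in_l tens_out_l !mem_inl !mem_inlr !orbF.
    by have := bdG v; rewrite mem_cat => ->.
  rewrite tens_in_r tens_out_r !mem_inr !mem_inrl.
  by have := bdH v; rewrite mem_cat => ->.
- rewrite !map_cat -!map_comp -dsG -dsH; congr cat; apply: eq_map => v;
  by rewrite /= /is_input ?tens_in_l ?tens_in_r.
- rewrite !map_cat -!map_comp -csG -csH; congr cat; apply: eq_map => v;
  by rewrite /= /is_output ?tens_out_l ?tens_out_r.
Qed.
End Tens.

Lemma framed_symm (X Y : seq letter) : framed (X ++ Y) (Y ++ X) (cospan_symm X Y).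
Proof.
have fX := framed_id X; have fY := framed_id Y.
apply: (framed_perm (framed_tens fX fY)); first by rewrite perm_catC.
  by rewrite !map_cat -(fr_cod_type fX) -(fr_cod_type fY) -!map_comp.
rewrite !map_cat -(fr_cod_sign fX) -(fr_cod_sign fY).
congr cat; rewrite -[LHS]map_comp; apply: eq_map => v.
  by rewrite /= /is_output tens_out_r.
by rewrite /= /is_output tens_out_l.
Qed.

Section Glue.
Variables (X Y Z : seq letter) (G H : cospan).
Hypotheses (fG : framed X Y G) (fH : framed Y Z H).
Let W := cospan_comp G H.
Let g (v : cvert G) : cvert W := glue_proj (inl v).
Let h (v : cvert H) : cvert W := glue_proj (inr v).
Let glued v w := (v, w) \in zip (codf G) (domf H).

Lemma glue_size : size (codf G) = size (domf H).
Proof.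
have := congr1 size (fr_cod_type fG); have := congr1 size (fr_dom_type fH).
by rewrite !size_map => -> ->.
Qed.

Lemma glue_inr u v : glued u v -> u \in codf G /\ v \in domf H.
Proof.
move=> uv; split.
  by rewrite -(unzip1_zip (eq_leq glue_size)); apply: (map_f fst uv).
by rewrite -(unzip2_zip (eq_leq (esym glue_size))); apply: (map_f snd uv).
Qed.

Lemma glue_l u : u \in codf G -> exists v, glued u v.
Proof.
rewrite -{1}(unzip1_zip (eq_leq glue_size)) => /mapP[[u' v] uv /= ->].
by exists v.
Qed.

Lemma glue_r v : v \in domf H -> exists u, glued u v.
Proof.
rewrite -{1}(unzip2_zip (eq_leq (esym glue_size))) => /mapP[[u v'] uv /= ->].
by exists u.
Qed.

Lemma glue_nth u v : glued u v ->
  [/\ index u (codf G) < size Y, u = nth u (codf G) (index u (codf G))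
    & v = nth v (domf H) (index u (codf G))].
Proof.
move=> uv; have [uc vd] := glue_inr uv.
move/(nthP (u, v)): uv => [i]; rewrite size_zip glue_size minnn => li.
rewrite nth_zip ?glue_size // => -[ui vi].
have uc' : uniq (codf G) by have := fr_uniq fG; rewrite cat_uniq => /and3P[].
have -> : index u (codf G) = i by rewrite -ui index_uniq // glue_size.
by rewrite ui vi; split=> //; have := congr1 size (fr_dom_type fH);
  rewrite !size_map => <-.
Qed.

Lemma glue_funl u v v' : glued u v -> glued u v' -> v = v'.
Proof.
move=> p p'; have [li _ ->] := glue_nth p; have [_ _ ->] := glue_nth p'.
apply: set_nth_default; have := congr1 size (fr_dom_type fH).
by rewrite !size_map => ->.
Qed.

Lemma glue_funr u u' v : glued u v -> glued u' v -> u = u'.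
Proof.
move=> p p'; have [li e1 e2] := glue_nth p; have [li' e1' e2'] := glue_nth p'.
have ud : uniq (domf H) by have := fr_uniq fH; rewrite cat_uniq => /and3P[].
have sH : size (domf H) = size Y.
  by have := congr1 size (fr_dom_type fH); rewrite !size_map.
have ie : index u (codf G) = index u' (codf G).
  by apply/eqP; rewrite -(nth_uniq v _ _ ud) ?sH // -e2 -e2'.
rewrite [LHS]e1 [RHS]e1' ie; apply: set_nth_default.
by rewrite glue_size sH.
Qed.

Lemma glue_relE u v : glue_rel (G := G) (H := H) u v =
  match u, v with
  | inl a, inr b => glued a b
  | inr b, inl a => glued a b
  | _, _ => false
  end.
Proof.
have zE (a b : cvert G + cvert H) :
    ((a, b) \in zip (map inl (codf G)) (map inr (domf H))) =
    match a, b with inl a, inr b => glued a b | _, _ => false end.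
  have -> : zip (map inl (codf G)) (map inr (domf H)) =
      [seq (inl p.1, inr p.2) | p <- zip (codf G) (domf H)]
        :> seq ((cvert G + cvert H) * (cvert G + cvert H)).
    by elim: (codf G) (domf H) => [|x s IH] [|y t] //=; rewrite IH.
  case: a b => a [] b; try by apply/mapP => -[].
  apply/mapP/idP => [[[? ?] ? [-> ->]] //|ab]; by exists (a, b).
by rewrite /glue_rel /= !zE; case: u v => u [] v; rewrite ?orbF.
Qed.

Lemma glue_connect u v : connect (@glue_rel G H) u v -> u = v \/ glue_rel u v.
Proof.
case/connectP => p; elim: p u => [|w p IH] u /=; first by move=> _ ->; left.
case/andP=> uw pw vl; case: (IH w pw vl) => [<-|wv]; first by right.
move: uw wv; rewrite !glue_relE; case: u w v {IH pw vl} => u [] w [] v // h1 h2; left.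
  by rewrite (glue_funr h1 h2).
by rewrite (glue_funl h1 h2).
Qed.

Lemma glue_projP u v : glue_proj u = glue_proj v :> cvert W -> u = v \/ glue_rel u v.
Proof.
move=> e; have {}e : root (@glue_rel G H) u = root (@glue_rel G H) v.
  exact: (congr1 (@proj1_sig _ _) e).
by apply: glue_connect; rewrite -(root_connect (@glue_sym G H)) e eqxx.
Qed.

Lemma glue_gI : injective g.
Proof. by move=> u v /glue_projP[[]|] //; rewrite glue_relE. Qed.

Lemma glue_hI : injective h.
Proof. by move=> u v /glue_projP[[]|] //; rewrite glue_relE. Qed.

Lemma glue_gh u v : g u = h v <-> glued u v.
Proof.
split=> [/glue_projP[//|]|uv]; first by rewrite glue_relE.
apply: val_inj; apply/eqP; rewrite /g /h (root_connect (@glue_sym G H)).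
by apply: connect1; rewrite glue_relE.
Qed.

Lemma glue_case (P : cvert W -> Prop) :
  (forall v, P (g v)) -> (forall v, P (h v)) -> forall w, P w.
Proof.
move=> Pg Ph w; have <- : glue_proj (sval w) = w.
  by apply: val_inj; apply/eqP; exact: svalP w.
by case: (sval w).
Qed.

Lemma glued_type u v : glued u v -> vtype u = vtype v.
Proof.
move=> p; have [li eu ev] := glue_nth p; rewrite [in LHS]eu [in RHS]ev.
have sG : size (codf G) = size Y.
  by have := congr1 size (fr_cod_type fG); rewrite !size_map.
have sH : size (domf H) = size Y by rewrite -glue_size.
by rewrite -(nth_map u (vtype u) (@vtype G)) ?sG //
  -(nth_map v (vtype u) (@vtype H)) ?sH // (fr_cod_type fG) (fr_dom_type fH).
Qed.

Lemma glued_wire u v : glued u v -> is_wire u /\ is_wire v.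
Proof.
case/glue_inr=> uc vd.
have : is_bound u by rewrite -(fr_bound fG) mem_cat uc orbT.
have : is_bound v by rewrite -(fr_bound fH) mem_cat vd.
by rewrite /is_bound /is_input /is_output; case: is_wire; case: is_wire.
Qed.

Lemma glued_io u v : glued u v -> has_in v = ~~ has_in u /\ has_out v = ~~ has_out u.
Proof.
move=> p; have [uc vd] := glue_inr p; have [wu wv] := glued_wire p.
have bu : is_bound u by rewrite -(fr_bound fG) mem_cat uc orbT.
have bv : is_bound v by rewrite -(fr_bound fH) mem_cat vd.
have nu := fr_isolated fG u; have nv := fr_isolated fH v.
have : is_output u = is_input v.
  have [li eu ev] := glue_nth p; rewrite [in LHS]eu [in RHS]ev.
  have sG : size (codf G) = size Y.
    by have := congr1 size (fr_cod_type fG); rewrite !size_map.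
  have sH : size (domf H) = size Y by rewrite -glue_size.
  by rewrite -(nth_map u true (@is_output G)) ?sG //
    -(nth_map v true (@is_input H)) ?sH // (fr_cod_sign fG) (fr_dom_sign fH).
move: bu bv nu nv; rewrite /is_bound /is_isolated /is_input /is_output wu wv /=.
by do 4!case: has_in || case: has_out.
Qed.

Lemma glue_type_g v : vtype (g v) = vtype v.
Proof.
rewrite /=; have := connect_root (@glue_rel G H) (inl v).
move=> /glue_connect[<- //|]; rewrite glue_relE; case: root => // w.
by move/glued_type.
Qed.

Lemma glue_type_h v : vtype (h v) = vtype v.
Proof.
rewrite /=; have := connect_root (@glue_rel G H) (inr v).
move=> /glue_connect[<- //|]; rewrite glue_relE; case: root => // w.
by move/glued_type.
Qed.

Lemma glue_wire_g v : is_wire (g v) = is_wire v.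
Proof. by rewrite /is_wire glue_type_g. Qed.
Lemma glue_wire_h v : is_wire (h v) = is_wire v.
Proof. by rewrite /is_wire glue_type_h. Qed.

Lemma glue_in_gh u v : glued u v -> has_in (g u).
Proof.
move=> p; have [hi _] := glued_io p.
case hu: (has_in u); first case/existsP: hu => e /eqP he.
  by apply/existsP; exists (inl e); rewrite /= he.
rewrite hu in hi; case/existsP: hi => e /eqP he.
by apply/existsP; exists (inr e); rewrite /= he; apply/eqP; symmetry; apply/glue_gh.
Qed.

Lemma glue_out_gh u v : glued u v -> has_out (g u).
Proof.
move=> p; have [_ hi] := glued_io p.
case hu: (has_out u); first case/existsP: hu => e /eqP he.
  by apply/existsP; exists (inl e); rewrite /= he.
rewrite hu in hi; case/existsP: hi => e /eqP he.
by apply/existsP; exists (inr e); rewrite /= he; apply/eqP; symmetry; apply/glue_gh.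
Qed.

Lemma glue_in_g v : v \notin codf G -> has_in (g v) = has_in v.
Proof.
move=> nv; apply/existsP/existsP => [[[e|e] /eqP he]|[e /eqP he]].
- by exists e; apply/eqP/glue_gI.
- by case/esym/glue_gh/glue_inr: he; rewrite (negbTE nv).
- by exists (inl e); rewrite /= he.
Qed.

Lemma glue_out_g v : v \notin codf G -> has_out (g v) = has_out v.
Proof.
move=> nv; apply/existsP/existsP => [[[e|e] /eqP he]|[e /eqP he]].
- by exists e; apply/eqP/glue_gI.
- by case/esym/glue_gh/glue_inr: he; rewrite (negbTE nv).
- by exists (inl e); rewrite /= he.
Qed.

Lemma glue_in_h v : v \notin domf H -> has_in (h v) = has_in v.
Proof.
move=> nv; apply/existsP/existsP => [[[e|e] /eqP he]|[e /eqP he]].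
- by case/glue_gh/glue_inr: he; rewrite (negbTE nv).
- by exists e; apply/eqP/glue_hI.
- by exists (inr e); rewrite /= he.
Qed.

Lemma glue_out_h v : v \notin domf H -> has_out (h v) = has_out v.
Proof.
move=> nv; apply/existsP/existsP => [[[e|e] /eqP he]|[e /eqP he]].
- by case/glue_gh/glue_inr: he; rewrite (negbTE nv).
- by exists e; apply/eqP/glue_hI.
- by exists (inr e); rewrite /= he.
Qed.

Lemma glue_bound_g v : is_bound (g v) = (v \in domf G).
Proof.
have un := fr_uniq fG; case: (boolP (v \in codf G)) => vc.
  have [w p] := glue_l vc.
  rewrite /is_bound /is_input /is_output (glue_in_gh p) (glue_out_gh p) !andbF /=.
  by move: un; rewrite cat_uniq => /and3P[_ /hasPn/(_ _ vc)/negbTE].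
rewrite /is_bound /is_input /is_output glue_in_g // glue_out_g // glue_wire_g.
by have := fr_bound fG v; rewrite mem_cat (negbTE vc) orbF => ->.
Qed.

Lemma glue_bound_h v : is_bound (h v) = (v \in codf H).
Proof.
have un := fr_uniq fH; case: (boolP (v \in domf H)) => vd.
  have [w p] := glue_r vd; have /glue_gh <- := p.
  rewrite /is_bound /is_input /is_output (glue_in_gh p) (glue_out_gh p) !andbF /=.
  move: un; rewrite uniq_catC cat_uniq => /and3P[_ /hasPn/(_ _ vd) nv _].
  by rewrite (negbTE nv).
rewrite /is_bound /is_input /is_output glue_in_h // glue_out_h // glue_wire_h.
by have := fr_bound fH v; rewrite mem_cat (negbTE vd) /= => ->.
Qed.

Lemma framed_comp : framed X Z W.
Proof.
have [[tG iG oG bG] nG dtG ctG uG bdG dsG csG] := fG.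
have [[tH iH oH bH] nH dtH ctH uH bdH dsH csH] := fH.
have inin e1 e2 : glued (ctgt e1) (ctgt e2) -> False.
  case/glued_io=> + _; have -> : has_in (ctgt e1) by apply/existsP; exists e1.
  by have -> : has_in (ctgt e2) by apply/existsP; exists e2.
have outout e1 e2 : glued (csrc e1) (csrc e2) -> False.
  case/glued_io=> _; have -> : has_out (csrc e1) by apply/existsP; exists e1.
  by have -> : has_out (csrc e2) by apply/existsP; exists e2.
have disj v : v \in codf G -> v \notin domf G.
  move: (uG); rewrite cat_uniq => /and3P[_ /hasPn hn _]; exact: hn.
have disj' v : v \in domf H -> v \notin codf H.
  move: (uH); rewrite uniq_catC cat_uniq => /and3P[_ /hasPn hn _]; exact: hn.
split; first split.
- case=> e; first by have [<- <-] := tG e; split; apply: glue_type_g.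
  by have [<- <-] := tH e; split; apply: glue_type_h.
- case=> e1 [] e2 w /= eq.
  + by congr inl; apply: iG; [rewrite -glue_wire_g | apply: glue_gI].
  + by case: (inin e1 e2); apply/glue_gh.
  + by case: (inin e2 e1); apply/glue_gh.
  + by congr inr; apply: iH; [rewrite -glue_wire_h | apply: glue_hI].
- case=> e1 [] e2 w /= eq.
  + by congr inl; apply: oG; [rewrite -glue_wire_g | apply: glue_gI].
  + by case: (outout e1 e2); apply/glue_gh.
  + by case: (outout e2 e1); apply/glue_gh.
  + by congr inr; apply: oH; [rewrite -glue_wire_h | apply: glue_hI].
- elim/glue_case => b wb t; rewrite ?glue_type_g ?glue_type_h => ht.
    rewrite glue_wire_g in wb.
    have [e [[he te] ue]] := bG b wb t ht; exists (inl e); split.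
      by split=> //=; case: he => ->; [left | right].
    case=> e' [he' te'].
      by congr inl; apply: ue; split=> //; case: he' => /glue_gI; [left | right].
    by case: he' => /esym/glue_gh/glued_wire[]; rewrite (negbTE wb).
  rewrite glue_wire_h in wb.
  have [e [[he te] ue]] := bH b wb t ht; exists (inr e); split.
    by split=> //=; case: he => ->; [left | right].
  case=> e' [he' te'].
    by case: he' => /glue_gh/glued_wire[_]; rewrite (negbTE wb).
  by congr inr; apply: ue; split=> //; case: he' => /glue_hI; [left | right].
- elim/glue_case => v; rewrite /is_isolated.
    case: (boolP (v \in codf G)) => vc.
      have [w p] := glue_l vc.
      by rewrite /is_input (glue_in_gh p) andbF.
    by rewrite /is_input /is_output glue_in_g // glue_out_g // glue_wire_g; apply: nG.
  case: (boolP (v \in domf H)) => vd.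
    have [w p] := glue_r vd; have /glue_gh <- := p.
    by rewrite /is_input (glue_in_gh p) andbF.
  by rewrite /is_input /is_output glue_in_h // glue_out_h // glue_wire_h; apply: nH.
- by rewrite -dtG -map_comp; apply: eq_map => v; apply: glue_type_g.
- by rewrite -ctH -map_comp; apply: eq_map => v; apply: glue_type_h.
- rewrite cat_uniq !map_inj_uniq; [|exact: glue_hI|exact: glue_gI].
  move: (uG) (uH); rewrite !cat_uniq => /and3P[-> _ _] /and3P[_ _ ->]; rewrite andbT /=.
  apply/hasPn => _ /mapP[v vc ->]; apply/mapP => -[u ud /esym/glue_gh/glue_inr[uc _]].
  by case/negP: (disj u uc).
- elim/glue_case => v; rewrite mem_cat.
    rewrite glue_bound_g (mem_map glue_gI); case: (v \in _) => //=.
    by apply/mapP => -[w wc /glue_gh/glue_inr[_ /disj'/negP]].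
  rewrite glue_bound_h (mem_map glue_hI) orbC; case: (v \in codf H) => //=.
  by apply/mapP => -[w wc /esym/glue_gh/glue_inr[/disj/negP]].
- rewrite -dsG -map_comp; apply/eq_in_map => v vd.
  rewrite /= /is_input glue_wire_g glue_in_g //.
  by apply/negP => /disj; rewrite vd.
- rewrite -csH -map_comp; apply/eq_in_map => v vd.
  rewrite /= /is_output glue_wire_h glue_out_h //.
  by apply/negP => /disj'; rewrite vd.
Qed.
End Glue.

Section Trace.
Variables (U A B : seq letter) (G : cospan).
Hypothesis fG : framed (A ++ U) (B ++ U) G.
Let W := cospan_tr U A B G.
Let l := trace_wires U A B G.
Let dU := drop (size A) (domf G).
Let cU := drop (size B) (codf G).

Let wsrc (p : letter * (cvert G * cvert G)) := if p.1.1 then p.2.2 else p.2.1.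
Let wtgt (p : letter * (cvert G * cvert G)) := if p.1.1 then p.2.1 else p.2.2.

Lemma tr_dom_split : domf G = domf W ++ dU.
Proof. by rewrite cat_take_drop. Qed.
Lemma tr_cod_split : codf G = codf W ++ cU.
Proof. by rewrite cat_take_drop. Qed.

Lemma tr_size_dom : size (domf G) = size A + size U.
Proof. by have := congr1 size (fr_dom_type fG); rewrite !size_map size_cat. Qed.
Lemma tr_size_cod : size (codf G) = size B + size U.
Proof. by have := congr1 size (fr_cod_type fG); rewrite !size_map size_cat. Qed.
Lemma tr_size_dU : size dU = size U.
Proof. by rewrite size_drop tr_size_dom addKn. Qed.
Lemma tr_size_cU : size cU = size U.
Proof. by rewrite size_drop tr_size_cod addKn. Qed.
Lemma tr_size_l : size l = size U.
Proof. by rewrite !size_zip -/dU -/cU tr_size_dU tr_size_cU !minnn. Qed.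

Lemma tr_map (S : Type) (f : cvert G -> S) (k : letter -> S) s C :
  [seq f v | v <- s] = [seq k x | x <- C ++ U] ->
  [seq f v | v <- take (size C) s] = map k C
  /\ [seq f v | v <- drop (size C) s] = map k U.
Proof.
move=> e; rewrite map_take map_drop e map_cat take_size_cat ?drop_size_cat //;
  by rewrite size_map.
Qed.

Lemma tr_edge (i : 'I_(size l)) :
  exists x u v, [/\ tnth (in_tuple l) i = (x, (u, v)),
    [/\ u = nth u dU i & v = nth v cU i],
    [/\ u \in dU & v \in cU],
    [/\ vtype u = inl x.2 & vtype v = inl x.2]
  & [/\ is_input u = x.1 & is_output v = x.1]].
Proof.
have li : i < size U by rewrite -tr_size_l.
case E: (tnth (in_tuple l) i) => [x [u v]]; exists x, u, v.
have : nth (x, (u, v)) l i = (x, (u, v)) by rewrite -[RHS]E (tnth_nth (x, (u, v))).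
rewrite /l /trace_wires nth_zip; last first.
  by rewrite size_zip -/dU -/cU tr_size_dU tr_size_cU minnn.
rewrite nth_zip -/dU -/cU ?tr_size_dU ?tr_size_cU // => -[ex eu ev].
have ud : u \in dU by rewrite -eu mem_nth // tr_size_dU.
have vc : v \in cU by rewrite -ev mem_nth // tr_size_cU.
have [_ dt] := tr_map (fr_dom_type fG); have [_ ds] := tr_map (fr_dom_sign fG).
have [_ ct] := tr_map (fr_cod_type fG); have [_ cs] := tr_map (fr_cod_sign fG).
split=> //; split.
- have := congr1 (fun s => nth (vtype u) s i) dt.
  by rewrite (nth_map u) ?tr_size_dU // eu (nth_map x) // ex.
- have := congr1 (fun s => nth (vtype v) s i) ct.
  by rewrite (nth_map v) ?tr_size_cU // ev (nth_map x) // ex.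
- have := congr1 (fun s => nth true s i) ds.
  by rewrite (nth_map u) ?tr_size_dU // eu (nth_map x) // ex.
- have := congr1 (fun s => nth true s i) cs.
  by rewrite (nth_map v) ?tr_size_cU // ev (nth_map x) // ex.
Qed.

Lemma tr_mem_edge p : p \in dU ++ cU -> exists i : 'I_(size l),
  exists x u v, tnth (in_tuple l) i = (x, (u, v)) /\ (p = u \/ p = v).
Proof.
suff aux k : k < size U -> p = nth p dU k \/ p = nth p cU k ->
    exists i : 'I_(size l), exists x u v,
    tnth (in_tuple l) i = (x, (u, v)) /\ (p = u \/ p = v).
  rewrite mem_cat => /orP[] h; [apply: (aux (index p dU)) | apply: (aux (index p cU))].
  - by rewrite -tr_size_dU index_mem; exact: h.
  - by left; rewrite nth_index.
  - by rewrite -tr_size_cU index_mem; exact: h.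
  - by right; rewrite nth_index.
rewrite -tr_size_l => lk h; exists (Ordinal lk).
have [x [u [v [E [eu ev] [ud vc] _ _]]]] := tr_edge (Ordinal lk).
exists x, u, v; split=> //.
have lk' : k < size U by rewrite -tr_size_l.
case: h => h; [left; rewrite eu h | right; rewrite ev h]; apply: set_nth_default.
  by rewrite tr_size_dU.
by rewrite tr_size_cU.
Qed.

Lemma tr_bound v : v \in dU ++ cU -> is_bound v.
Proof.
by rewrite -(fr_bound fG) tr_dom_split tr_cod_split !mem_cat => /orP[] ->;
  rewrite !orbT.
Qed.

Lemma tr_wire v : v \in dU ++ cU -> is_wire v.
Proof. by move/tr_bound; rewrite /is_bound /is_input /is_output; case: is_wire. Qed.

Lemma tr_edge_tgt (i : 'I_(size l)) : let v := ctgt (inr i : cedge W) : cvert G in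
  [/\ v \in dU ++ cU, ~~ has_in v & vtype v = inl (tnth (in_tuple l) i).1.2].
Proof.
have [x [u [v [E _ [ud vc] [tu tv] [su sv]]]]] := tr_edge i; rewrite /= -/l E /=.
have bu : u \in dU ++ cU by rewrite mem_cat ud.
have bv : v \in dU ++ cU by rewrite mem_cat vc orbT.
case: x => -[] o /= in E tu tv su sv *; split=> //.
  by case/andP: su.
have := tr_bound bv; rewrite /is_bound sv orbF => /andP[] //.
Qed.

Lemma tr_edge_src (i : 'I_(size l)) : let v := csrc (inr i : cedge W) : cvert G in
  [/\ v \in dU ++ cU, ~~ has_out v & vtype v = inl (tnth (in_tuple l) i).1.2].
Proof.
have [x [u [v [E _ [ud vc] [tu tv] [su sv]]]]] := tr_edge i; rewrite /= -/l E /=.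
have bu : u \in dU ++ cU by rewrite mem_cat ud.
have bv : v \in dU ++ cU by rewrite mem_cat vc orbT.
case: x => -[] o /= in E tu tv su sv *; split=> //.
  by case/andP: sv.
by have := tr_bound bu; rewrite /is_bound su => /andP[].
Qed.

Lemma tr_uniq : uniq (dU ++ cU).
Proof.
have := fr_uniq fG; rewrite tr_dom_split tr_cod_split -catA cat_uniq => /and3P[_ _].
by rewrite catA uniq_catC catA cat_uniq => /and3P[]; rewrite uniq_catC.
Qed.

Lemma tr_end_inj (i j : 'I_(size l)) : forall x u v x' u' v',
  tnth (in_tuple l) i = (x, (u, v)) -> tnth (in_tuple l) j = (x', (u', v')) ->
  u = u' \/ v = v' \/ u = v' \/ v = u' -> i = j.
Proof.
move=> x u v x' u' v' E E'.
have [x1 [u1 [v1 [E1 [eu ev] [ud vc] _ _]]]] := tr_edge i.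
move: E1; rewrite E => -[? ? ?]; subst x1 u1 v1.
have [x1 [u1 [v1 [E1 [eu' ev'] [ud' vc'] _ _]]]] := tr_edge j.
move: E1; rewrite E' => -[? ? ?]; subst x1 u1 v1.
have li (k : 'I_(size l)) : k < size U by rewrite -tr_size_l.
have := tr_uniq; rewrite cat_uniq => /and3P[ud0 /hasPn hn uc0].
move=> [e|[e|[e|e]]].
- rewrite -e in eu'; apply/val_inj/eqP.
  by rewrite /= -(nth_uniq u _ _ ud0) ?tr_size_dU // -eu -eu'.
- rewrite -e in ev'; apply/val_inj/eqP.
  by rewrite /= -(nth_uniq v _ _ uc0) ?tr_size_cU // -ev -ev'.
- by have := hn _ vc'; rewrite -e /= ud.
- by have := hn _ vc; rewrite e /= ud'.
Qed.

Lemma tr_in_old v : v \notin dU ++ cU -> has_in (G := W) v = has_in v.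
Proof.
move=> nv; apply/existsP/existsP => [[[e|i]] he|[e he]].
- by exists e.
- by have [] := tr_edge_tgt i; rewrite (eqP he) (negbTE nv).
- by exists (inl e).
Qed.

Lemma tr_out_old v : v \notin dU ++ cU -> has_out (G := W) v = has_out v.
Proof.
move=> nv; apply/existsP/existsP => [[[e|i]] he|[e he]].
- by exists e.
- by have [] := tr_edge_src i; rewrite (eqP he) (negbTE nv).
- by exists (inl e).
Qed.

Lemma tr_in_new v : v \in dU ++ cU -> has_in (G := W) v && has_out (G := W) v.
Proof.
move=> nv; have [i [x [u [w [E h]]]]] := tr_mem_edge nv.
have [? [? [? [+ _ [ud wc] _ [su sw]]]]] := tr_edge i.
rewrite E => -[? ? ?]; subst.
have keep_in : has_in (G := G) v -> has_in (G := W) v.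
  by case/existsP=> e he; apply/existsP; exists (inl e).
have keep_out : has_out (G := G) v -> has_out (G := W) v.
  by case/existsP=> e he; apply/existsP; exists (inl e).
have bv := tr_bound nv; have wv := tr_wire nv; have iv := fr_isolated fG v.
have new_in : is_input v -> has_in (G := W) v.
  move=> iv'; apply/existsP; exists (inr i); rewrite /= -/l E.
  case: h => h; subst; first by rewrite -su iv'.
  by rewrite -sw; move: iv; rewrite /is_isolated iv' /= => /negbTE ->.
have new_out : is_output v -> has_out (G := W) v.
  move=> iv'; apply/existsP; exists (inr i); rewrite /= -/l E.
  case: h => h; subst; last by rewrite -sw iv'.
  by rewrite -su; move: iv; rewrite /is_isolated iv' andbT /= => /negbTE ->.
apply/andP; split.
  case: (boolP (has_in (G := G) v)) => [/keep_in //|hi].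
  by apply: new_in; rewrite /is_input wv.
case: (boolP (has_out (G := G) v)) => [/keep_out //|hi].
by apply: new_out; rewrite /is_output wv.
Qed.

Lemma framed_tr : framed A B W.
Proof.
have [[tG iG oG bG] nG dtG ctG uG bdG dsG csG] := fG.
have disj : uniq ((domf W ++ codf W) ++ (dU ++ cU)).
  move: uG; rewrite {1}tr_dom_split {1}tr_cod_split.
  by rewrite (perm_uniq (s2 := (domf W ++ codf W) ++ (dU ++ cU))) // perm_catACA.
have bW (v : cvert G) : is_bound (G := W) v = is_bound (G := G) v && (v \notin dU ++ cU).
  case: (boolP (v \in dU ++ cU)) => h.
    have /andP[hi ho] := tr_in_new h.
    by rewrite andbF /is_bound /is_input /is_output hi ho !andbF.
  by rewrite andbT /is_bound /is_input /is_output tr_in_old // tr_out_old.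
have nin v : v \in domf W ++ codf W -> v \notin dU ++ cU.
  move=> vW; move: disj; rewrite uniq_catC cat_uniq => /and3P[_ /hasPn hn _].
  exact: hn.
have memG (v : cvert G) : is_bound (G := G) v = (v \in domf W ++ codf W) || (v \in dU ++ cU).
  rewrite -bdG {1}tr_dom_split {1}tr_cod_split !mem_cat.
  by rewrite -!orbA; congr orb; rewrite orbCA.
split; first split.
- case=> [e|i]; first exact: tG.
  have [_ _ ht] := tr_edge_tgt i; have [_ _ hs] := tr_edge_src i.
  by rewrite [vtype _]hs [vtype (ctgt _)]ht.
- case=> [e1|i] [e2|j] w e.
  + by congr inl; apply: iG w e.
  + have [_ + _] := tr_edge_tgt j; rewrite -e /= => /existsP[]; by exists e1.
  + have [_ + _] := tr_edge_tgt i; rewrite e /= => /existsP[]; by exists e2.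
  + congr inr; have [x [u [v [E _ _ _ _]]]] := tr_edge i.
    have [x' [u' [v' [E' _ _ _ _]]]] := tr_edge j.
    apply: (tr_end_inj E E'); move: e; rewrite /= -/l E E'.
    by case: ifP => _; case: ifP => _ ->; tauto.
- case=> [e1|i] [e2|j] w e.
  + by congr inl; apply: oG w e.
  + have [_ + _] := tr_edge_src j; rewrite -e /= => /existsP[]; by exists e1.
  + have [_ + _] := tr_edge_src i; rewrite e /= => /existsP[]; by exists e2.
  + congr inr; have [x [u [v [E _ _ _ _]]]] := tr_edge i.
    have [x' [u' [v' [E' _ _ _ _]]]] := tr_edge j.
    apply: (tr_end_inj E E'); move: e; rewrite /= -/l E E'.
    by case: ifP => _; case: ifP => _ ->; tauto.
- move=> b wb t ht; have [e [he ue]] := bG b wb t ht; exists (inl e); split=> //.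
  case=> [e'|i] [he' te']; first by congr inl; apply: ue.
  case/negP: wb; case: he' => <-.
    by have [/tr_wire] := tr_edge_src i.
  by have [/tr_wire] := tr_edge_tgt i.
- move=> v; case: (boolP (v \in dU ++ cU)) => h.
    have /andP[hi ho] := tr_in_new h.
    by rewrite /is_isolated /is_input hi andbF.
  by rewrite /is_isolated /is_input /is_output tr_in_old // tr_out_old //; apply: nG.
- by have [] := tr_map dtG.
- by have [] := tr_map ctG.
- by move: disj; rewrite cat_uniq => /and3P[].
- move=> v; rewrite bW memG.
  case: (boolP (v \in domf W ++ codf W)) => [/nin -> //|_] /=.
  by rewrite andbN.
- have [<- _] := tr_map dsG; apply/eq_in_map => v vd.
  by rewrite /is_input tr_in_old //; apply: nin; rewrite mem_cat vd.
- have [<- _] := tr_map csG; apply/eq_in_map => v vd.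
  by rewrite /is_output tr_out_old //; apply: nin; rewrite mem_cat vd orbT.
Qed.
End Trace.

Definition positive (X : seq letter) : bool := all fst X.

Definition pos_word (w : seq (sobj T)) : seq letter := [seq (true, o) | o <- w].

Lemma framed_box (f : smor T) :
  framed (pos_word (sdom f)) (pos_word (scod f)) (cospan_box f).
Proof.
set W := cospan_box f.
have mapS (S R : Type) (k : S -> R) (s : seq S) :
    [seq k (tnth (in_tuple s) i) | i <- enum 'I_(size s)] = [seq k y | y <- s].
  by rewrite map_comp map_tnth_enum.
have hin v : has_in (G := W) v = if v is Some (inl _) then false else
    if v is Some (inr _) then true else has_in v.
  case: v => [[i|j]|] //; last by apply/existsP; exists (inr j).
  by apply/existsP => -[[]].
have hout v : has_out (G := W) v = if v is Some (inl _) then true else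
    if v is Some (inr _) then false else has_out v.
  case: v => [[i|j]|] //; first by apply/existsP; exists (inl i).
  by apply/existsP => -[[]].
split; first split.
- by case.
- by case=> i [] j //= _ [->].
- by case=> i [] j //= _ [->].
- case=> [[]|] // _ t ht.
  have : (exists i, t = @in_edge f i) \/ (exists j, t = @out_edge f j).
    case: t ht => [X [] //|g i [//|/= [e]]|g j [/= [e]|//]].
      by left; subst g; exists i.
    by right; subst g; exists j.
  case=> -[i ->]; [exists (inl i) | exists (inr i)]; split; try by auto.
    case=> j [_ /= e] //; congr inl.
    by move: (f_equal (fun t => if t is in_edge g k then val k else 0) e) => /val_inj.
  case=> j [_ /= e] //; congr inr.
  by move: (f_equal (fun t => if t is out_edge g k then val k else 0) e) => /val_inj.
- by case=> [[i|j]|]; rewrite /is_isolated /is_input /is_output ?hin ?hout.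
- rewrite /pos_word -[LHS]map_comp -[RHS]map_comp -[RHS]mapS.
  by apply: eq_map.
- rewrite /pos_word -[LHS]map_comp -[RHS]map_comp -[RHS]mapS.
  by apply: eq_map.
- rewrite cat_uniq !map_inj_uniq -?enumT ?enum_uniq /=; try by move=> ? ? [].
  by rewrite andbT; apply/hasPn => _ /mapP[i _ ->]; apply/mapP => -[].
- have SI (S : eqType) (s : seq S) x : (Some x \in map Some s) = (x \in s).
    by rewrite mem_map // => ? ? [].
  have -> : domf W = map Some (map inl (enum 'I_(size (sdom f)))).
    by rewrite -[RHS]map_comp.
  have -> : codf W = map Some (map inr (enum 'I_(size (scod f)))).
    by rewrite -[RHS]map_comp.
  move=> v; rewrite -map_cat; case: v => [[i|j]|].
  + by rewrite SI mem_cat mem_inl mem_enum /is_bound /is_input hin.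
  + by rewrite SI mem_cat mem_inr mem_enum orbT /is_bound /is_output hout /= orbT.
  + by rewrite /is_bound /is_input /is_output /=; apply/mapP => -[].
- rewrite /pos_word -[LHS]map_comp -[RHS]map_comp -[RHS]mapS.
  by apply: eq_map => i; rewrite /= /is_input hin.
- rewrite /pos_word -[LHS]map_comp -[RHS]map_comp -[RHS]mapS.
  by apply: eq_map => i; rewrite /= /is_output hout.
Qed.

Definition fcospan_id (X : seq letter) : fcospan X X :=
  exist _ (cospan_id X) (framed_id X).

Definition fcospan_comp (X Y Z : seq letter) (H : fcospan Y Z) (G : fcospan X Y) :
    fcospan X Z :=
  exist _ (cospan_comp (sval G) (sval H)) (framed_comp (svalP G) (svalP H)).

Definition fcospan_tens (X Y X' Y' : seq letter)
    (G : fcospan X Y) (H : fcospan X' Y') : fcospan (X ++ X') (Y ++ Y') :=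
  exist _ (cospan_tens (sval G) (sval H)) (framed_tens (svalP G) (svalP H)).

Definition fcospan_symm (X Y : seq letter) : fcospan (X ++ Y) (Y ++ X) :=
  exist _ (cospan_symm X Y) (framed_symm X Y).

Definition fcospan_tr (U A B : seq letter) (G : fcospan (A ++ U) (B ++ U)) :
    fcospan A B :=
  exist _ (cospan_tr U A B (sval G)) (framed_tr (svalP G)).

Definition wclass (X Y : seq letter) : Type :=
  {c : fcospan X Y -> Prop | exists G, c = wire_homeo G}.

Definition cls (X Y : seq letter) (G : fcospan X Y) : wclass X Y :=
  exist _ (wire_homeo G) (ex_intro _ G erefl).

Definition rep (X Y : seq letter) (c : wclass X Y) : fcospan X Y :=
  proj1_sig (constructive_indefinite_description _ (proj2_sig c)).

(* The operations on classes are computed on chosen representatives; a priori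
   they depend on the choice. *)
Definition FCsp : sst_data := @SSTData
  (seq letter)
  wclass
  (fun X => cls (fcospan_id X))
  (fun X Y Z h g => cls (fcospan_comp (rep h) (rep g)))
  [::]
  (@cat letter)
  (@catA letter)
  (@cat0s letter)
  (@cats0 letter)
  (fun X X' Y Y' g h => cls (fcospan_tens (rep g) (rep h)))
  (fun X Y => cls (fcospan_symm X Y))
  (fun U A B g => cls (fcospan_tr (rep g))).

Lemma positive_cat (X Y : seq letter) :
  positive X -> positive Y -> positive (X ++ Y).
Proof. by rewrite /positive all_cat => -> ->. Qed.

Definition FCspP : sst_data :=
  @full_sub FCsp positive (isT : positive [::]) positive_cat.

Definition pcls (X Y : Ob FCspP) (G : fcospan (sval X) (sval Y)) : Hom X Y := cls G.

Definition pos_letter (o : sobj T) : Ob FCspP :=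
  exist _ [:: (true, o)] (isT : positive [:: (true, o)]).

Lemma sval_tensl (w : seq (sobj T)) :
  sval (tensl [seq pos_letter o | o <- w]) = pos_word w.
Proof. by elim: w => //= o w ->. Qed.

Lemma framed_box_tensl (f : smor T) :
  framed (sval (tensl [seq pos_letter o | o <- sdom f]))
         (sval (tensl [seq pos_letter o | o <- scod f])) (cospan_box f).
Proof. by rewrite !sval_tensl; apply: framed_box. Qed.

Definition canonical_sighom : sighom T FCspP :=
  @SigHom T FCspP pos_letter
    (fun f => pcls (exist _ (cospan_box f) (framed_box_tensl f))).

End StringGraphs.

(* Main.v *)
(* A string graph is studied through its links, the triples (source, target,
   type) of its edges.  If a map between framed string graphs collapses paths of
   wires, the two graphs are wire-homeomorphic; the laws of a symmetric traced
   category hold because the two sides contract to a common graph.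

   For freeness, label the wire-vertices of a graph G by themselves and call the
   boxes and the mid-edges its nodes.  Every label is produced once, by the
   domain or by a node, and consumed once, by the codomain or by a node.  The
   value of G in V is the trace, over the consumed labels, of the tensor product
   of the nodes followed by the permutation from produced to consumed labels.
   It does not depend on the order of the nodes, and by yanking it does not
   change when a wire is split, so it is a functor of the class of G.  Conversely
   G is a contraction of the trace of a permuted tensor product of its nodes, so
   its class is generated by the boxes and the functor is unique. *)
Require Import Defs.
From Stdlib Require Import Relation_Operators ClassicalEpsilon.
From Stdlib Require Import FunctionalExtensionality PropExtensionality ProofIrrelevance.
From mathcomp Require Import all_boot zify.

Set Implicit Arguments.
Unset Strict Implicit.
Unset Printing Implicit Defensive.

(** * Contraction of wires *)

Arguments csrc {T c} e.
Arguments ctgt {T c} e.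
Arguments vtype {T c} v.
Arguments etype {T c} e.

(** Isomorphisms and splittings read backwards are both contractions, and every nontrivial step of a
    contraction removes a vertex; hence an operation passes to classes as soon as it preserves
    contractions, and no zigzag of moves is handled directly. The pushout that defines composition
    has equivalence classes as vertices. It is avoided: joining the two graphs by wires gives a
    graph whose vertices form a plain sum, and composition becomes a tensor product, a reordering of
    the codomain and a trace, both for the laws and for the value in V. Treating mid-edges as nodes
    with value the identity serves the same purpose: tracing and splitting merely add identity nodes
    to a network. Positivity makes the domain frame an enumeration of the inputs and the codomain
    frame one of the outputs, so that all added wires run the same way. In V, permutations are given
    by words of distinct labels and never by indices; composites of permutations are then compared
    by their end words alone. *)

Lemma choose_fun (A B : Type) (P : A -> B -> Prop) :
  (forall a, exists b, P a b) -> exists f : A -> B, forall a, P a (f a).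
Proof.
move=> h; exists (fun a => proj1_sig (constructive_indefinite_description _ (h a))) => a.
exact: proj2_sig.
Qed.

Section Contraction.
Variable T : signature.
Implicit Types (G H K : cospan T) (X Y Z : seq (bool * sobj T)).

Definition link G (u v : cvert G) (t : type_edge T) :=
  exists e : cedge G, [/\ csrc e = u, ctgt e = v & etype e = t].

Lemma edge_link G (e : cedge G) : link (csrc e) (ctgt e) (etype e).
Proof. by exists e. Qed.

Lemma link_type G (u v : cvert G) t : typed G -> link u v t ->
  vtype u = src (g := typegraph T) t /\ vtype v = tgt (g := typegraph T) t.
Proof. by move=> tG [e [<- <- <-]]; apply: tG. Qed.

Lemma edge_wire G (e : cedge G) : typed G -> is_wire (csrc e) || is_wire (ctgt e).
Proof. by move/(_ e) => -[h k]; rewrite /is_wire h k; case: (etype e). Qed.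

(** No edge of the typegraph joins two boxes, so one end of an edge is a wire-vertex, where it is
    the only edge on its side. Hence links determine edges and lose no multiplicities. *)
Lemma edge_inj G (e e' : cedge G) : string_graph G ->
  csrc e = csrc e' -> ctgt e = ctgt e' -> e = e'.
Proof.
case=> tG iG oG _ hs ht; case/orP: (edge_wire e tG) => w; first exact: oG.
exact: iG.
Qed.

Lemma link_out_inj G (u v v' : cvert G) t t' : string_graph G -> is_wire u ->
  link u v t -> link u v' t' -> v = v'.
Proof.
case=> _ _ oG _ wu [e [hs <- _]] [e' [hs' <- _]].
by rewrite (oG e e') ?hs ?hs'.
Qed.

Lemma link_in_inj G (u u' v : cvert G) t t' : string_graph G -> is_wire v ->
  link u v t -> link u' v t' -> u = u'.
Proof.
case=> _ iG _ _ wu [e [<- ht _]] [e' [<- ht' _]].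
by rewrite (iG e e') ?ht ?ht'.
Qed.

Lemma has_inP G (v : cvert G) : reflect (exists u t, link u v t) (has_in v).
Proof.
apply: (iffP existsP) => [[e /eqP <-]|[u [t [e [_ <- _]]]]]; last by exists e.
by exists (csrc e), (etype e); exact: edge_link.
Qed.

Lemma has_outP G (v : cvert G) : reflect (exists u t, link v u t) (has_out v).
Proof.
apply: (iffP existsP) => [[e /eqP <-]|[u [t [e [<- _ _]]]]]; last by exists e.
by exists (ctgt e), (etype e); exact: edge_link.
Qed.

(** Positive letters of [X] sit at inputs. Conversely, an input lying in the codomain frame would
    also be an output, as [Y] is positive, and so isolated. *)
Lemma pos_dom X Y G (v : cvert G) : framed X Y G -> positive X -> positive Y ->
  (v \in domf G) = is_input v.
Proof.
move=> [_ iso _ _ _ bd ds cs] pX pY.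
apply/idP/idP => [vd|iv].
  have /allP/(_ (is_input v) (map_f _ vd)) : all id [seq is_input v | v <- domf G].
    by rewrite ds all_map.
  by [].
have := bd v; rewrite mem_cat /is_bound iv => /orP[//|vc].
have /allP/(_ (is_output v) (map_f _ vc)) : all id [seq is_output v | v <- codf G].
  by rewrite cs all_map.
by move=> /= ov; have := iso v; rewrite /is_isolated iv ov.
Qed.

Lemma pos_cod X Y G (v : cvert G) : framed X Y G -> positive X -> positive Y ->
  (v \in codf G) = is_output v.
Proof.
move=> [_ iso _ _ _ bd ds cs] pX pY.
apply/idP/idP => [vd|iv].
  have /allP/(_ (is_output v) (map_f _ vd)) : all id [seq is_output v | v <- codf G].
    by rewrite cs all_map.
  by [].
have := bd v; rewrite mem_cat /is_bound iv orbT => /orP[vc|//].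
have /allP/(_ (is_input v) (map_f _ vc)) : all id [seq is_input v | v <- domf G].
  by rewrite ds all_map.
by move=> /= ov; have := iso v; rewrite /is_isolated iv ov.
Qed.

(* [pv] collapses each maximal path of contracted links of [G] to one vertex of
   [H]; [rk] excludes that a closed loop disappears. *)
Record collapse G H (pv : cvert G -> cvert H) (C : rel (cvert G))
    (rk : cvert G -> nat) : Prop := Collapse {
  co_type : forall u, vtype (pv u) = vtype u;
  co_onto : forall a, exists u, pv u = a;
  co_path : forall u v, C u v -> [/\ pv u = pv v, rk u < rk v & exists t, link u v t];
  co_link : forall u v t, link u v t -> C u v \/ link (pv u) (pv v) t;
  co_lift : forall a b t, link a b t ->
    exists u v, [/\ pv u = a, pv v = b, link u v t & ~~ C u v];
  co_head : forall u v, pv u = pv v ->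
    (forall w, ~~ C w u) -> (forall w, ~~ C w v) -> u = v }.

Definition contr G H : Prop := exists pv C rk, [/\ @collapse G H pv C rk,
  domf H = [seq pv v | v <- domf G] & codf H = [seq pv v | v <- codf G]].

Lemma Contr G H (pv : cvert G -> cvert H) (C : rel (cvert G)) (rk : cvert G -> nat) :
    (forall u, vtype (pv u) = vtype u) ->
    (forall a, exists u, pv u = a) ->
    (forall u v, C u v -> [/\ pv u = pv v, rk u < rk v & exists t, link u v t]) ->
    (forall u v t, link u v t -> C u v \/ link (pv u) (pv v) t) ->
    (forall a b t, link a b t ->
      exists u v, [/\ pv u = a, pv v = b, link u v t & ~~ C u v]) ->
    (forall u v, pv u = pv v -> (forall w, ~~ C w u) -> (forall w, ~~ C w v) -> u = v) ->
    domf H = [seq pv v | v <- domf G] -> codf H = [seq pv v | v <- codf G] ->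
  contr G H.
Proof. by move=> *; exists pv, C, rk; split=> //; split. Qed.

Lemma contr_bij G H (pv : cvert G -> cvert H) :
    bijective pv -> (forall u, vtype (pv u) = vtype u) ->
    (forall u v t, link u v t <-> link (pv u) (pv v) t) ->
    domf H = [seq pv v | v <- domf G] -> codf H = [seq pv v | v <- codf G] ->
  contr G H.
Proof.
move=> bpv ht ha hd hc; have [qv qK pK] := bpv.
apply: (@Contr _ _ pv (fun _ _ => false) (fun _ => 0)) => //.
- by move=> a; exists (qv a).
- by move=> u v t /ha; right.
- move=> a b t; rewrite -(pK a) -(pK b) => /ha h.
  by exists (qv a), (qv b).
- by move=> u v h _ _; apply: (can_inj qK).
Qed.

(** The edge maps in both directions are chosen from the links; [edge_inj] makes them mutually
    inverse. *)
Lemma cospan_iso_link G H (fv : cvert G -> cvert H) :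
    string_graph G -> string_graph H ->
    bijective fv -> (forall u, vtype (fv u) = vtype u) ->
    (forall u v t, link u v t <-> link (fv u) (fv v) t) ->
    domf H = [seq fv v | v <- domf G] -> codf H = [seq fv v | v <- codf G] ->
  cospan_iso G H.
Proof.
move=> sG sH bfv ht ha hd hc.
have [fe feP] : exists fe : cedge G -> cedge H, forall e,
    [/\ csrc (fe e) = fv (csrc e), ctgt (fe e) = fv (ctgt e) & etype (fe e) = etype e].
  apply: (@choose_fun _ _ (fun e e' => [/\ csrc e' = fv (csrc e), ctgt e' = fv (ctgt e)
    & etype e' = etype e])) => e; have /ha [e' [h1 h2 h3]] := edge_link e; by exists e'.
have [ge geP] : exists ge : cedge H -> cedge G, forall e,
    fv (csrc (ge e)) = csrc e /\ fv (ctgt (ge e)) = ctgt e.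
  apply: (@choose_fun _ _ (fun e e' => fv (csrc e') = csrc e /\ fv (ctgt e') = ctgt e)) => e.
  have [gv _ fK] := bfv.
  have := edge_link e; rewrite -{1}(fK (csrc e)) -{1}(fK (ctgt e)).
  by case/ha=> e' [h1 h2 _]; exists e'; rewrite h1 h2 !fK.
exists fv, fe; split=> //; try by move=> e; have [] := feP e.
split=> //; exists ge => e.
  have [h1 h2 _] := feP e; have [h3 h4] := geP (fe e).
  by apply: (edge_inj sG); apply: (bij_inj bfv); rewrite ?h3 ?h4 ?h1 ?h2.
have [h1 h2 _] := feP (ge e); have [h3 h4] := geP e.
by apply: (edge_inj sH); rewrite ?h1 ?h2 ?h3 ?h4.
Qed.

(** * Contracting a single wire *)

Section ContractEdge.
Variables (X Y : seq (bool * sobj T)) (G : cospan T) (u0 v0 : cvert G).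
Variables (t0 : type_edge T).
Hypotheses (fG : framed X Y G) (pX : positive X) (pY : positive Y) (uv0 : link u0 v0 t0) (wu0 : is_wire u0).
Hypotheses (wv0 : is_wire v0) (nuv0 : u0 != v0).
Hypothesis nio : ~~ (is_input u0 && is_output v0).

(** The default [u0] of [insubd] makes this the quotient map that merges [v0] into [u0]. *)
Definition keep : cvert G -> {x | x != v0} := insubd (exist _ u0 nuv0).

Lemma val_keep x : val (keep x) = if x == v0 then u0 else x.
Proof. by rewrite val_insubd; case: eqP. Qed.

Lemma keepK (x : {x | x != v0}) : keep (val x) = x.
Proof. by apply: val_inj; rewrite val_keep (negbTE (valP x)). Qed.

(** Being a wire-vertex, [v0] has a single in-edge, so dropping the edges into [v0] drops only the
    wire from [u0]. *)
Definition contract_edge : cospan T :=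
  {| cvert := {x | x != v0};
     cedge := {e : cedge G | ctgt e != v0};
     csrc e := keep (csrc (val e));
     ctgt e := exist _ (ctgt (val e)) (valP e);
     vtype x := vtype (val x);
     etype e := etype (val e);
     domf := map keep (domf G);
     codf := map keep (codf G) |}.
Let G' := contract_edge.
Let sG := fr_string fG.

Lemma keep_link x (y : cvert G') t : link x (val y) t -> link (keep x : cvert G') y t.
Proof.
case=> e [<- h <-]; have he : ctgt e != v0 by rewrite h (valP y).
by exists (exist _ e he); split=> //; apply: val_inj.
Qed.

(** The merged vertex keeps the in-link of [u0] and takes over the out-link of [v0], since the only
    out-link of [u0] is the contracted one. *)
Lemma contract_link (x y : cvert G') t :
  link x y t <-> link (if val x == u0 then v0 else val x) (val y) t.
Proof.
split=> [[[e he] /= [<- <- <-]]|h].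
  rewrite val_keep; case: (eqVneq (csrc e) v0) => [ev|nv]; first by rewrite eqxx; exists e.
  case: eqVneq => [eu|_]; last by exists e.
  by case/eqP: he; apply: (link_out_inj sG wu0 _ uv0); exists e.
suff -> : x = keep (if val x == u0 then v0 else val x) by apply: keep_link.
apply: val_inj; rewrite val_keep; case: (eqVneq (val x) u0) => [->|_].
  by rewrite eqxx.
by rewrite (negbTE (valP x)).
Qed.

Lemma contract_type x : vtype (keep x : cvert G') = vtype x.
Proof.
rewrite /= val_keep; case: eqP => // ->.
have [hu hv] := link_type (sg_typed sG) uv0.
by move: wu0 wv0; rewrite /is_wire hu hv; case: (t0).
Qed.

Lemma contract_wire x : is_wire (keep x : cvert G') = is_wire x.
Proof. by rewrite /is_wire contract_type. Qed.

Lemma contract_in x : x != v0 -> has_in (keep x : cvert G') = has_in x.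
Proof.
move=> nx; have vx : val (keep x) = x by rewrite val_keep (negbTE nx).
apply/has_inP/has_inP => [[y [t /contract_link]]|[y [t h]]].
  by rewrite vx => h; eexists; exists t; exact: h.
by exists (keep y), t; apply: keep_link; rewrite vx.
Qed.

Lemma contract_out x : x != u0 -> has_out (keep x : cvert G') = has_out x.
Proof.
move=> nx; have vx : (if val (keep x) == u0 then v0 else val (keep x)) = x.
  by rewrite val_keep; case: (eqVneq x v0) => [->|_]; rewrite ?eqxx ?(negbTE nx).
apply/has_outP/has_outP => [[y [t /contract_link]]|[y [t h]]].
  by rewrite vx => h; eexists; exists t; exact: h.
exists (keep y), t; apply/contract_link; rewrite vx val_keep; case: eqP => // yv.
by rewrite yv in h; case/eqP: nx; apply: (link_in_inj sG wv0 h uv0).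
Qed.

Lemma hin_v0 : has_in v0. Proof. by apply/has_inP; exists u0, t0. Qed.
Lemma hout_u0 : has_out u0. Proof. by apply/has_outP; exists v0, t0. Qed.

Lemma in_v0 x : (keep x == keep v0 :> cvert G') = (x == u0) || (x == v0).
Proof.
rewrite -val_eqE /= !val_keep eqxx.
by case: (eqVneq x v0); rewrite ?eqxx ?orbT ?orbF.
Qed.

Lemma contract_input x : x != v0 -> is_input (keep x : cvert G') = is_input x.
Proof. by move=> nx; rewrite /is_input contract_wire contract_in. Qed.

Lemma contract_output x : x != u0 -> is_output (keep x : cvert G') = is_output x.
Proof. by move=> nx; rewrite /is_output contract_wire contract_out. Qed.

Lemma keep_uv : keep u0 = keep v0.
Proof. by apply/eqP; rewrite in_v0 eqxx. Qed.

Lemma bound_uv : u0 \in domf G ++ codf G -> v0 \in domf G ++ codf G -> False.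
Proof.
rewrite !(fr_bound fG) /is_bound.
rewrite [is_output u0]/is_output hout_u0 [is_input v0]/is_input hin_v0.
by rewrite !andbF orbF /= => hi ho; case/negP: nio; rewrite hi.
Qed.

Lemma keep_inj_in : {in domf G ++ codf G &, injective (keep : cvert G -> cvert G')}.
Proof.
move=> x y xb yb /(congr1 val); rewrite !val_keep.
case: (eqVneq x v0) => [ex|_]; case: (eqVneq y v0) => [ey|_] // e.
- by rewrite ex ey.
- by case: bound_uv; rewrite -?ex // e.
- by case: bound_uv; rewrite -?ey // -e.
Qed.

Lemma contract_bound x :
  is_bound (keep x : cvert G') =
    if (x == u0) || (x == v0) then is_input u0 || is_output v0 else is_bound x.
Proof.
rewrite -in_v0; case: eqP => [->|/eqP]; rewrite /is_bound.
  by rewrite -[in LHS]keep_uv contract_input // keep_uv contract_output // eq_sym.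
by rewrite in_v0 negb_or => /andP[h h']; rewrite contract_input // contract_output.
Qed.

(** The merged vertex is an input iff [u0] is and an output iff [v0] is; [nio] excludes both at
    once, which would make it isolated. *)
Lemma framed_contract : framed X Y G'.
Proof.
have [[tG iG oG bG] nG dtG ctG uG bdG dsG csG] := fG.
have nd : v0 \notin domf G by rewrite (pos_dom _ fG) // /is_input hin_v0 andbF.
have nc : u0 \notin codf G by rewrite (pos_cod _ fG) // /is_output hout_u0 andbF.
have surj (P : cvert G' -> Prop) : (forall x, P (keep x)) -> forall x, P x.
  by move=> h x; rewrite -(keepK x).
split; first split.
- case=> e he; have [hs ht] := tG e; split; last exact: ht.
  by rewrite -hs; apply: contract_type.
- case=> e1 h1 [e2 h2] w [] h; apply: val_inj; apply: iG => //.
- move=> e1 e2; rewrite [is_wire _]contract_wire => w h; apply: val_inj; apply: oG => //.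
  move/(congr1 val): h; rewrite /= !val_keep.
  case: (eqVneq (csrc (val e1)) v0) => [h1|n1]; case: (eqVneq (csrc (val e2)) v0) => [h2|n2] // h.
  + by rewrite h1 h2.
  + case/eqP: (valP e2); apply: (link_out_inj sG wu0 _ uv0).
    by exists (val e2); split; last by [].
  + case/eqP: (valP e1); apply: (link_out_inj sG wu0 _ uv0).
    by exists (val e1); split; last by [].
- elim/surj => b; rewrite contract_wire contract_type => wb t ht.
  have nb : b != v0 by apply: contraNneq wb => ->.
  have nb' : b != u0 by apply: contraNneq wb => ->.
  have vb (e : cedge G') : (csrc e = keep b \/ ctgt e = keep b) <->
      (csrc (val e) = b \/ ctgt (val e) = b).
    have kb x : keep x = keep b -> x = b.
      move/(congr1 val); rewrite !val_keep (negbTE nb).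
      by case: eqP => // _ h; rewrite h eqxx in nb'.
    split=> -[h|h]; [left; exact: kb|right|left; rewrite /= h //|right].
      by move/(congr1 val): h; rewrite /= val_keep (negbTE nb).
    by apply: val_inj; rewrite val_keep (negbTE nb).
  have [e [[he te] ue]] := bG b wb t ht.
  have ne : ctgt e != v0.
    apply/eqP => h; have : link (csrc e) v0 (etype e) by exists e.
    move/link_in_inj => /(_ _ _ sG wv0 uv0) hu.
    by case: he nb nb' => <-; rewrite ?h ?hu eqxx.
  exists (exist _ e ne); split; first by split=> //; apply/vb.
  by case=> e' ne' [/vb he' te']; apply: val_inj; apply: ue.
- elim/surj => x; rewrite /is_isolated.
  case: (boolP ((x == u0) || (x == v0))) => [|].
    rewrite -in_v0 => /eqP ->; rewrite -{1}keep_uv contract_input //.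
    by rewrite contract_output // eq_sym.
  rewrite negb_or => /andP[h h']; rewrite contract_input // contract_output //.
  exact: nG.
- by rewrite -dtG -map_comp; apply: eq_map => x; apply: contract_type.
- by rewrite -ctG -map_comp; apply: eq_map => x; apply: contract_type.
- by rewrite -map_cat map_inj_in_uniq //; apply: keep_inj_in.
- elim/surj => x; rewrite contract_bound -map_cat.
  apply/mapP/idP => [[y yb e]|].
    move/eqP: e; rewrite -val_eqE /= !val_keep.
    case: (eqVneq x v0) => [->|nx].
      rewrite orbT; case: (eqVneq y v0) => [ey _|ny /eqP ey].
        move: yb; rewrite ey mem_cat (negbTE nd) /= (pos_cod _ fG) // => ->.
        by rewrite orbT.
      by move: yb; rewrite -ey mem_cat (negbTE nc) orbF (pos_dom _ fG) // => ->.
    rewrite orbF; case: (eqVneq y v0) => [ey /eqP ->|ny /eqP ->].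
      move: yb; rewrite ey mem_cat (negbTE nd) /= (pos_cod _ fG) // eqxx => ->.
      by rewrite orbT.
    case: eqVneq => [ey|_]; last by rewrite -bdG.
    by move: yb; rewrite ey mem_cat (negbTE nc) orbF (pos_dom _ fG) // => ->.
  case: ifP => h; last by exists x; rewrite ?bdG.
  rewrite -in_v0 in h; rewrite (eqP h) => /orP[hi|ho].
    by exists u0; rewrite ?keep_uv // mem_cat (pos_dom _ fG) // hi.
  by exists v0; rewrite // mem_cat (pos_cod _ fG) // ho orbT.
- rewrite -dsG -map_comp; apply/eq_in_map => x xd.
  by rewrite /= contract_input //; apply: contraNneq nd => <-.
- rewrite -csG -map_comp; apply/eq_in_map => x xd.
  by rewrite /= contract_output //; apply: contraNneq nc => <-.
Qed.

(** Splitting the merged vertex restores [G]: its first half is [u0], its second half [None] is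
    [v0], and the new edge is [e0]. *)
Lemma contract_splits : splits_to G' G.
Proof.
have [tu tv] := link_type (sg_typed sG) uv0.
have [o to] : exists o, t0 = mid_edge o.
  by move: wu0 wv0; rewrite /is_wire tu tv; case: (t0) => [o|f i|f i] //=; exists o.
have [e0 [hs ht te0]] := uv0.
have nd : v0 \notin domf G by rewrite (pos_dom _ fG) // /is_input hin_v0 andbF.
have nc : u0 \notin codf G by rewrite (pos_cod _ fG) // /is_output hout_u0 andbF.
have ou : is_output (exist _ u0 nuv0 : cvert G') = is_output v0.
  rewrite (_ : exist _ u0 nuv0 = keep v0 :> cvert G') ?contract_output // 1?eq_sym //.
  by apply: val_inj; rewrite val_keep eqxx.
exists (exist _ u0 nuv0), o; split; first by rewrite /= tu to.
pose fv (x : option (cvert G')) := if x is Some x' then val x' else v0.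
pose fe (e : option (cedge G')) := if e is Some e' then val e' else e0.
have e0P e : ctgt e = v0 -> e = e0.
  by move=> h; apply: (sg_in sG); rewrite h // ht.
have fr x : x != v0 -> fv (Some (keep x)) = x by move=> h; rewrite /fv val_keep (negbTE h).
exists fv, fe; split.
- split.
    exists (fun x => if x == v0 then None else Some (keep x)).
      case=> [x|] /=; last by rewrite eqxx.
      by rewrite (negbTE (valP x)) keepK.
    by move=> x; case: eqVneq => [->|h] //; rewrite fr.
  exists (fun e => insub e) => [[e|]|e] /=; first by rewrite valK.
    by rewrite insubF // ht eqxx.
  by case: insubP => [e' _ <-//|]; rewrite negbK => /eqP/e0P ->.
- case=> [e|] /=; last by rewrite hs ht.
  split=> //; rewrite -val_eqE /= val_keep.
  case: (eqVneq (csrc (val e)) v0) => [-> //|n]; first by rewrite eqxx.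
  rewrite ifN /fv ?val_keep ?(negbTE n) //; apply: contraNneq (valP e) => h.
  by apply/eqP; apply: (link_out_inj sG wu0 _ uv0); exists (val e).
- case=> [x|] //=; by rewrite tv to.
- by case=> [e|] //=; rewrite te0 to.
- split; rewrite -map_comp -map_comp -[LHS]map_id; apply/eq_in_map => x xd /=.
    rewrite ou -val_eqE /= val_keep.
    have nx : x != v0 by apply: contraNneq nd => <-.
    rewrite (negbTE nx) ifN ?fr //.
    apply/negP => /andP[/eqP ex ov]; case/negP: nio; rewrite -ex -(pos_dom _ fG) // xd; exact: ov.
  rewrite ou -val_eqE /= val_keep.
  case: (eqVneq x v0) => [ex|nx].
    rewrite eqxx (_ : is_output v0) //.
    by rewrite -(pos_cod _ fG pX pY) -ex; exact: xd.
  by rewrite ifN ?fr //; apply/negP => /andP[/eqP ex _]; rewrite -ex xd in nc.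
Qed.
End ContractEdge.

(** If nothing is contracted, [co_head] makes [pv] injective and hence an isomorphism. Otherwise one
    pair in [C] is contracted, and the rest of the collapse restricts to the smaller graph. *)
Lemma contr_step X Y G H (fG : framed X Y G) (fH : framed X Y H) :
    positive X -> positive Y -> contr G H ->
  cospan_iso G H \/ exists2 G', #|cvert G'| < #|cvert G| &
    [/\ framed X Y G', splits_to G' G & contr G' H].
Proof.
move=> pX pY [pv [C [rk [[ht hs hC har hra hi] hd hc]]]].
have [sG sH] := (fr_string fG, fr_string fH).
case: (pickP (fun p => C p.1 p.2)) => [[u0 v0] /= uv|C0]; last first.
  have nC u v : C u v = false := C0 (u, v).
  left; have pI : injective pv by move=> u v /hi; apply => w; rewrite nC.
  have bpv : bijective pv.
    have [q qK] := choose_fun hs; exists q => // u.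
    by apply: pI; rewrite qK.
  apply: (@cospan_iso_link _ _ pv) => // u v t; split; first by case/har; rewrite ?nC.
  by case/hra=> u' [v' [/pI -> /pI -> ]].
right; have [epv lt [t0 a0]] := hC _ _ uv.
have [tu tv] := link_type (sg_typed sG) a0.
have [wu wv] : is_wire u0 /\ is_wire v0.
  move: tu tv; rewrite /is_wire -[vtype u0]ht epv ht => ->.
  by case: (t0).
have nuv : u0 != v0 by apply: contraTneq lt => ->; rewrite ltnn.
(* If [u0] were an input and [v0] an output, their common image would lie in both frames of [H],
   which are disjoint. *)
have nio : ~~ (is_input u0 && is_output v0).
  rewrite -(pos_dom _ fG) // -(pos_cod _ fG) //; apply/negP => /andP[ud vc].
  have := fr_uniq fH; rewrite cat_uniq => /and3P[_ /hasPn/(_ (pv v0)) + _].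
  by rewrite hc hd map_f // -epv map_f // => /(_ isT).
exists (contract_edge nuv).
  rewrite card_sig -[X in _ < X](cardC (pred1 v0)) card1 addnC addn1 ltnS.
  by rewrite subset_leq_card //; apply/subsetP => x.
have kp := val_keep nuv; split; first exact: (framed_contract fG pX pY a0 wu wv nuv nio).
  exact: (contract_splits fG pX pY a0 wu wv nuv nio).
have pk x : pv (val (keep nuv x)) = pv x by rewrite kp; case: eqP => // ->.
have cu0 y : C u0 y -> y = v0.
  by case/hC=> _ _ [t h]; apply: link_out_inj wu h a0.
have cv0 y : C y v0 -> y = u0.
  by case/hC=> _ _ [t h]; apply: link_in_inj wv h a0.
(* Out-links of the merged vertex come from [v0], so [s] replaces [u0] by [v0] wherever a vertex
   serves as a source. *)
pose s x := if x == u0 then v0 else x.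
have ps x : pv (s x) = pv x by rewrite /s; case: eqP => // ->.
have sk x : x != u0 -> s (val (keep nuv x)) = x.
  by move=> n; rewrite /s kp; case: (eqVneq x v0) => [->|_]; rewrite ?eqxx ?(negbTE n).
pose C' (x y : {x | x != v0}) := C (s (val x)) (val y).
have linkE := @contract_link _ _ _ _ _ _ fG a0 wu nuv.
apply: (@Contr _ _ (fun x : cvert (contract_edge nuv) => pv (val x)) C' (fun x => rk (val x))).
- by move=> x; apply: ht.
- by move=> a; have [u <-] := hs a; exists (keep nuv u); apply: pk.
- move=> x y /hC [e l [t h]]; split; first by rewrite -ps.
    (* The merged vertex has the rank of [u0], which is below that of [v0]. *)
    by move: l; rewrite /s; case: eqP => // -> /(ltn_trans lt).
  by exists t; apply/linkE.
- by move=> x y t /linkE/har; rewrite -/(s (val x)) ps.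
- move=> a b t /hra[u [v [ea eb h nc]]].
  have nv : v != v0.
    apply: contraNneq nc => ev; rewrite ev in h *.
    by rewrite (link_in_inj sG wv h a0).
  have nu : u != u0 by apply: contraNneq nv => eu; rewrite eu in h; rewrite (link_out_inj sG wu h a0).
  exists (keep nuv u), (exist _ v nv); split=> //; first by rewrite pk.
    by apply/linkE; rewrite -/(s _) sk.
  by rewrite /C' sk.
- have no (x : {x | x != v0}) : (forall w, ~~ C' w x) -> forall w, ~~ C w (val x).
    move=> h w; apply/negP => cw; have nw : w != u0.
      by apply: contraNneq (valP x) => ew; rewrite ew in cw; rewrite (cu0 _ cw).
    by case/negP: (h (keep nuv w)); rewrite /C' sk.
  by move=> x y e nx ny; apply/val_inj/(hi _ _ e); apply: no.
- by rewrite hd -map_comp; apply: eq_map => x /=; rewrite pk.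
- by rewrite hc -map_comp; apply: eq_map => x /=; rewrite pk.
Qed.

(** Each step is a splitting read backwards; the induction is on the number of vertices of the
    larger graph. *)
Lemma contr_homeo X Y (G H : fcospan X Y) : positive X -> positive Y ->
  contr (sval G) (sval H) -> wire_homeo G H.
Proof.
move=> pX pY; case: H => H fH /=.
have [n] := ubnP #|cvert (sval G)|; elim: n G => // n IH [G fG] /= ltn GH.
case: (contr_step fG fH pX pY GH) => [iso|[G' lt [fG' sp c]]]; first by apply: rst_step; left.
apply: (@rst_trans _ _ _ (exist _ G' fG')); last by apply: (IH (exist _ G' fG')) c; apply: (leq_trans lt).
by apply/rst_sym/rst_step; right.
Qed.

Lemma cospan_iso_contr G H : cospan_iso G H -> contr G H.
Proof.
case=> fv [fe [[bv [ge geK feK]] hst ht he [hd hc]]].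
apply: (contr_bij bv) => // u v t; split=> [[e [<- <- <-]]|[e [h1 h2 h3]]].
  by exists (fe e); have [-> ->] := hst e.
exists (ge e); have [] := hst (ge e); rewrite feK h1 h2 => h4 h5.
by split; [apply: (bij_inj bv)|apply: (bij_inj bv)|rewrite -he feK].
Qed.

(** With [cospan_iso_contr], each generator of wire-homeomorphism is a contraction in one of the two
    directions. *)
Lemma splits_contr G H : splits_to G H -> contr H G.
Proof.
case=> v [X [tv [fv [fe [[bv [ge geK feK]] hst ht he [hd hc]]]]]].
have [gv gK fK] := bv.
pose pv a := odflt v (gv a).
have linkE a b t : link a b t -> match gv a, gv b with
    | Some x, Some y => x != v /\ link x y t
    | Some x, None => x = v
    | None, Some y => link v y t
    | None, None => False end.
  case=> e [<- <- <-]; rewrite -(feK e); have [-> ->] := hst (ge e).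
  rewrite !gK he; case: (ge e) => [e'|] //=; case: eqVneq => [<-|n]; last split=> //.
    by exists e'.
  by exists e'.
have linkE' x y t : link x y t -> exists a, [/\ link a (fv (Some y)) t, pv a = x & gv a != Some v].
  case=> e [<- <- <-]; exists (csrc (fe (Some e))); have [h1 h2] := hst (Some e).
  split; last 2 first.
  + by rewrite h1 /pv gK /=; case: eqP.
  + by rewrite h1 gK /=; case: (eqVneq (csrc e) v) => // n; apply: contraNneq n => -[->].
  by exists (fe (Some e)); rewrite -h2 he.
apply: (@Contr _ _ pv (fun a b => (gv a == Some v) && (gv b == None)) (fun a => gv a == None)).
- by move=> a; rewrite -[a in RHS]fK ht /pv; case: (gv a).
- by move=> x; exists (fv (Some x)); rewrite /pv gK.
- move=> a b /andP[/eqP h1 /eqP h2]; rewrite /pv h1 h2; split=> //.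
  exists (mid_edge X); exists (fe None); have [-> ->] := hst None; rewrite he /=.
  by rewrite -h1 -h2 !fK.
- move=> a b t /linkE; rewrite /pv; case: (gv a) (gv b) => [x|] [y|] //=.
  + by case; right.
  + by move->; left; rewrite !eqxx.
  + by right.
- move=> x y t /linkE'[a [h1 h2 h3]]; exists a, (fv (Some y)); split=> //.
    by rewrite /pv gK.
  by rewrite (negbTE h3).
- have no a : (forall w, ~~ ((gv w == Some v) && (gv a == None))) -> gv a != None.
    by move/(_ (fv (Some v))); rewrite gK eqxx.
  move=> a b e /no na /no nb; rewrite -[LHS]fK -[RHS]fK; congr fv; move: e na nb.
  by rewrite /pv; case: (gv a) (gv b) => [x|] [y|] //= ->.
- rewrite hd -map_comp -map_comp -[LHS]map_id; apply: eq_map => x.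
  by rewrite /pv /= gK; case: eqP => [->|_]; case: is_output.
- rewrite hc -map_comp -map_comp -[LHS]map_id; apply: eq_map => x.
  by rewrite /pv /= gK; case: eqP => [->|_]; case: is_output.
Qed.
End Contraction.

(** * Tensor product, trace and composition preserve contractions *)

Section Operations.
Variable T : signature.
Implicit Types (G H K : cospan T) (X Y Z A B U : seq (bool * sobj T)).

Definition recod G c : cospan T :=
  @Cospan T (cvert G) (cedge G) csrc ctgt vtype etype (domf G) c.

Definition swapc G H : cospan T :=
  recod (G := cospan_tens G H) (map inr (codf H) ++ map inl (codf G)).

Lemma framed_swapc X Y X' Y' G H : framed X Y G -> framed X' Y' H ->
  framed (X ++ X') (Y' ++ Y) (swapc G H).
Proof.
move=> fG fH; apply: (framed_perm (framed_tens fG fH)); first by rewrite perm_catC.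
  rewrite !map_cat -(fr_cod_type fG) -(fr_cod_type fH); congr cat; by rewrite -map_comp.
rewrite !map_cat -(fr_cod_sign fG) -(fr_cod_sign fH) -!map_comp.
congr cat; apply: eq_map => v /=; rewrite /is_output.
  by rewrite tens_out_r.
by rewrite tens_out_l.
Qed.

(* Equivalent to [cospan_comp G H], but with wires in place of identifications. *)
Definition lcomp Y X Z G H : cospan T := cospan_tr Y X Z (swapc G H).

Lemma framed_lcomp X Y Z G H : framed X Y G -> framed Y Z H ->
  framed X Z (lcomp Y X Z G H).
Proof. by move=> fG fH; apply: framed_tr; apply: framed_swapc. Qed.

Lemma size_domf X Y G : framed X Y G -> size (domf G) = size X.
Proof. by move/fr_dom_type/(congr1 size); rewrite !size_map. Qed.
Lemma size_codf X Y G : framed X Y G -> size (codf G) = size Y.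
Proof. by move/fr_cod_type/(congr1 size); rewrite !size_map. Qed.

Lemma link_tens G H (u v : cvert (cospan_tens G H)) t : link u v t <->
  match u, v with
  | inl a, inl b => link a b t
  | inr a, inr b => link a b t
  | _, _ => False
  end.
Proof.
split=> [[[e|e] [<- <- <-]]|]; try exact: edge_link.
by case: u v => [a|a] [b|b] // [e [<- <- <-]]; [exists (inl e)|exists (inr e)].
Qed.

Lemma link_id X (u v : cvert (cospan_id X)) t : positive X -> link u v t <->
  exists i, [/\ u = inl i, v = inr i & t = mid_edge (tnth (in_tuple X) i).2].
Proof.
move=> pX; have p i : (tnth (in_tuple X) i).1 by move: i; apply/all_tnthP.
split=> [[i [<- <- <-]]|[i [-> -> ->]]]; first by exists i; rewrite /= p.
by exists i; rewrite /= p.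
Qed.

Definition wire_mid G (u : cvert G) t := exists o, vtype u = inl o /\ t = mid_edge o.

(** By positivity each trace wire runs from the codomain frame to the domain frame, and its type is
    determined by its source. *)
Lemma link_tr U A B G (u v : cvert (cospan_tr U A B G)) t :
    framed (A ++ U) (B ++ U) G -> positive (A ++ U) -> positive (B ++ U) ->
  link u v t <-> link (G := G) u v t \/
    (v, u) \in zip (drop (size A) (domf G)) (drop (size B) (codf G)) /\
    wire_mid (G := G) u t.
Proof.
move=> fG pA pB; have sz := tr_size_l fG.
have iE (i : 'I_(size (trace_wires U A B G))) : exists (x : sobj T) v u,
    [/\ tnth (in_tuple (trace_wires U A B G)) i = ((true, x), (v, u)),
      (v, u) = nth (v, u) (zip (drop (size A) (domf G)) (drop (size B) (codf G))) i,
      i < size (zip (drop (size A) (domf G)) (drop (size B) (codf G))) &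
      vtype u = inl x].
  have [[b x] [u' [v' [E [eu ev] [ud vc] [tu tv] [su sv]]]]] := tr_edge fG i.
  have bt : b.
    by rewrite -[b]su -(pos_dom _ fG) // -[domf G](cat_take_drop (size A)) mem_cat ud orbT.
  rewrite bt in E; exists x, u', v'; split=> //.
    rewrite nth_zip ?(tr_size_dU fG) ?(tr_size_cU fG) //; congr pair.
      by rewrite [LHS]eu; apply: set_nth_default; rewrite (tr_size_dU fG) -sz.
    by rewrite [LHS]ev; apply: set_nth_default; rewrite (tr_size_cU fG) -sz.
  by rewrite size_zip (tr_size_dU fG) (tr_size_cU fG) minnn -sz.
split=> [[[e|i] [<- <- <-]]|[]].
- by left; apply: edge_link.
- right; have [x [u' [v' [E h li tv]]]] := iE i.
  by rewrite /= E /=; split; [rewrite h mem_nth|exists x].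
- by case=> e [<- <- <-]; exists (inl e).
- case=> /(nthP (v, u))[i li e] [o [tu ->]].
  have li' : i < size (trace_wires U A B G).
    by move: li; rewrite size_zip (tr_size_dU fG) (tr_size_cU fG) minnn -sz.
  exists (inr (Ordinal li')); have [x [u' [v' [E h _ tv]]]] := iE (Ordinal li').
  have [eu ev] : (v, u) = (u', v').
    by rewrite h -e; apply: set_nth_default.
  by rewrite /= E /=; move: tu; rewrite ev tv => -[->].
Qed.

Lemma link_lcomp Y X Z G H (u v : cvert (lcomp Y X Z G H)) t :
    framed X Y G -> framed Y Z H -> positive X -> positive Y -> positive Z ->
  link u v t <->
  match u, v with
  | inl a, inl b => link a b t
  | inr a, inr b => link a b t
  | inl a, inr b => (a, b) \in zip (codf G) (domf H) /\ wire_mid a t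
  | inr _, inl _ => False
  end.
Proof.
move=> fG fH pX pY pZ; rewrite (link_tr _ _ _ (framed_swapc fG fH)) ?positive_cat //.
have := link_tens (G := G) (H := H) u v t => h; rewrite [link _ _ _]h {h} /=.
rewrite !drop_size_cat ?size_map ?(size_domf fG) ?(size_codf fH) //.
have -> : zip [seq inr i | i <- domf H] [seq inl i | i <- codf G] =
    [seq (inr p.2, inl p.1) | p <- zip (codf G) (domf H)]
      :> seq ((cvert G + cvert H) * (cvert G + cvert H)).
  by elim: (codf G) (domf H) => [|x s IH] [|y s'] //=; rewrite IH.
have m a b : (inr b, inl a) \in [seq (inr p.2, inl p.1) | p <- zip (codf G) (domf H)]
    = ((a, b) \in zip (codf G) (domf H)).
  by apply/mapP/idP => [[[x y] h [-> ->]] //|h]; exists (a, b).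
case: u v => a [] b; rewrite ?m; split=> //; try by left.
all: try by case=> // -[/mapP[]].
all: by [case|right].
Qed.

Lemma collapse_tens_l G G' H pv C rk : collapse (G := G) (H := G') pv C rk ->
  collapse (G := cospan_tens G H) (H := cospan_tens G' H)
    (fun u => match u with inl a => inl (pv a) | inr b => inr b end)
    (fun u v => if (u, v) is (inl a, inl b) then C a b else false)
    (fun u => if u is inl a then rk a else 0).
Proof.
case=> ht hs hC har hra hi; split.
- by case.
- by case=> a; [have [u <-] := hs a; exists (inl u)|exists (inr a)].
- case=> u [] v // /hC [-> -> [t h]]; split=> //; exists t; exact/link_tens.
- move=> u v t /link_tens; case: u v => u [] v //.
    by case/har; [left|right; apply/link_tens].
  by move=> ?; right; apply/link_tens.
- move=> a b t /link_tens; case: a b => a [] b //.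
    by case/hra=> u [v [<- <- ? ?]]; exists (inl u), (inl v); split=> //; apply/link_tens.
  by move=> ?; exists (inr a), (inr b); split=> //; apply/link_tens.
- case=> u [] v // => [[e] nu nv|[->] //]; congr inl; apply: hi e _ _ => w.
    exact: (nu (inl w)).
  exact: (nv (inl w)).
Qed.

Lemma collapse_tens_r G H H' pv C rk : collapse (G := H) (H := H') pv C rk ->
  collapse (G := cospan_tens G H) (H := cospan_tens G H')
    (fun u => match u with inl a => inl a | inr b => inr (pv b) end)
    (fun u v => if (u, v) is (inr a, inr b) then C a b else false)
    (fun u => if u is inr a then rk a else 0).
Proof.
case=> ht hs hC har hra hi; split.
- by case.
- by case=> a; [exists (inl a)|have [u <-] := hs a; exists (inr u)].
- case=> u [] v // /hC [-> -> [t h]]; split=> //; exists t; exact/link_tens.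
- move=> u v t /link_tens; case: u v => u [] v //.
    by move=> ?; right; apply/link_tens.
  by case/har; [left|right; apply/link_tens].
- move=> a b t /link_tens; case: a b => a [] b //.
    by move=> ?; exists (inl a), (inl b); split=> //; apply/link_tens.
  by case/hra=> u [v [<- <- ? ?]]; exists (inr u), (inr v); split=> //; apply/link_tens.
- case=> u [] v // => [[->] //|[e] nu nv]; congr inr; apply: hi e _ _ => w.
    exact: (nu (inr w)).
  exact: (nv (inr w)).
Qed.

(** [collapse] says nothing about the frames, so they may be replaced at will. *)
Lemma collapse_recod G H pv C rk c d : collapse (G := G) (H := H) pv C rk ->
  collapse (G := recod (G := G) c) (H := recod (G := H) d) pv C rk.
Proof. by case=> *; split. Qed.

Lemma contr_tens_l G G' H : contr G G' -> contr (cospan_tens G H) (cospan_tens G' H).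
Proof.
case=> pv [C [rk [/collapse_tens_l co hd hc]]]; do 3!eexists; split; first exact: co.
  by rewrite /= hd map_cat -!map_comp.
by rewrite /= hc map_cat -!map_comp.
Qed.

Lemma contr_tens_r G H H' : contr H H' -> contr (cospan_tens G H) (cospan_tens G H').
Proof.
case=> pv [C [rk [/collapse_tens_r co hd hc]]]; do 3!eexists; split; first exact: co.
  by rewrite /= hd map_cat -!map_comp.
by rewrite /= hc map_cat -!map_comp.
Qed.

Lemma contr_swapc_l G G' H : contr G G' -> contr (swapc G H) (swapc G' H).
Proof.
case=> pv [C [rk [/collapse_tens_l-/(_ H) co hd hc]]].
have co' := collapse_recod (G := cospan_tens G H) (H := cospan_tens G' H)
  (map inr (codf H) ++ map inl (codf G)) (map inr (codf H) ++ map inl (codf G')) co.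
do 3!eexists; split; first exact: co'.
  by rewrite /= hd map_cat -!map_comp.
by rewrite /= hc map_cat -!map_comp.
Qed.

Lemma contr_swapc_r G H H' : contr H H' -> contr (swapc G H) (swapc G H').
Proof.
case=> pv [C [rk [/(collapse_tens_r G) co hd hc]]].
have co' := collapse_recod (G := cospan_tens G H) (H := cospan_tens G H')
  (map inr (codf H) ++ map inl (codf G)) (map inr (codf H') ++ map inl (codf G)) co.
do 3!eexists; split; first exact: co'.
  by rewrite /= hd map_cat -!map_comp.
by rewrite /= hc map_cat -!map_comp.
Qed.

Lemma zip_map2 (R S : Type) (f : R -> S) s1 s2 :
  zip (map f s1) (map f s2) = [seq (f p.1, f p.2) | p <- zip s1 s2].
Proof. by elim: s1 s2 => [|x s IH] [|y s'] //=; rewrite IH. Qed.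

Lemma mem_zip (R S : eqType) (s1 : seq R) (s2 : seq S) x y :
  (x, y) \in zip s1 s2 -> x \in s1 /\ y \in s2.
Proof.
elim: s1 s2 => [|a s IH] [|b s'] //=; rewrite !inE xpair_eqE.
by case/orP=> [/andP[-> ->] //|/IH[-> ->]]; rewrite !orbT.
Qed.

Lemma mem_drop2 (R : eqType) n (s : seq R) x : x \in drop n s -> x \in s.
Proof. by move=> h; rewrite -[s](cat_take_drop n) mem_cat h orbT. Qed.

(** The trace wires are kept and not contracted, so [pv], [C] and the rank stay the same. *)
Lemma contr_tr U A B G H :
    framed (A ++ U) (B ++ U) G -> framed (A ++ U) (B ++ U) H ->
    positive (A ++ U) -> positive (B ++ U) ->
  contr G H -> contr (cospan_tr U A B G) (cospan_tr U A B H).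
Proof.
move=> fG fH pA pB [pv [C [rk [[ht hs hC har hra hi] hd hc]]]].
have linkG := link_tr _ _ _ fG pA pB; have linkH := link_tr _ _ _ fH pA pB.
have z : zip (drop (size A) (domf H)) (drop (size B) (codf H)) =
    [seq (pv p.1, pv p.2) | p <- zip (drop (size A) (domf G)) (drop (size B) (codf G))].
  by rewrite hd hc -!map_drop zip_map2.
apply: (@Contr _ (cospan_tr U A B G) (cospan_tr U A B H) pv C rk) => //.
- move=> u v /hC[-> -> [t h]]; split=> //; exists t; apply/linkG; by left.
- move=> u v t /linkG[/har[]|[h [o [h1 h2]]]]; [by left|right; apply/linkH; by left|].
  right; apply/linkH; right; split; last by exists o; rewrite ht.
  by rewrite z; apply/mapP; exists (v, u).
- move=> a b t /linkH[/hra[u [v [h1 h2 h3 h4]]]|].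
    by exists u, v; split=> //; apply/linkG; left.
  case; rewrite z => /mapP[[v u] h [-> ->]] [o [h1 h2]].
  exists u, v; split=> //; first by apply/linkG; right; split=> //; exists o; rewrite -ht.
  (* A contracted pair would be a link out of [u], but [u] is in the codomain frame and so has no
     out-link. *)
  apply/negP => /hC[_ _ [t' h']]; have [_ /mem_drop2] := mem_zip h.
  rewrite (pos_cod _ fG) // => /andP[_ /negP]; apply.
  by apply/has_outP; exists v, t'.
- by rewrite /= hd map_take.
- by rewrite /= hc map_take.
Qed.

End Operations.

(** * Representatives of wire-homeomorphism classes *)

Section Classes.
Variable T : signature.
Implicit Types (G H K : cospan T) (X Y Z A B U : seq (bool * sobj T)).

Lemma sig_eq (A : Type) (P : A -> Prop) (x y : {a | P a}) : sval x = sval y -> x = y.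
Proof.
case: x y => [x px] [y py] /= e; subst y; congr exist; exact: proof_irrelevance.
Qed.

(** A class is the predicate [wire_homeo G], so equality of classes rests on functional and
    propositional extensionality. *)
Lemma clsP X Y (G H : fcospan X Y) : cls G = cls H <-> wire_homeo G H.
Proof.
split=> [/(congr1 sval) /= ->|h]; first exact: rst_refl.
apply: sig_eq; apply: functional_extensionality => K.
apply: propositional_extensionality; split=> k; last exact: rst_trans k.
by apply: rst_trans k; apply: rst_sym.
Qed.

Lemma repK X Y (c : wclass X Y) : cls (rep c) = c.
Proof.
by apply: sig_eq; rewrite /rep; case: constructive_indefinite_description.
Qed.

(** Membership of [G] in [c] with the proof of [framed] hidden: laws can then be checked on any
    convenient graph in place of the chosen [rep c]. *)
Definition represents X Y (c : wclass X Y) G := exists fG : framed X Y G, c = cls (exist _ G fG).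

Lemma represents_framed X Y (c : wclass X Y) G : represents c G -> framed X Y G.
Proof. by case. Qed.

Lemma represents_ex X Y (c : wclass X Y) : exists G, represents c G.
Proof.
exists (sval (rep c)), (svalP (rep c)); rewrite -[LHS]repK; congr cls.
exact: sig_eq.
Qed.

Lemma represents_cls X Y (G : fcospan X Y) : represents (cls G) (sval G).
Proof. by case: G => G fG; exists fG. Qed.

Lemma represents_fun X Y (c d : wclass X Y) G : represents c G -> represents d G -> c = d.
Proof.
by case=> f -> [f' ->]; rewrite (proof_irrelevance _ f f').
Qed.

Section Positive.
Variables (X Y : seq (bool * sobj T)) (pX : positive X) (pY : positive Y).

Lemma represents_contr (c : wclass X Y) G H :
  represents c G -> framed X Y H -> contr G H -> represents c H.
Proof. by case=> fG -> fH h; exists fH; apply/clsP; apply: contr_homeo. Qed.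

Lemma represents_expand (c : wclass X Y) G H :
  represents c G -> framed X Y H -> contr H G -> represents c H.
Proof. by case=> fG -> fH h; exists fH; apply/clsP/rst_sym; apply: contr_homeo. Qed.

Lemma represents_eq (c d : wclass X Y) G H :
  represents c G -> represents d H -> contr G H -> c = d.
Proof.
by move=> rG rH /(represents_contr rG (represents_framed rH)) h; apply: represents_fun h rH.
Qed.

Lemma represents_eq2 (c d : wclass X Y) G H K :
  represents c G -> represents d H -> framed X Y K -> contr G K -> contr H K -> c = d.
Proof.
move=> rG rH fK h k; apply: (represents_fun (G := K)).
  exact: represents_contr h.
exact: represents_contr k.
Qed.
End Positive.

(** Since the generators of wire-homeomorphism are contractions up to direction, an operation that
    preserves framedness and contractions descends to classes, and [rep c] may be exchanged for any
    other representative. *)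
Lemma represents_map X Y X' Y' (op : cospan T -> cospan T) (c : wclass X Y) G (d : wclass X' Y') :
    positive X -> positive Y -> positive X' -> positive Y' ->
    (forall G, framed X Y G -> framed X' Y' (op G)) ->
    (forall G H, framed X Y G -> framed X Y H -> contr G H -> contr (op G) (op H)) ->
  represents c G -> represents d (op (sval (rep c))) -> represents d (op G).
Proof.
move=> pX pY pX' pY' fop cop [fG ec] [f ->]; exists (fop _ fG); apply/clsP.
suff aux (G1 G2 : fcospan X Y) : wire_homeo G1 G2 -> forall f1 f2,
    wire_homeo (exist (framed X' Y') (op (sval G1)) f1) (exist _ (op (sval G2)) f2).
  by apply: (aux _ (exist _ G fG)); apply/clsP; rewrite repK.
elim=> {G fG ec f G1 G2} [[G fG] [H fH] /= [iso|sp]|[G fG]|[G fG] [H fH] _ IH|G [H fH] K _ IH _ IH'] f f'.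
- by apply: contr_homeo => //=; apply: cop => //; apply: cospan_iso_contr.
- by apply/rst_sym; apply: contr_homeo => //=; apply: cop => //; apply: splits_contr.
- by rewrite (proof_irrelevance _ f f'); apply: rst_refl.
- by apply/rst_sym/IH.
- exact: rst_trans (IH f (fop _ fH)) (IH' _ f').
Qed.

Lemma wire_midE G (u : cvert G) : is_wire u -> exists t, wire_mid u t.
Proof. by rewrite /is_wire /wire_mid; case: (vtype u) => // o _; exists (mid_edge o), o. Qed.

(** Contracting the joining wires merges exactly the pairs of vertices that the pushout identifies.
    A contracted path has at most one wire, so the rank only separates [G] from [H]. *)
Lemma lcomp_comp X Y Z G H : framed X Y G -> framed Y Z H ->
  positive X -> positive Y -> positive Z -> contr (lcomp Y X Z G H) (cospan_comp G H).
Proof.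
move=> fG fH pX pY pZ; have linkE := link_lcomp _ _ _ fG fH pX pY pZ.
apply: (@Contr _ (lcomp Y X Z G H) (cospan_comp G H) (@glue_proj _ G H)
  (fun u v => if (u, v) is (inl a, inr b) then (a, b) \in zip (codf G) (domf H) else false)
  (fun u => if u is inr _ then 1 else 0)).
- by case=> u; [apply: glue_type_g fG fH _|apply: glue_type_h fG fH _].
- by elim/glue_case => u; [exists (inl u)|exists (inr u)].
- case=> a [] b // h; split=> //; first exact/(glue_gh fG fH).
  have [wa _] := glued_wire fG fH h; have [t ht] := wire_midE wa.
  by exists t; apply/linkE.
- case=> a [] b t /linkE // h; [right|left|right]; last 1 first.
  + by case: h => e [<- <- <-]; exists (inr e).
  + by case: h => e [<- <- <-]; exists (inl e).
  + by case: h.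
- move=> a b t [[e|e] [<- <- <-]].
    by exists (inl (csrc e)), (inl (ctgt e)); split=> //; apply/linkE; apply: edge_link.
  by exists (inr (csrc e)), (inr (ctgt e)); split=> //; apply/linkE; apply: edge_link.
- move=> u v /(glue_projP fG fH)[//|]; rewrite glue_relE; case: u v => u [] v // h nu nv.
    by case/negP: (nv (inl u)).
  by case/negP: (nu (inl v)).
- by rewrite /= take_size_cat ?size_map ?(size_domf fG) // -map_comp.
- by rewrite /= take_size_cat ?size_map ?(size_codf fH) // -map_comp.
Qed.

Lemma contr_lcomp_l X Y Z G G' H : framed X Y G -> framed X Y G' -> framed Y Z H ->
    positive X -> positive Y -> positive Z ->
  contr G G' -> contr (lcomp Y X Z G H) (lcomp Y X Z G' H).
Proof.
move=> fG fG' fH pX pY pZ h; apply: contr_tr; rewrite ?positive_cat //.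
- exact: framed_swapc.
- exact: framed_swapc.
- exact: contr_swapc_l.
Qed.

Lemma contr_lcomp_r X Y Z G H H' : framed X Y G -> framed Y Z H -> framed Y Z H' ->
    positive X -> positive Y -> positive Z ->
  contr H H' -> contr (lcomp Y X Z G H) (lcomp Y X Z G H').
Proof.
move=> fG fG' fH pX pY pZ h; apply: contr_tr; rewrite ?positive_cat //.
- exact: framed_swapc.
- exact: framed_swapc.
- exact: contr_swapc_r.
Qed.

(** Once [cospan_comp] of the chosen representatives is replaced by [lcomp], the two arguments are
    exchanged one at a time, as [represents_map] treats unary operations. *)
Lemma represents_comp X Y Z (g : wclass X Y) (h : wclass Y Z) G H :
    positive X -> positive Y -> positive Z -> represents g G -> represents h H ->
  represents (cls (fcospan_comp (rep h) (rep g))) (lcomp Y X Z G H).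
Proof.
move=> pX pY pZ rg rh; have fG := represents_framed rg; have fH := represents_framed rh.
have r0 : represents (cls (fcospan_comp (rep h) (rep g))) (lcomp Y X Z (sval (rep g)) (sval (rep h))).
  apply: (represents_expand pX pZ (represents_cls _)).
    by apply: framed_lcomp; apply: svalP.
  by apply: lcomp_comp => //; apply: svalP.
apply: (represents_map (op := fun G => lcomp Y X Z G H) _ _ _ _ _ _ rg) => //.
- by move=> *; apply: framed_lcomp.
- by move=> *; apply: contr_lcomp_l.
apply: (represents_map (op := fun H => lcomp Y X Z (sval (rep g)) H) _ _ _ _ _ _ rh) => //.
- by move=> *; apply: framed_lcomp => //; apply: svalP.
- by move=> *; apply: contr_lcomp_r => //; apply: svalP.
Qed.

Lemma represents_tens X Y X' Y' (g : wclass X Y) (h : wclass X' Y') G H :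
    positive X -> positive Y -> positive X' -> positive Y' -> represents g G -> represents h H ->
  represents (cls (fcospan_tens (rep g) (rep h))) (cospan_tens G H).
Proof.
move=> pX pY pX' pY' rg rh; have fG := represents_framed rg; have fH := represents_framed rh.
apply: (represents_map (op := fun G => cospan_tens G H) _ _ _ _ _ _ rg); rewrite ?positive_cat //.
- by move=> *; apply: framed_tens.
- by move=> *; apply: contr_tens_l.
apply: (represents_map (op := cospan_tens (sval (rep g))) _ _ _ _ _ _ rh); rewrite ?positive_cat //.
- by move=> *; apply: framed_tens => //; apply: svalP.
- by move=> *; apply: contr_tens_r.
exact: represents_cls.
Qed.

Lemma represents_tr U A B (g : wclass (A ++ U) (B ++ U)) G :
    positive U -> positive A -> positive B -> represents g G ->
  represents (cls (fcospan_tr (rep g))) (cospan_tr U A B G).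
Proof.
move=> pU pA pB rg; have fG := represents_framed rg.
apply: (represents_map (op := cospan_tr U A B) _ _ _ _ _ _ rg); rewrite ?positive_cat //.
- by move=> *; apply: framed_tr.
- by move=> *; apply: contr_tr; rewrite ?positive_cat.
exact: represents_cls.
Qed.

Definition rep_by (X Y : Ob (FCspP T)) (c : Hom X Y) G : Prop :=
  @represents (sval X) (sval Y) c G.

Lemma rep_cast (X Y X' Y' : Ob (FCspP T)) (eX : X = X') (eY : Y = Y') (c : Hom X Y) G :
  rep_by c G -> rep_by (castm eX eY c) G.
Proof. by subst. Qed.

Lemma rep_ex (X Y : Ob (FCspP T)) (c : Hom X Y) : exists G, rep_by c G.
Proof. exact: represents_ex. Qed.

Lemma rep_comp (X Y Z : Ob (FCspP T)) (h : Hom Y Z) (g : Hom X Y) G H :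
  rep_by g G -> rep_by h H ->
  rep_by (compm h g) (lcomp (sval Y) (sval X) (sval Z) G H).
Proof. exact: (represents_comp (svalP X) (svalP Y) (svalP Z)). Qed.

Lemma rep_tens (X Y X' Y' : Ob (FCspP T)) (g : Hom X Y) (h : Hom X' Y') G H :
  rep_by g G -> rep_by h H -> rep_by (tensm g h) (cospan_tens G H).
Proof. exact: (represents_tens (svalP X) (svalP Y) (svalP X') (svalP Y')). Qed.

Lemma rep_tr (U A B : Ob (FCspP T)) (g : Hom (tensO A U) (tensO B U)) G :
  rep_by g G -> rep_by (trm U g) (cospan_tr (sval U) (sval A) (sval B) G).
Proof. exact: (represents_tr (svalP U) (svalP A) (svalP B)). Qed.

Lemma rep_id (X : Ob (FCspP T)) : rep_by (idm X) (cospan_id (sval X)).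
Proof. by exists (framed_id (sval X)). Qed.

Lemma rep_symm (X Y : Ob (FCspP T)) : rep_by (symm X Y) (cospan_symm (sval X) (sval Y)).
Proof. by exists (framed_symm (sval X) (sval Y)). Qed.

Lemma rep_framed (X Y : Ob (FCspP T)) (c : Hom X Y) G :
  rep_by c G -> framed (sval X) (sval Y) G.
Proof. exact: represents_framed. Qed.

(** The graph [lcomp] of the given representatives represents the left-hand side and contracts to
    their pushout. *)
Lemma pcls_comp (X Y Z : Ob (FCspP T)) (H : fcospan (sval Y) (sval Z))
    (G : fcospan (sval X) (sval Y)) :
  compm (pcls H) (pcls G) = pcls (fcospan_comp H G).
Proof.
have r := rep_comp (represents_cls G : rep_by (pcls G) _) (represents_cls H : rep_by (pcls H) _).
apply: (represents_fun r); apply: (represents_expand (svalP X) (svalP Z) (represents_cls _)).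
  exact: rep_framed r.
exact: (lcomp_comp (svalP G) (svalP H) (svalP X) (svalP Y) (svalP Z)).
Qed.

Lemma pcls_tens (X Y X' Y' : Ob (FCspP T)) (G : fcospan (sval X) (sval Y))
    (H : fcospan (sval X') (sval Y')) :
  tensm (pcls G) (pcls H) = @pcls T (tensO X X') (tensO Y Y') (fcospan_tens G H).
Proof.
have r := rep_tens (represents_cls G : rep_by (pcls G) _) (represents_cls H : rep_by (pcls H) _).
exact: (represents_fun r (represents_cls (fcospan_tens G H))).
Qed.

Lemma pcls_tr (U A B : Ob (FCspP T))
    (G : fcospan (sval A ++ sval U) (sval B ++ sval U)) :
  trm U (@pcls T (tensO A U) (tensO B U) G) = pcls (fcospan_tr G).
Proof.
have r := rep_tr (represents_cls G : rep_by (@pcls T (tensO A U) (tensO B U) G) _).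
exact: (represents_fun r (represents_cls (fcospan_tr G))).
Qed.
End Classes.

(** * The laws of a symmetric traced category *)

Section Zip.
Variables A B C : eqType.
Implicit Types (s : seq A) (t : seq B) (r : seq C).

Lemma zip_inll s r a c : ((inl a : A + B, c) \in zip (map inl s) r) = ((a, c) \in zip s r).
Proof. by elim: s r => [|x s IH] [|y r] //=; rewrite !inE !xpair_eqE IH. Qed.
Lemma zip_inlr t r b c : ((inr b : A + B, c) \in zip (map inr t) r) = ((b, c) \in zip t r).
Proof. by elim: t r => [|x s IH] [|y r] //=; rewrite !inE !xpair_eqE IH. Qed.
Lemma zip_inrl s r a c : ((c, inl a : A + B) \in zip r (map inl s)) = ((c, a) \in zip r s).
Proof. by elim: s r => [|x s IH] [|y r] //=; rewrite !inE !xpair_eqE IH. Qed.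
Lemma zip_inrr t r b c : ((c, inr b : A + B) \in zip r (map inr t)) = ((c, b) \in zip r t).
Proof. by elim: t r => [|x s IH] [|y r] //=; rewrite !inE !xpair_eqE IH. Qed.
Lemma zip_inl0 s r b c : ((inr b : A + B, c) \in zip (map inl s) r) = false.
Proof. by apply/negP => /mem_zip[/mapP[]]. Qed.
Lemma zip_inr0 t r a c : ((inl a : A + B, c) \in zip (map inr t) r) = false.
Proof. by apply/negP => /mem_zip[/mapP[]]. Qed.
Lemma zip_l0 s r b c : ((c, inr b : A + B) \in zip r (map inl s)) = false.
Proof. by apply/negP => /mem_zip[_ /mapP[]]. Qed.
Lemma zip_r0 t r a c : ((c, inl a : A + B) \in zip r (map inr t)) = false.
Proof. by apply/negP => /mem_zip[_ /mapP[]]. Qed.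

Definition zip_sum := (zip_inll, zip_inlr, zip_inrl, zip_inrr, zip_inl0, zip_inr0, zip_l0, zip_r0).
End Zip.

(** * Links as equations, and absorption of graphs made of wires *)

Section LinkLaws.
Variable T : signature.
Implicit Types (G H K : cospan T) (X Y Z A B U : seq (bool * sobj T)).

(** Stated as an equality of propositions so that links can be rewritten under disjunctions and
    matches. *)
Lemma link_tensE G H (u v : cvert (cospan_tens G H)) t : link u v t =
  match u, v with
  | inl a, inl b => link a b t
  | inr a, inr b => link a b t
  | _, _ => False
  end.
Proof. exact/propositional_extensionality/link_tens. Qed.

Lemma link_trE U A B G (u v : cvert (cospan_tr U A B G)) t :
    framed (A ++ U) (B ++ U) G -> positive (A ++ U) -> positive (B ++ U) ->
  link u v t = (link (G := G) u v t \/
    (v, u) \in zip (drop (size A) (domf G)) (drop (size B) (codf G)) /\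
    wire_mid (G := G) u t).
Proof. by move=> *; apply/propositional_extensionality/link_tr. Qed.

Lemma link_lcompE Y X Z G H (u v : cvert (lcomp Y X Z G H)) t :
    framed X Y G -> framed Y Z H -> positive X -> positive Y -> positive Z ->
  link u v t =
  match u, v with
  | inl a, inl b => link a b t
  | inr a, inr b => link a b t
  | inl a, inr b => (a, b) \in zip (codf G) (domf H) /\ wire_mid a t
  | inr _, inl _ => False
  end.
Proof. by move=> *; apply/propositional_extensionality/link_lcomp. Qed.

Lemma domf_lcomp Y X Z G H : framed X Y G -> domf (lcomp Y X Z G H) = map inl (domf G).
Proof. by move=> fG; rewrite /= take_size_cat ?size_map ?(size_domf fG). Qed.

Lemma codf_lcomp Y X Z G H : framed Y Z H -> codf (lcomp Y X Z G H) = map inr (codf H).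
Proof. by move=> fH; rewrite /= take_size_cat ?size_map ?(size_codf fH). Qed.

(** The boolean form of [link] with the type forgotten, as required for the relation [C] of a
    contraction. *)
Definition edgeb G (u v : cvert G) := [exists e : cedge G, (csrc e == u) && (ctgt e == v)].

Lemma edgebP G (u v : cvert G) : reflect (exists t, link u v t) (edgeb u v).
Proof.
apply: (iffP existsP) => [[e /andP[/eqP <- /eqP <-]]|[t [e [<- <- _]]]].
  by exists (etype e); apply: edge_link.
by exists e; rewrite !eqxx.
Qed.

Lemma nth_mem_zip (R S : eqType) (s : seq R) (s' : seq S) x :
  size s = size s' -> x \in s -> exists y, (x, y) \in zip s s'.
Proof.
elim: s s' => [|a s IH] [|b s'] //= [/IH h]; rewrite inE => /orP[/eqP ->|/h[y hy]].
  by exists b; rewrite mem_head.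
by exists y; rewrite inE hy orbT.
Qed.

Lemma nth_mem_zip' (R S : eqType) (s : seq R) (s' : seq S) x :
  size s = size s' -> x \in s' -> exists y, (y, x) \in zip s s'.
Proof.
elim: s s' => [|a s IH] [|b s'] //= [/IH h]; rewrite inE => /orP[/eqP ->|/h[y hy]].
  by exists a; rewrite mem_head.
by exists y; rewrite inE hy orbT.
Qed.

Lemma mem_zip_map (R S : eqType) (q : R -> S) (s : seq R) x y :
  (x, y) \in zip (map q s) s -> x = q y.
Proof. by elim: s => //= a s IH; rewrite inE => /orP[/eqP[-> ->]|/IH]. Qed.

Lemma mem_zip_map' (R S : eqType) (q : R -> S) (s : seq R) x y :
  (y, x) \in zip s (map q s) -> x = q y.
Proof. by elim: s => //= a s IH; rewrite inE => /orP[/eqP[-> ->]|/IH]. Qed.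

(* [W] consists of wires only; [q] sends both ends of a wire to one vertex. *)
Record wires W G (q : cvert W -> cvert G) (d c : seq (cvert G)) : Prop := Wires {
  wi_link : forall u v t, link u v t -> q u = q v;
  wi_bound : forall w : cvert W, w \in domf W ++ codf W;
  wi_type : forall w, vtype (q w) = vtype w;
  wi_dom : map q (domf W) = d;
  wi_cod : map q (codf W) = c;
  wi_perm : perm_eq c d }.

Lemma framed_recod X Y Y' G c : positive X -> positive Y -> positive Y' ->
    framed X Y G -> perm_eq c (codf G) ->
    [seq vtype v | v <- c] = [seq inl y.2 | y <- Y'] ->
  framed X Y' (recod (G := G) c).
Proof.
move=> pX pY pY' fG pc tc; apply: (framed_perm fG) => //.
have sz : size c = size Y' by move/(congr1 size): tc; rewrite !size_map.
transitivity (nseq (size c) true).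
  rewrite -(size_map (@is_output T G)); apply/all_pred1P/allP => _ /mapP[v vc ->].
  by rewrite -(pos_cod _ fG) // -(perm_mem pc) vc.
by rewrite sz; elim: (Y') pY' => //= -[b y] Y1 IH /andP[/= -> /IH ->].
Qed.

Lemma recodK G : recod (codf G) = G.
Proof. by case: G. Qed.

Section Absorb.
Variables (X Y Z : seq (bool * sobj T)).
Hypotheses (pX : positive X) (pY : positive Y) (pZ : positive Z).

(** All of [W] is contracted onto the codomain frame of [G]: a path starts in [G], crosses a joining
    wire and then a wire of [W]. The ranks 0, 1, 2 follow this order. *)
Lemma absorb_r G W (q : cvert W -> cvert G) c : framed X Y G -> framed Y Z W -> wires q (codf G) c ->
  contr (lcomp Y X Z G W) (recod (G := G) c).
Proof.
move=> fG fW [ql qb qt qd qc _].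
have linkE := fun u v t => link_lcompE u v t fG fW pX pY pZ.
(* Every vertex of [W] lies on a frame and none is isolated. *)
have win w : has_in w = (w \notin domf W).
  have := qb w; rewrite mem_cat (pos_dom _ fW) // (pos_cod _ fW) //.
  have := fr_isolated fW w; rewrite /is_isolated /is_input /is_output.
  by case: is_wire; case: has_in; case: has_out.
apply: (@Contr _ (lcomp Y X Z G W) (recod (G := G) c)
  (fun u => match u with inl a => a | inr w => q w end)
  (fun u v => match u, v with
    | inl a, inr b => (a, b) \in zip (codf G) (domf W)
    | inr a, inr b => edgeb a b | _, _ => false end)
  (fun u => match u with inl a => 0 | inr w => if w \in domf W then 1 else 2 end)).
- by case.
- by move=> a; exists (inl a).
- case=> u [] v //.
    move=> h; have [hu hv] := mem_zip h; rewrite hv; split=> //.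
      by rewrite -qd in h; apply: mem_zip_map h.
    have [|t ht] := @wire_midE T G u; last by exists t; rewrite linkE.
    by move: hu; rewrite (pos_cod _ fG) // => /andP[].
  case/edgebP=> t h; rewrite (ql _ _ _ h); split=> //; last by exists t; rewrite linkE.
  have hv : v \notin domf W by rewrite -win; apply/has_inP; exists u, t.
  rewrite (negbTE hv); case: ifP => //.
  have := qb u; rewrite mem_cat => /orP[->//|].
  rewrite (pos_cod _ fW) // => /andP[_ /negP[]]; apply/has_outP; by exists v, t.
- move=> u v t; rewrite linkE; case: u v => u [] v //; first by right.
    by case; left.
  by left; apply/edgebP; exists t.
- by move=> a b t h; exists (inl a), (inl b); rewrite linkE.
- have no w : (forall u, ~~ match u with
      | inl a => (a, w) \in zip (codf G) (domf W)
      | inr a => edgeb a w end) -> False.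
    move=> h; case: (boolP (w \in domf W)) => [hw|].
      have [|u hu] := nth_mem_zip' _ hw (s := codf G).
        by rewrite (size_codf fG) (size_domf fW).
      by have := h (inl u); rewrite hu.
    rewrite -win => /has_inP[u [t hu]]; case/negP: (h (inr u)).
    by apply/edgebP; exists t.
  case=> [u|w] [v|w'] /= e h1 h2; first by rewrite e.
  + by case: (no w').
  + by case: (no w).
  + by case: (no w).
- by rewrite domf_lcomp // -map_comp map_id.
- by rewrite codf_lcomp // -map_comp -qc; apply: eq_map.
Qed.

Definition redom G d : cospan T :=
  @Cospan T (cvert G) (cedge G) csrc ctgt vtype etype d (codf G).

(** Mirror image of [absorb_r], except that a contracted path now ends in [G]. Heads in [W] lie in
    its domain frame, where [q] is injective because the frame of [G] has no repetitions. *)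
Lemma absorb_l G W (q : cvert W -> cvert G) d : framed Y Z G -> framed X Y W -> wires q d (domf G) ->
  contr (lcomp Y X Z W G) (redom (G := G) d).
Proof.
move=> fG fW [ql qb qt qd qc pq].
have linkE := fun u v t => link_lcompE u v t fW fG pX pY pZ.
have win w : has_in w = (w \notin domf W).
  have := qb w; rewrite mem_cat (pos_dom _ fW) // (pos_cod _ fW) //.
  have := fr_isolated fW w; rewrite /is_isolated /is_input /is_output.
  by case: is_wire; case: has_in; case: has_out.
have qin w : q w \in domf G.
  have := qb w; rewrite mem_cat => /orP[|] h; last by rewrite -qc map_f.
  by rewrite (perm_mem pq) -qd map_f.
have uq : uniq (map q (domf W)).
  by rewrite qd -(perm_uniq pq); have := fr_uniq fG; rewrite cat_uniq => /andP[].
apply: (@Contr _ (lcomp Y X Z W G) (redom (G := G) d)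
  (fun u => match u with inl w => q w | inr a => a end)
  (fun u v => match u, v with
    | inl a, inr b => (a, b) \in zip (codf W) (domf G)
    | inl a, inl b => edgeb a b | _, _ => false end)
  (fun u => match u with inl w => if w \in domf W then 0 else 1 | inr a => 2 end)).
- by case.
- by move=> a; exists (inr a).
- case=> u [] v //.
    case/edgebP=> t h; rewrite (ql _ _ _ h); split=> //; last by exists t; rewrite linkE.
    have hv : v \notin domf W by rewrite -win; apply/has_inP; exists u, t.
    rewrite (negbTE hv); case: ifP => //.
    have := qb u; rewrite mem_cat => /orP[->//|].
    rewrite (pos_cod _ fW) // => /andP[_ /negP[]]; apply/has_outP; by exists v, t.
  move=> h; have [hu hv] := mem_zip h; split=> //; last first.
  + have [|t ht] := @wire_midE T W u; last by exists t; rewrite linkE.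
    by move: hu; rewrite (pos_cod _ fW) // => /andP[].
  + by case: ifP.
  + by rewrite -qc in h; rewrite (mem_zip_map' h).
- move=> u v t; rewrite linkE; case: u v => u [] v //; last by right.
    by left; apply/edgebP; exists t.
  by case; left.
- by move=> a b t h; exists (inr a), (inr b); rewrite linkE.
- have no w : (forall u, ~~ match u with
      | inl a => edgeb a w | inr a => false end) -> w \in domf W.
    move=> h; apply: contraT; rewrite -win => /has_inP[u [t hu]].
    by case/negP: (h (inl u)); apply/edgebP; exists t.
  have no' w : (forall u, ~~ match u with
      | inl a => (a, w) \in zip (codf W) (domf G) | inr a => false end) ->
      w \notin domf G.
    move=> h; apply/negP => hw; have [|u hu] := nth_mem_zip' _ hw (s := codf W).
      by rewrite (size_codf fW) (size_domf fG).
    by have := h (inl u); rewrite hu.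
  case=> [u|w] [v|w'] /= e h1 h2.
  + congr inl; move/no: h1 => h1; move/no: h2 => h2.
    rewrite -(nth_index u h1) -(nth_index u h2); congr nth; apply/eqP.
    rewrite -(nth_uniq (q u) _ _ uq) ?size_map ?index_mem //.
    by rewrite !(nth_map u) ?index_mem // !nth_index ?e.
  + by have := no' _ _ h2; rewrite -e qin.
  + by have := no' _ _ h1; rewrite e qin.
  + by rewrite e.
- by rewrite domf_lcomp // -map_comp -qd; apply: eq_map.
- by rewrite codf_lcomp // -map_comp map_id.
Qed.

End Absorb.
End LinkLaws.

Ltac contr_by_bij f := match goal with |- contr ?G ?H => apply: (@contr_bij _ G H f) end.

(** * Category, monoidal and symmetry laws *)

Section SSTLaws.
Variable T : signature.
Implicit Types (G H K : cospan T) (X Y Z A B U : seq (bool * sobj T)).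

(** Both ends of wire [i] go to entry [i] of [l]; [cast_ord] bridges the equal lengths of [X] and
    [l]. *)
Lemma wires_id X G (l : seq (cvert G)) : positive X ->
    [seq vtype v | v <- l] = [seq inl x.2 | x <- X] ->
  exists q : cvert (cospan_id X) -> cvert G, wires q l l.
Proof.
move=> pX tl; have e : size X = size l by move/(congr1 size): tl; rewrite !size_map.
pose q (i : 'I_(size X)) := tnth (in_tuple l) (cast_ord e i).
have ql : [seq q i | i <- enum 'I_(size X)] = l.
  suff h n (e' : n = size l) : [seq tnth (in_tuple l) (cast_ord e' i) | i <- enum 'I_n] = l.
    exact: h.
  subst n; rewrite -[RHS](map_tnth_enum (in_tuple l)); apply: eq_map => i.
  by rewrite cast_ord_id.
exists (fun u => match u with inl i | inr i => q i end); split=> //.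
- by move=> u v t /(link_id _ _ _ pX)[i [-> ->]].
- by case=> i; rewrite mem_cat; apply/orP; [left|right]; apply/map_f; rewrite mem_enum.
- have h i : vtype (q i) = inl (tnth (in_tuple X) i).2.
    have := congr1 (fun s => nth (inl (tnth (in_tuple X) i).2) s i) tl.
    rewrite (nth_map (q i)) -?e // (nth_map (tnth (in_tuple X) i)) //.
    have -> : nth (q i) l i = q i by rewrite [RHS](tnth_nth (q i)).
    suff -> : nth (tnth (in_tuple X) i) X i = tnth (in_tuple X) i by [].
    by rewrite [RHS](tnth_nth (tnth (in_tuple X) i)).
  by case.
- by rewrite /= -map_comp -[RHS]ql.
- by rewrite /= -map_comp -[RHS]ql.
Qed.

Lemma wires_tens W W' G (q : cvert W -> cvert G) (q' : cvert W' -> cvert G) d c d' c' :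
  wires q d c -> wires q' d' c' ->
  wires (W := cospan_tens W W') (fun u => match u with inl w => q w | inr w => q' w end)
    (d ++ d') (c ++ c').
Proof.
case=> ql qb qt qd qc pq [ql' qb' qt' qd' qc' pq']; split.
- by move=> u v t; rewrite link_tensE; case: u v => u [] v //; [apply: ql|apply: ql'].
- case=> w; rewrite !mem_cat ?mem_inl ?mem_inr ?mem_inlr ?mem_inrl.
    by have := qb w; rewrite mem_cat => /orP[] ->; rewrite ?orbT.
  by have := qb' w; rewrite mem_cat => /orP[] ->; rewrite ?orbT.
- by case.
- by rewrite /= map_cat -!map_comp -qd -qd'.
- by rewrite /= map_cat -!map_comp -qc -qc'.
- exact: perm_cat.
Qed.

Lemma wires_symm X Y G (l l' : seq (cvert G)) : positive X -> positive Y ->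
    [seq vtype v | v <- l] = [seq inl x.2 | x <- X] ->
    [seq vtype v | v <- l'] = [seq inl x.2 | x <- Y] ->
  exists q : cvert (cospan_symm X Y) -> cvert G, wires q (l ++ l') (l' ++ l).
Proof.
move=> pX pY /(wires_id pX)[q w] /(wires_id pY)[q' w'].
have [ql qb qt qd qc pq] := wires_tens w w'.
eexists; split; [exact: ql| |exact: qt|exact: qd| |by rewrite perm_catC].
  by move=> u; have := qb u; rewrite /= !mem_cat [in X in _ || X]orbC.
by rewrite -[X in _ = _ ++ X](wi_cod w) -(wi_cod w') /= map_cat -!map_comp.
Qed.

Lemma framed_redom X X' Y G d : positive X -> positive Y -> positive X' ->
    framed X Y G -> perm_eq d (domf G) ->
    [seq vtype v | v <- d] = [seq inl y.2 | y <- X'] ->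
  framed X' Y (redom (G := G) d).
Proof.
move=> pX pY pX' fG pd td; have [[tG iG oG bG] nG dtG ctG uG bdG dsG csG] := fG.
split=> //.
- by rewrite (perm_uniq (s2 := domf G ++ codf G)) // perm_cat2r.
- by move=> v; rewrite mem_cat (perm_mem pd) -mem_cat; apply: bdG.
have sz : size d = size X' by move/(congr1 size): td; rewrite !size_map.
transitivity (nseq (size d) true).
  rewrite -(size_map (@is_input T G)); apply/all_pred1P/allP => _ /mapP[v vc ->].
  by apply/eqP; change (@is_input T G v = true); rewrite -(pos_dom _ fG) // -(perm_mem pd) vc.
by rewrite sz; elim: (X') pX' => //= -[b y] Y1 IH /andP[/= -> /IH ->].
Qed.

Lemma rep_fun (X Y : Ob (FCspP T)) (c d : Hom X Y) G : rep_by c G -> rep_by d G -> c = d.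
Proof. exact: represents_fun. Qed.

Lemma rep_eq (X Y : Ob (FCspP T)) (c d : Hom X Y) G H :
  rep_by c G -> rep_by d H -> contr G H -> c = d.
Proof. exact: (represents_eq (svalP X) (svalP Y)). Qed.

Lemma rep_eq2 (X Y : Ob (FCspP T)) (c d : Hom X Y) G H K :
    rep_by c G -> rep_by d H -> framed (sval X) (sval Y) K ->
    contr G K -> contr H K -> c = d.
Proof. exact: (represents_eq2 (svalP X) (svalP Y)). Qed.

(** Composing with an arrow made of wires only reorders the codomain frame, so laws between wirings
    become equalities of lists. *)
Lemma rep_absorb_r (X Y Z : Ob (FCspP T)) (w : Hom Y Z) (g : Hom X Y) W G
    (q : cvert W -> cvert G) c :
  rep_by w W -> rep_by g G -> wires q (codf G) c -> rep_by (compm w g) (recod (G := G) c).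
Proof.
move=> rw rg wq; have fG := rep_framed rg; have fW := rep_framed rw.
apply: (represents_contr (svalP X) (svalP Z) (rep_comp rg rw)).
  apply: (framed_recod (svalP X) (svalP Y) (svalP Z) fG (wi_perm wq)).
  rewrite -(wi_cod wq) -map_comp -(fr_cod_type fW); apply: eq_map => u.
  exact: (wi_type wq).
exact: (absorb_r (svalP X) (svalP Y) (svalP Z) fG fW wq).
Qed.

Lemma rep_absorb_l (X Y Z : Ob (FCspP T)) (w : Hom X Y) (g : Hom Y Z) W G
    (q : cvert W -> cvert G) d :
  rep_by w W -> rep_by g G -> wires q d (domf G) -> rep_by (compm g w) (redom (G := G) d).
Proof.
move=> rw rg wq; have fG := rep_framed rg; have fW := rep_framed rw.
apply: (represents_contr (svalP X) (svalP Z) (rep_comp rw rg)).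
  apply: (framed_redom (svalP Y) (svalP Z) (svalP X) fG).
    by rewrite perm_sym (wi_perm wq).
  rewrite -(wi_dom wq) -map_comp -(fr_dom_type fW); apply: eq_map => u.
  exact: (wi_type wq).
exact: (absorb_l (svalP X) (svalP Y) (svalP Z) fG fW wq).
Qed.

Lemma redomK G : redom (domf G) = G.
Proof. by case: G. Qed.

Lemma FCsp_comp1m (A B : Ob (FCspP T)) (f : Hom A B) : compm (idm B) f = f.
Proof.
have [F rF] := rep_ex f; have [q w] := wires_id (svalP B) (fr_cod_type (rep_framed rF)).
apply: (rep_fun _ rF); rewrite -[F in rep_by _ F]recodK.
exact: rep_absorb_r (rep_id B) rF w.
Qed.

Lemma FCsp_compm1 (A B : Ob (FCspP T)) (f : Hom A B) : compm f (idm A) = f.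
Proof.
have [F rF] := rep_ex f; have [q w] := wires_id (svalP A) (fr_dom_type (rep_framed rF)).
apply: (rep_fun _ rF); rewrite -[F in rep_by _ F]redomK.
exact: rep_absorb_l (rep_id A) rF w.
Qed.

(** Since [lcomp] adds wires instead of identifying vertices, both sides have the same links up to
    re-bracketing, and nothing is contracted. *)
Lemma FCsp_compmA (A B D E : Ob (FCspP T)) (h : Hom D E) (g : Hom B D) (f : Hom A B) :
  compm h (compm g f) = compm (compm h g) f.
Proof.
have [F rF] := rep_ex f; have [G rG] := rep_ex g; have [H rH] := rep_ex h.
have [fF fG fH] := And3 (rep_framed rF) (rep_framed rG) (rep_framed rH).
have rFG := rep_comp rF rG; have rGH := rep_comp rG rH.
apply: (rep_eq (rep_comp rFG rH) (rep_comp rF rGH)).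
have [pA pB pD pE] := And4 (svalP A) (svalP B) (svalP D) (svalP E).
have [fFG fGH] := (rep_framed rFG, rep_framed rGH).
pose pv (u : (cvert F + cvert G) + cvert H) : cvert F + (cvert G + cvert H) :=
  match u with inl (inl a) => inl a | inl (inr b) => inr (inl b) | inr c => inr (inr c) end.
contr_by_bij pv.
- by exists (fun u => match u with inl a => inl (inl a) | inr (inl b) => inl (inr b)
    | inr (inr c) => inr c end); do ![case].
- by do ![case].
- move=> u v t; rewrite (link_lcompE _ _ _ fFG fH pA pD pE) (link_lcompE _ _ _ fF fGH pA pB pE).
  case: u v => [[u|u]|u] [[v|v]|v]; rewrite /pv; cbv beta iota;
    rewrite ?(link_lcompE _ _ _ fF fG pA pB pD) ?(link_lcompE _ _ _ fG fH pB pD pE);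
    by rewrite ?(codf_lcomp _ _ fG) ?(domf_lcomp _ _ fG) ?zip_sum; split=> // -[].
- by rewrite (domf_lcomp _ _ fFG) !(domf_lcomp _ _ fF) -!map_comp.
- by rewrite (codf_lcomp _ _ fGH) !(codf_lcomp _ _ fH) -!map_comp.
Qed.

Lemma split_types G (A B : Ob (FCspP T)) (l : seq (cvert G)) :
    [seq vtype v | v <- l] = [seq inl x.2 | x <- sval (tensO A B)] ->
  exists l1 l2, [/\ l = l1 ++ l2, [seq vtype v | v <- l1] = [seq inl x.2 | x <- sval A] &
    [seq vtype v | v <- l2] = [seq inl x.2 | x <- sval B]].
Proof.
move=> h; have [h1 h2] := tr_map (h : _ = [seq inl x.2 | x <- sval A ++ sval B]).
by exists (take (size (sval A)) l), (drop (size (sval A)) l); rewrite cat_take_drop.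
Qed.

Lemma FCsp_tensm_id (A B : Ob (FCspP T)) : tensm (idm A) (idm B) = idm (tensO A B).
Proof.
have ri := rep_id (tensO A B); have [l1 [l2 [e t1 t2]]] := split_types (fr_dom_type (rep_framed ri)).
have [q1 w1] := wires_id (svalP A) t1; have [q2 w2] := wires_id (svalP B) t2.
have w := wires_tens w1 w2; rewrite -e in w.
rewrite -[LHS]FCsp_comp1m; apply: (rep_fun _ ri); rewrite -[cospan_id _]redomK.
exact: rep_absorb_l (rep_tens (rep_id A) (rep_id B)) ri w.
Qed.

Lemma domf_tens G H : domf (cospan_tens G H) = map inl (domf G) ++ map inr (domf H).
Proof. by []. Qed.

Lemma codf_tens G H : codf (cospan_tens G H) = map inl (codf G) ++ map inr (codf H).
Proof. by []. Qed.

Lemma FCsp_tensm_comp (A B D A' B' D' : Ob (FCspP T)) (g : Hom B D) (f : Hom A B)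
    (g' : Hom B' D') (f' : Hom A' B') :
  tensm (compm g f) (compm g' f') = compm (tensm g g') (tensm f f').
Proof.
have [F rF] := rep_ex f; have [G rG] := rep_ex g.
have [F' rF'] := rep_ex f'; have [G' rG'] := rep_ex g'.
have [fF fG] := (rep_framed rF, rep_framed rG).
have [fF' fG'] := (rep_framed rF', rep_framed rG').
have [pA pB pD] := And3 (svalP A) (svalP B) (svalP D).
have [pA' pB' pD'] := And3 (svalP A') (svalP B') (svalP D').
have rFF := rep_tens rF rF'; have rGG := rep_tens rG rG'.
have [fFF fGG] := (rep_framed rFF, rep_framed rGG).
apply: (rep_eq (rep_tens (rep_comp rF rG) (rep_comp rF' rG')) (rep_comp rFF rGG)).
pose pv (u : (cvert F + cvert G) + (cvert F' + cvert G')) :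
    (cvert F + cvert F') + (cvert G + cvert G') :=
  match u with inl (inl a) => inl (inl a) | inl (inr b) => inr (inl b)
  | inr (inl a) => inl (inr a) | inr (inr b) => inr (inr b) end.
have L := fun u v t => link_lcompE u v t fFF fGG (positive_cat pA pA') (positive_cat pB pB')
  (positive_cat pD pD').
contr_by_bij pv.
- by exists (fun u => match u with inl (inl a) => inl (inl a) | inr (inl b) => inl (inr b)
    | inl (inr a) => inr (inl a) | inr (inr b) => inr (inr b) end); do ![case].
- by do ![case].
- move=> u v t; rewrite L link_tensE; case: u v => [[u|u]|[u|u]] [[v|v]|[v|v]];
    rewrite ?(link_lcompE _ _ _ fF fG pA pB pD) ?(link_lcompE _ _ _ fF' fG' pA' pB' pD') /=;
    rewrite ?link_tensE ?zip_cat ?mem_cat ?zip_sum ?orbF //=;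
    try (by split=> // -[]);
    by rewrite !size_map (size_codf fF) (size_domf fG).
- by rewrite (domf_lcomp _ _ fFF) !domf_tens !map_cat (domf_lcomp _ _ fF)
    (domf_lcomp _ _ fF') -!map_comp.
- by rewrite (codf_lcomp _ _ fGG) !codf_tens !map_cat (codf_lcomp _ _ fG)
    (codf_lcomp _ _ fG') -!map_comp.
Qed.

Lemma FCsp_tensmA (A B A' B' A'' B'' : Ob (FCspP T))
    (f : Hom A B) (g : Hom A' B') (h : Hom A'' B'') :
  castm (tensOA A A' A'') (tensOA B B' B'') (tensm f (tensm g h)) = tensm (tensm f g) h.
Proof.
have [F rF] := rep_ex f; have [G rG] := rep_ex g; have [H rH] := rep_ex h.
apply: (rep_eq (rep_cast _ _ (rep_tens rF (rep_tens rG rH))) (rep_tens (rep_tens rF rG) rH)).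
pose pv (u : cvert F + (cvert G + cvert H)) : (cvert F + cvert G) + cvert H :=
  match u with inl a => inl (inl a) | inr (inl b) => inl (inr b) | inr (inr c) => inr c end.
contr_by_bij pv.
- by exists (fun u => match u with inl (inl a) => inl a | inl (inr b) => inr (inl b)
    | inr c => inr (inr c) end); do ![case].
- by do ![case].
- by move=> u v t; rewrite !link_tensE; case: u v => [u|[u|u]] [v|[v|v]]; rewrite /= ?link_tensE.
- by rewrite /= !map_cat -!map_comp catA.
- by rewrite /= !map_cat -!map_comp catA.
Qed.

Lemma FCsp_tens1m (A B : Ob (FCspP T)) (f : Hom A B) :
  castm (tens1O A) (tens1O B) (tensm (idm unitO) f) = f.
Proof.
have [F rF] := rep_ex f.
apply: (rep_eq (rep_cast _ _ (rep_tens (rep_id unitO) rF)) rF).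
have no (P : Type) (u : cvert (cospan_id (T := T) [::])) : P by case: u => -[].
contr_by_bij (fun u : cvert (cospan_id (T := T) [::]) + cvert F =>
  match u with inl a => no _ a | inr b => b end).
- by exists inr => // -[u|//]; exact: no.
- by case=> // u; exact: no.
- by move=> [u|u] [v|v] t; try exact: no; rewrite link_tensE.
- by rewrite /= enum_ord0 /= -map_comp map_id.
- by rewrite /= enum_ord0 /= -map_comp map_id.
Qed.

Lemma FCsp_tensm1 (A B : Ob (FCspP T)) (f : Hom A B) :
  castm (tensO1 A) (tensO1 B) (tensm f (idm unitO)) = f.
Proof.
have [F rF] := rep_ex f.
apply: (rep_eq (rep_cast _ _ (rep_tens rF (rep_id unitO))) rF).
have no (P : Type) (u : cvert (cospan_id (T := T) [::])) : P by case: u => -[].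
contr_by_bij (fun u : cvert F + cvert (cospan_id (T := T) [::]) =>
  match u with inl b => b | inr a => no _ a end).
- by exists inl => // -[//|u]; exact: no.
- by case=> // u; exact: no.
- by move=> [u|u] [v|v] t; try exact: no; rewrite link_tensE.
- by rewrite /= enum_ord0 /= cats0 -map_comp map_id.
- by rewrite /= enum_ord0 /= cats0 -map_comp map_id.
Qed.

(** Absorbing the symmetries leaves [F] and [G] side by side, with the codomain reordered on one
    side of the equation and the domain on the other; exchanging the two summands matches them. *)
Lemma FCsp_symm_nat (A B A' B' : Ob (FCspP T)) (f : Hom A B) (g : Hom A' B') :
  compm (symm B B') (tensm f g) = compm (tensm g f) (symm A A').
Proof.
have [F rF] := rep_ex f; have [G rG] := rep_ex g.
have [fF fG] := (rep_framed rF, rep_framed rG).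
have ty H H' (k : cvert H -> cvert H') X l : (forall v, vtype (k v) = vtype v) ->
    [seq vtype v | v <- l] = [seq inl x.2 | x <- X] :> seq (sobj T + smor T) ->
    [seq vtype v | v <- map k l] = [seq inl x.2 | x <- X].
  by move=> hk <-; rewrite -map_comp; apply: eq_map.
have [q w] := wires_symm (svalP B) (svalP B')
  (ty _ (cospan_tens F G) inl _ _ (fun=> erefl) (fr_cod_type fF))
  (ty _ (cospan_tens F G) inr _ _ (fun=> erefl) (fr_cod_type fG)).
have [q' w'] := wires_symm (svalP A) (svalP A')
  (ty _ (cospan_tens G F) inr _ _ (fun=> erefl) (fr_dom_type fF))
  (ty _ (cospan_tens G F) inl _ _ (fun=> erefl) (fr_dom_type fG)).
apply: (rep_eq (rep_absorb_r (rep_symm B B') (rep_tens rF rG) w)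
  (rep_absorb_l (rep_symm A A') (rep_tens rG rF) w')).
pose pv (u : cvert F + cvert G) : cvert G + cvert F :=
  match u with inl a => inr a | inr b => inl b end.
contr_by_bij pv.
- by exists (fun u => match u with inl a => inr a | inr b => inl b end); case.
- by case.
- move=> u v t; change (link (G := cospan_tens F G) u v t <->
    link (G := cospan_tens G F) (pv u) (pv v) t).
  by rewrite !link_tensE; case: u v => u [] v.
- by rewrite /= map_cat -!map_comp.
- by rewrite /= map_cat -!map_comp.
Qed.

Lemma FCsp_symmK (A B : Ob (FCspP T)) : compm (symm B A) (symm A B) = idm (tensO A B).
Proof.
have [fA fB] := (framed_id (sval A), framed_id (sval B)).
have tA : [seq vtype v | v <- (map inl (codf (cospan_id (sval A))) : seq (cvert (cospan_symm (sval A) (sval B))))]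
    = [seq inl x.2 | x <- sval A].
  by rewrite -(fr_cod_type fA) -map_comp.
have tB : [seq vtype v | v <- (map inr (codf (cospan_id (sval B))) : seq (cvert (cospan_symm (sval A) (sval B))))]
    = [seq inl x.2 | x <- sval B].
  by rewrite -(fr_cod_type fB) -map_comp.
have [q w] := wires_symm (svalP B) (svalP A) tB tA.
rewrite -FCsp_tensm_id.
apply: (rep_fun (rep_absorb_r (rep_symm B A) (rep_symm A B) w)).
exact: rep_tens (rep_id A) (rep_id B).
Qed.

(** Both sides are precomposed with the identity on the whole word and absorbed into it; the
    codomain frame becomes [l2 ++ l3 ++ l1] on either side. *)
Lemma FCsp_hexagon (A B D : Ob (FCspP T)) :
  symm A (tensO B D) =
    compm (castm (erefl (tensO B (tensO A D))) (tensOA B D A) (tensm (idm B) (symm A D)))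
      (castm (esym (tensOA A B D)) (esym (tensOA B A D)) (tensm (symm A B) (idm D))).
Proof.
have ri := rep_id (tensO A (tensO B D)).
have [l1 [l' [e t1 t']]] := split_types (fr_cod_type (rep_framed ri)).
have [l2 [l3 [e' t2 t3]]] := split_types t'.
rewrite -[LHS]FCsp_compm1 -[RHS]FCsp_compm1 -FCsp_compmA.
have [q w] := wires_symm (svalP A) (svalP (tensO B D)) t1 t'.
have [q1 w1] := wires_symm (svalP A) (svalP B) t1 t2; have [q3 w3] := wires_id (svalP D) t3.
have w13 := wires_tens w1 w3; rewrite -catA -e' -e in w13; rewrite -e in w.
have r1 := rep_absorb_r (rep_cast (esym (tensOA A B D)) (esym (tensOA B A D))
  (rep_tens (rep_symm A B) (rep_id D))) ri w13.
pose K := recod (G := cospan_id (sval (tensO A (tensO B D)))) ((l2 ++ l1) ++ l3).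
have [q2 w2] := wires_id (G := K) (svalP B) t2.
have [q4 w4] := wires_symm (G := K) (svalP A) (svalP D) t1 t3.
have := wires_tens w2 w4; rewrite catA => w24.
apply: (rep_fun (rep_absorb_r (rep_symm A (tensO B D)) ri w)).
rewrite e' -catA.
exact: (rep_absorb_r (rep_cast (erefl (tensO B (tensO A D))) (tensOA B D A)
  (rep_tens (rep_id B) (rep_symm A D))) r1 w24).
Qed.

End SSTLaws.

Ltac contr_by f C rk := match goal with |- contr ?G ?H => apply: (@Contr _ G H f C rk) end.

(** * Trace laws *)

Section TraceLaws.
Variable T : signature.
Implicit Types (G H K : cospan T) (X Y Z A B U : seq (bool * sobj T)).

Lemma map_uniq_inj (R S : eqType) (q : R -> S) (s : seq R) x y : uniq (map q s) ->
  x \in s -> y \in s -> q x = q y -> x = y.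
Proof.
move=> uq xs ys e; rewrite -(nth_index x xs) -(nth_index x ys); congr nth; apply/eqP.
rewrite -(nth_uniq (q x) _ _ uq) ?size_map ?index_mem //.
by rewrite !(nth_map x) ?index_mem // !nth_index ?e.
Qed.

Lemma mem_zip_mapq (R R' S : eqType) (q : R -> R') (s : seq R) (r : seq S) w y :
  (w, y) \in zip s r -> (q w, y) \in zip (map q s) r.
Proof.
elim: s r => [|a s IH] [|b r] //=; rewrite !inE => /orP[/eqP[-> ->]|/IH ->].
  by rewrite eqxx.
by rewrite orbT.
Qed.

Lemma mem_zip_mapq' (R R' S : eqType) (q : R -> R') (s : seq R) (r : seq S) w y :
  (y, w) \in zip r s -> (y, q w) \in zip r (map q s).
Proof.
elim: s r => [|a s IH] [|b r] //=; rewrite !inE => /orP[/eqP[-> ->]|/IH ->].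
  by rewrite eqxx.
by rewrite orbT.
Qed.

Lemma zip_mapq_mem (R R' S : eqType) (q : R -> R') (s : seq R) (r : seq S) x y :
  (x, y) \in zip (map q s) r -> exists2 w, (w, y) \in zip s r & q w = x.
Proof.
elim: s r => [|a s IH] [|b r] //=; rewrite inE => /orP[/eqP[-> ->]|/IH[w h <-]].
  by exists a; rewrite // mem_head.
by exists w; rewrite // inE h orbT.
Qed.

Lemma zip_mapq_mem' (R R' S : eqType) (q : R -> R') (s : seq R) (r : seq S) x y :
  (y, x) \in zip r (map q s) -> exists2 w, (y, w) \in zip r s & q w = x.
Proof.
elim: s r => [|a s IH] [|b r] //=; rewrite inE => /orP[/eqP[-> ->]|/IH[w h <-]].
  by exists a; rewrite // mem_head.
by exists w; rewrite // inE h orbT.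
Qed.

Lemma has_in_wire X Y W (w : cvert W) : framed X Y W -> positive X -> positive Y ->
  w \in domf W ++ codf W -> has_in w = (w \notin domf W).
Proof.
move=> fW pX pY; rewrite mem_cat (pos_dom _ fW) // (pos_cod _ fW) //.
have := fr_isolated fW w; rewrite /is_isolated /is_input /is_output.
by case: is_wire; case: has_in; case: has_out.
Qed.

Lemma link_lt X Y W (u v : cvert W) t : framed X Y W -> positive X -> positive Y ->
  (forall w : cvert W, w \in domf W ++ codf W) ->
  link u v t -> u \in domf W /\ v \notin domf W.
Proof.
move=> fW pX pY bW h; split; last first.
  by rewrite -(has_in_wire fW pX pY (bW v)); apply/has_inP; exists u, t.
have := bW u; rewrite mem_cat => /orP[//|].
rewrite (pos_cod _ fW) // => /andP[_ /negP[]]; apply/has_outP; by exists v, t.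
Qed.

Lemma wire_mid_cod X Y G (u : cvert G) : framed X Y G -> positive X -> positive Y ->
  u \in codf G -> exists t, wire_mid u t.
Proof. by move=> fG pX pY; rewrite (pos_cod _ fG) // => /andP[/wire_midE]. Qed.

Lemma domf_tr U A B G : domf (cospan_tr U A B G) = take (size A) (domf G).
Proof. by []. Qed.

Lemma codf_tr U A B G : codf (cospan_tr U A B G) = take (size B) (codf G).
Proof. by []. Qed.

Section Split.
Variables (X Y A B : seq (bool * sobj T)) (G : cospan T).
Hypotheses (pA : positive A) (pB : positive B) (pX : positive X) (pY : positive Y).
Hypothesis fG : framed (A ++ X) (B ++ Y) G.
Let dA := take (size A) (domf G).
Let dX := drop (size A) (domf G).
Let cB := take (size B) (codf G).
Let cY := drop (size B) (codf G).

Lemma frame_split : [/\ domf G = dA ++ dX, codf G = cB ++ cY,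
    [/\ size dA = size A, size dX = size X, size cB = size B & size cY = size Y] &
    [/\ [seq vtype v | v <- dA] = [seq inl x.2 | x <- A],
        [seq vtype v | v <- dX] = [seq inl x.2 | x <- X],
        [seq vtype v | v <- cB] = [seq inl x.2 | x <- B] &
        [seq vtype v | v <- cY] = [seq inl x.2 | x <- Y]] /\
    uniq dA /\ uniq dX].
Proof.
have [t1 t2] := tr_map (fr_dom_type fG); have [t3 t4] := tr_map (fr_cod_type fG).
split; rewrite ?cat_take_drop //.
  rewrite !size_take !size_drop (size_domf fG) (size_codf fG) !size_cat !addKn.
  by split=> //; case: ltnP => //; rewrite -leq_subRL // subnn leqn0 => /eqP ->; rewrite addn0.
split=> //; have := fr_uniq fG; rewrite cat_uniq -{1}(cat_take_drop (size A) (domf G)).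
by rewrite cat_uniq => /andP[/and3P[]].
Qed.
End Split.

(** Each trace wire on the left enters an identity wire on [X] that is joined to [F]. Contracting
    the identity wire and the joining wire onto [dX] leaves the trace wire of the right-hand
    side. *)
Lemma FCsp_trm_natl (X A A' B : Ob (FCspP T)) (f : Hom (tensO A X) (tensO B X)) (a : Hom A' A) :
  trm X (compm f (tensm a (idm X))) = compm (trm X f) a.
Proof.
have [F rF] := rep_ex f; have [G rG] := rep_ex a.
have [fF fG] := (rep_framed rF, rep_framed rG).
have [pX pA pA' pB] := And4 (svalP X) (svalP A) (svalP A') (svalP B).
have [pAX pBX pA'X] := And3 (positive_cat pA pX) (positive_cat pB pX) (positive_cat pA' pX).
have rt := rep_tens rG (rep_id X); have ft := rep_framed rt.
have rl := rep_comp rt rF; have fl := rep_framed rl.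
have rtr := rep_tr rF; have ftr := rep_framed rtr.
have fI := framed_id (sval X).
apply: (rep_eq (rep_tr rl) (rep_comp rG rtr)).
have [ed ec [s1 s2 s3 s4] [[t1 t2 t3 t4] [u1 u2]]] := frame_split fF.
set dA := take _ (domf F) in ed s1 t1 u1; set dX := drop _ (domf F) in ed s2 t2 u2.
set cB := take _ (codf F) in ec s3 t3; set cX := drop _ (codf F) in ec s4 t4.
have [q w] := wires_id pX t2.
have L u v t : link (G := cospan_tr (sval X) (sval A') (sval B) _) u v t = _ :=
  link_trE u v t fl pA'X pBX.
rewrite (domf_lcomp _ _ ft) (codf_lcomp _ _ fF) domf_tens in L.
rewrite map_cat drop_size_cat ?size_map ?(size_domf fG) // -map_drop -/cX in L.
have L2 u v t := link_lcompE u v t ft fF pA'X pAX pBX.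
have R u v t := link_lcompE u v t fG ftr pA' pA pB.
have R2 u v t := link_trE u v t fF pAX pBX.
contr_by (fun u : (cvert G + cvert (cospan_id (sval X))) + cvert F =>
    match u with inl (inl x) => inl x | inl (inr w) => inr (q w) | inr y => inr y end)
  (fun u v : (cvert G + cvert (cospan_id (sval X))) + cvert F => match u, v with
    | inl (inr w), inl (inr w') => edgeb w w'
    | inl (inr w), inr y => (w, y) \in zip (codf (cospan_id (sval X))) dX
    | _, _ => false end)
  (fun u : (cvert G + cvert (cospan_id (sval X))) + cvert F => match u with
    | inl (inl _) => 0
    | inl (inr w) => if w \in domf (cospan_id (sval X)) then 0 else 1 | inr _ => 2 end).
- by case=> [[u|u]|u] //; exact: wi_type w u.
- by case=> z; [exists (inl (inl z))|exists (inr z)].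
- case=> [[u|u]|u] [[v|v]|v] //.
    case/edgebP=> t h; have [hu hv] := link_lt fI pX pX (wi_bound w) h.
    rewrite hu (negbTE hv) (wi_link w h); split=> //; exists t.
    by rewrite L; left; rewrite L2 link_tensE.
  move=> h; have [hu _] := mem_zip h; split; [|by case: ifP|].
    by congr inr; rewrite -[dX in zip _ dX](wi_cod w) in h; rewrite (mem_zip_map' h).
  have [t ht] := wire_mid_cod fI pX pX hu; exists t; rewrite L; left; rewrite L2; split=> //.
  by rewrite codf_tens ed zip_cat ?size_map ?(size_codf fG) ?s1 // mem_cat !zip_sum.
- move=> u v t; rewrite L => -[|[]].
    rewrite L2; case: u v => [u|u] [v|v] //; rewrite ?link_tensE.
    + case: u v => u [] v // h; last by left; apply/edgebP; exists t.
      by right; rewrite R.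
    + rewrite codf_tens ed zip_cat ?size_map ?(size_codf fG) ?s1 // mem_cat => -[].
      case: u => u; rewrite !zip_sum ?orbF => h wm; last by left.
      by right; rewrite R.
    + by right; rewrite R R2; left.
  case: v => [[v|v]|v]; rewrite ?zip_sum //; case: u => [u|u]; rewrite ?zip_sum // => h wm.
  right; rewrite R R2; right; split=> //; rewrite -/dX -/cX -(wi_dom w).
  exact: mem_zip_mapq.
- move=> y z t; rewrite R; case: y z => y [] z // h.
  + by exists (inl (inl y)), (inl (inl z)); rewrite L L2 link_tensE; split=> //; left.
  + exists (inl (inl y)), (inr z); split=> //; rewrite L L2; left; case: h => h wm; split=> //.
    by rewrite codf_tens ed zip_cat ?size_map ?(size_codf fG) ?s1 // mem_cat !zip_sum h.
  + move: h; rewrite R2 => -[h|[]].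
      by exists (inr y), (inr z); rewrite L L2; split=> //; left.
    rewrite -/dX -/cX -{1}(wi_dom w) => /zip_mapq_mem[x h <-] wm.
    exists (inr y), (inl (inr x)); split=> //; rewrite L; right; split=> //.
    by rewrite !zip_sum.
- have uq : uniq (map q (domf (cospan_id (sval X)))) by rewrite (wi_dom w).
  have no1 x : (forall u : (cvert G + cvert (cospan_id (sval X))) + cvert F,
      ~~ match u with inl (inr y) => edgeb y x | _ => false end) ->
      x \in domf (cospan_id (sval X)).
    move=> h; apply: contraT; rewrite -(has_in_wire fI pX pX (wi_bound w x)).
    case/has_inP=> u [t hu]; case/negP: (h (inl (inr u))); apply/edgebP; by exists t.
  have no2 y : (forall u : (cvert G + cvert (cospan_id (sval X))) + cvert F,
      ~~ match u with inl (inr x) => (x, y) \in zip (codf (cospan_id (sval X))) dX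
         | _ => false end) -> y \notin dX.
    move=> h; apply/negP => hy; have [|x hx] := nth_mem_zip' _ hy (s := codf (cospan_id (sval X))).
      by rewrite (size_codf fI).
    by case/negP: (h (inl (inr x))).
  have qX x : x \in domf (cospan_id (sval X)) -> q x \in dX.
    by move=> hx; rewrite -(wi_dom w) map_f.
  case=> [[u|u]|u] [[v|v]|v] //= e h1 h2; try by case: e => ->.
  + by case: e => /(map_uniq_inj uq (no1 _ h1) (no1 _ h2)) ->.
  + by case: e => e; have := no2 _ h2; rewrite -e qX // no1.
  + by case: e => e; have := no2 _ h1; rewrite e qX // no1.
- rewrite (domf_lcomp _ _ fG) domf_tr (domf_lcomp _ _ ft) domf_tens map_cat.
  by rewrite take_size_cat ?size_map ?(size_domf fG) // -!map_comp.
- by rewrite (codf_lcomp _ _ ftr) codf_tr [in RHS]codf_tr (codf_lcomp _ _ fF) -map_take -map_comp.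
Qed.

Lemma no_edge_dom X (w : cvert (cospan_id X)) : positive X ->
  w \in domf (cospan_id X) ++ codf (cospan_id X) ->
  (forall x, ~~ edgeb x w) -> w \in domf (cospan_id X).
Proof.
move=> pX bw h; apply: contraT; rewrite -(has_in_wire (framed_id X) pX pX bw).
by case/has_inP=> u [t hu]; case/negP: (h u); apply/edgebP; exists t.
Qed.

(** Mirror image of [FCsp_trm_natl]: each trace wire now leaves an identity wire, which is
    contracted onto [cX]. *)
Lemma FCsp_trm_natr (X A B B' : Ob (FCspP T)) (f : Hom (tensO A X) (tensO B X)) (b : Hom B B') :
  trm X (compm (tensm b (idm X)) f) = compm b (trm X f).
Proof.
have [F rF] := rep_ex f; have [G rG] := rep_ex b.
have [fF fG] := (rep_framed rF, rep_framed rG).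
have [pX pA pB' pB] := And4 (svalP X) (svalP A) (svalP B') (svalP B).
have [pAX pBX pB'X] := And3 (positive_cat pA pX) (positive_cat pB pX) (positive_cat pB' pX).
have rt := rep_tens rG (rep_id X); have ft := rep_framed rt.
have rl := rep_comp rF rt; have fl := rep_framed rl.
have rtr := rep_tr rF; have ftr := rep_framed rtr.
have fI := framed_id (sval X).
apply: (rep_eq (rep_tr rl) (rep_comp rtr rG)).
have [ed ec [s1 s2 s3 s4] [[t1 t2 t3 t4] _]] := frame_split fF.
set dA := take _ (domf F) in ed s1 t1; set dX := drop _ (domf F) in ed s2 t2.
set cB := take _ (codf F) in ec s3 t3; set cX := drop _ (codf F) in ec s4 t4.
have [q w] := wires_id pX t4.
have L u v t : link (G := cospan_tr (sval X) (sval A) (sval B') _) u v t = _ :=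
  link_trE u v t fl pAX pB'X.
rewrite (codf_lcomp _ _ ft) (domf_lcomp _ _ fF) codf_tens in L.
rewrite map_cat drop_size_cat ?size_map ?(size_codf fG) // -map_drop -/dX in L.
have L2 u v t := link_lcompE u v t fF ft pAX pBX pB'X.
have R u v t := link_lcompE u v t ftr fG pA pB pB'.
have R2 u v t := link_trE u v t fF pAX pBX.
have wm (u : cvert F) y : (u, y) \in zip cX (domf (cospan_id (sval X))) ->
    exists t, wire_mid u t.
  case/mem_zip=> hu _; apply: (wire_mid_cod fF) => //.
  by rewrite ec mem_cat hu orbT.
have ez : zip (codf F) (domf (cospan_tens G (cospan_id (sval X)))) =
    zip cB (map inl (domf G)) ++ zip cX (map inr (domf (cospan_id (sval X)))).
  by rewrite domf_tens ec zip_cat // size_map (size_domf fG).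
contr_by (fun u : cvert F + (cvert G + cvert (cospan_id (sval X))) =>
    match u with inl x => inl x | inr (inl y) => inr y | inr (inr w) => inl (q w) end)
  (fun u v : cvert F + (cvert G + cvert (cospan_id (sval X))) => match u, v with
    | inr (inr w), inr (inr w') => edgeb w w'
    | inl x, inr (inr w) => (x, w) \in zip cX (domf (cospan_id (sval X)))
    | _, _ => false end)
  (fun u : cvert F + (cvert G + cvert (cospan_id (sval X))) => match u with
    | inl _ => 0 | inr (inl _) => 0
    | inr (inr w) => if w \in domf (cospan_id (sval X)) then 1 else 2 end).
- by case=> [u|[u|u]] //; exact: wi_type w u.
- by case=> z; [exists (inl z)|exists (inr (inl z))].
- case=> [u|[u|u]] [v|[v|v]] //.
    move=> h; have [hu hv] := mem_zip h; split; [|by rewrite hv|].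
      by congr inl; rewrite -[cX in zip cX](wi_dom w) in h; rewrite (mem_zip_map h).
    have [t ht] := wm _ _ h.
    by exists t; rewrite L; left; rewrite L2; split=> //; rewrite ez mem_cat !zip_sum h orbT.
  case/edgebP=> t h; have [hu hv] := link_lt fI pX pX (wi_bound w) h.
  rewrite hu (negbTE hv) (wi_link w h); split=> //; exists t.
  by rewrite L; left; rewrite L2 link_tensE.
- move=> u v t; rewrite L => -[|[]].
    rewrite L2; case: u v => [u|u] [v|v] //; rewrite ?link_tensE.
    + by right; rewrite R R2; left.
    + rewrite ez mem_cat => -[].
      case: v => v; rewrite !zip_sum ?orbF => h wm'; last by left.
      by right; rewrite R.
    + case: u v => u [] v // h; last by left; apply/edgebP; exists t.
      by right; rewrite R.
  case: v => [v|v]; rewrite ?zip_sum //; case: u => [u|[u|u]]; rewrite ?zip_sum // => h wm'.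
  right; rewrite R R2; right; rewrite -/dX -/cX -(wi_cod w); split; first exact: mem_zip_mapq'.
  by case: wm' => o [h1 ->]; exists o; split=> //; rewrite (wi_type w).
- move=> y z t; rewrite R; case: y z => y [] z // h.
  + move: h; rewrite R2 => -[h|[]].
      by exists (inl y), (inl z); rewrite L L2; split=> //; left.
    rewrite -/dX -/cX -{1}(wi_cod w) => /zip_mapq_mem'[x h <-] wm'.
    exists (inr (inr x)), (inl z); split=> //; rewrite L; right; split.
      by rewrite !zip_sum.
    by case: wm' => o [h1 ->]; exists o; split=> //; rewrite (wi_type w) in h1.
  + exists (inl y), (inr (inl z)); split=> //; rewrite L L2; left; case: h => h wm'; split=> //.
    by rewrite ez mem_cat !zip_sum h.
  + by exists (inr (inl y)), (inr (inl z)); rewrite L L2 link_tensE; split=> //; left.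
- have no x : (forall u : cvert F + (cvert G + cvert (cospan_id (sval X))),
      ~~ match u with inl y => (y, x) \in zip cX (domf (cospan_id (sval X)))
         | inr (inr y) => edgeb y x | _ => false end) -> False.
    move=> h; have hd : x \in domf (cospan_id (sval X)).
      by apply: no_edge_dom (wi_bound w x) _ => // y; apply: (h (inr (inr y))).
    have [|y hy] := nth_mem_zip' _ hd (s := cX); first by rewrite s4 (size_domf fI).
    by case/negP: (h (inl y)).
  case=> [u|[u|u]] [v|[v|v]] //= e h1 h2; try by case: e => ->.
  + by case: (no v).
  + by case: (no u).
  + by case: (no u).
- by rewrite (domf_lcomp _ _ ftr) domf_tr [in RHS]domf_tr (domf_lcomp _ _ fF) -map_take -map_comp.
- rewrite (codf_lcomp _ _ fG) codf_tr (codf_lcomp _ _ ft) codf_tens map_cat.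
  by rewrite take_size_cat ?size_map ?(size_codf fG) // -!map_comp.
Qed.

Lemma FCsp_trm_unit (A B : Ob (FCspP T)) (f : Hom (tensO A unitO) (tensO B unitO)) :
  trm unitO f = castm (tensO1 A) (tensO1 B) f.
Proof.
have [F rF] := rep_ex f; have fF := rep_framed rF.
apply: (rep_eq (rep_tr rF) (rep_cast _ _ rF)).
have [sd sc] := (size_domf fF, size_codf fF).
contr_by_bij (fun u : cvert F => u); rewrite ?map_id //.
- by exists id.
- move=> u v t; rewrite (link_trE _ _ _ fF (svalP (tensO A unitO)) (svalP (tensO B unitO))).
  rewrite drop_oversize ?sd /= ?cats0 //; split; last by left.
  by case=> // -[]; case: (drop _ (codf F)).
- by rewrite domf_tr take_oversize // sd /= cats0.
- by rewrite codf_tr take_oversize // sc /= cats0.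
Qed.

(** Both sides have the same vertices, and the traced frame entries for the product are those for
    [X] followed by those for [Y], so the trace wires agree. *)
Lemma FCsp_trm_tens (X Y A B : Ob (FCspP T))
    (f : Hom (tensO A (tensO X Y)) (tensO B (tensO X Y))) :
  trm (tensO X Y) f = trm X (trm Y (castm (tensOA A X Y) (tensOA B X Y) f)).
Proof.
have [F rF] := rep_ex f; have rF' := rep_cast (tensOA A X Y) (tensOA B X Y) rF.
have [fF fF'] := (rep_framed rF, rep_framed rF').
have rtr := rep_tr rF'; have ftr := rep_framed rtr.
apply: (rep_eq (rep_tr rF) (rep_tr rtr)).
have [pX pY pA pB] := And4 (svalP X) (svalP Y) (svalP A) (svalP B).
have [pAX pBX] := (positive_cat pA pX, positive_cat pB pX).
have [sd sc] := (size_domf fF, size_codf fF).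
have dr (S : Type) (s : seq S) m n : drop m s = drop m (take (m + n) s) ++ drop (m + n) s.
  by rewrite addnC -drop_drop -{1}(cat_take_drop n (drop m s)) take_drop.
have tk (S : Type) (s : seq S) m n : take m (take (m + n) s) = take m s.
  by rewrite -take_min (minn_idPl (leq_addr _ _)).
contr_by_bij (fun u : cvert F => u); rewrite ?map_id //.
- by exists id.
- move=> u v t; rewrite (link_trE _ _ _ fF (positive_cat pA (positive_cat pX pY))
    (positive_cat pB (positive_cat pX pY))).
  rewrite (link_trE _ _ _ ftr pAX pBX) (link_trE _ _ _ fF' (positive_cat pAX pY)
    (positive_cat pBX pY)) domf_tr codf_tr !size_cat.
  rewrite (dr _ (domf F) (size (sval A)) (size (sval X))).
  rewrite (dr _ (codf F) (size (sval B)) (size (sval X))) zip_cat.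
    rewrite mem_cat; split=> [[l|[/orP[h|h] wm]]|[[l|[h wm]]|[h wm]]].
    - by left; left.
    - by right.
    - by left; right.
    - by left.
    - by right; rewrite h orbT.
    - by right; rewrite h.
  rewrite !size_drop !size_take sd sc !size_cat !addnA.
  by rewrite -!/(minn _ _) !(minn_idPl (leq_addr _ _)) !addKn.
- by rewrite /= size_cat tk.
- by rewrite /= size_cat tk.
Qed.

Lemma FCsp_trm_super (X A B D E : Ob (FCspP T)) (g : Hom D E)
    (f : Hom (tensO A X) (tensO B X)) :
  trm X (castm (tensOA D A X) (tensOA E B X) (tensm g f)) = tensm g (trm X f).
Proof.
have [F rF] := rep_ex f; have [G rG] := rep_ex g.
have rt := rep_cast (tensOA D A X) (tensOA E B X) (rep_tens rG rF).
have [fF fG ft] := And3 (rep_framed rF) (rep_framed rG) (rep_framed rt).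
apply: (rep_eq (rep_tr rt) (rep_tens rG (rep_tr rF))).
have [pX pA pB pD] := And4 (svalP X) (svalP A) (svalP B) (svalP D); have pE := svalP E.
have [pDA pEB] := (positive_cat pD pA, positive_cat pE pB).
contr_by_bij (fun u : cvert G + cvert F => u); rewrite ?map_id //.
- by exists id.
- move=> u v t; rewrite (link_trE _ _ _ ft (positive_cat pDA pX) (positive_cat pEB pX)).
  rewrite domf_tens codf_tens !size_cat.
  rewrite !drop_cat !size_map (size_domf fG) (size_codf fG) !ltnNge !leq_addr /= !addKn.
  rewrite -!map_drop [X in X \/ _ <-> _]link_tensE link_tensE.
  case: u v => u [] v; rewrite ?zip_sum; try by split=> // -[|[]].
    by split=> [[//|[]]|]; [|left].
  by rewrite (link_trE _ _ _ fF (positive_cat pA pX) (positive_cat pB pX)).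
- by rewrite /= size_cat take_cat size_map (size_domf fG) ltnNge leq_addr /= addKn map_take.
- by rewrite /= size_cat take_cat size_map (size_codf fG) ltnNge leq_addr /= addKn map_take.
Qed.

(** Tracing the symmetry joins the two copies of each wire into a path of three links; the last two
    are contracted. *)
Lemma FCsp_trm_yank (X : Ob (FCspP T)) : trm X (symm X X) = idm X.
Proof.
have pX := svalP X; have rs := rep_symm X X; have fs := rep_framed rs.
apply: (rep_eq (rep_tr rs) (rep_id X)); set I := 'I_(size (sval X)).
have L u v t : link (G := cospan_tr (sval X) (sval X) (sval X) _) u v t = _ :=
  link_trE u v t fs (positive_cat pX pX) (positive_cat pX pX).
have L2 u v t : link (G := cospan_symm (sval X) (sval X)) u v t = _ :=
  link_tensE (G := cospan_id (sval X)) (H := cospan_id (sval X)) u v t.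
have N u v t := link_id (X := sval X) u v t pX.
rewrite /= !drop_size_cat ?size_map -?enumT ?size_enum_ord // in L.
have zI (i j : I) : ((i, j) \in zip (enum I) (enum I)) = (i == j).
  apply/idP/eqP => [|<-]; first by rewrite -{2}[enum I]map_id => /mem_zip_map'.
  have [j' h] := nth_mem_zip erefl (mem_enum I i).
  suff e : j' = i by rewrite e in h.
  by move: h; rewrite -{2}[enum I]map_id => /mem_zip_map'.
contr_by (fun u : (I + I) + (I + I) => match u with
    | inl (inl i) => inl i | inl (inr i) => inr i | inr (inl i) => inr i | inr (inr i) => inr i end
    : I + I)
  (fun u v : (I + I) + (I + I) => match u, v with
    | inl (inr i), inr (inl j) => i == j | inr (inl i), inr (inr j) => i == j | _, _ => false end)
  (fun u : (I + I) + (I + I) => match u with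
    | inl _ => 0 | inr (inl _) => 1 | inr (inr _) => 2 end).
- by case=> [[i|i]|[i|i]].
- by case=> i; [exists (inl (inl i))|exists (inl (inr i))].
- case=> [[i|i]|[i|i]] [[j|j]|[j|j]] // /eqP <-; split=> //.
    exists (mid_edge (tnth (in_tuple (sval X)) i).2); rewrite L !zip_sum zI eqxx.
    by right; split=> //; eexists.
  exists (mid_edge (tnth (in_tuple (sval X)) i).2); rewrite L L2; left.
  by apply/N; exists i.
- move=> u v t; rewrite L L2 => -[|[]].
    case: u v => u [] v // /N[i [-> -> ->]]; last by left; rewrite /= eqxx.
    by right; apply/N; exists i.
  case: u v => [[i|i]|[i|i]] [[j|j]|[j|j]]; rewrite !zip_sum // zI eq_sym; by left.
- move=> u v t /N[i [-> -> ->]]; exists (inl (inl i)), (inl (inr i)); split=> //.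
  by rewrite L L2; left; apply/N; exists i.
- have no (P : I + I + (I + I) -> Prop) x : (forall u, P u) -> P x by [].
  case=> [[i|i]|[i|i]] [[j|j]|[j|j]] //= [->] h1 h2 //;
    by [have := h2 (inl (inr j)); rewrite eqxx|have := h2 (inr (inl j)); rewrite eqxx
      |have := h1 (inl (inr j)); rewrite eqxx|have := h1 (inr (inl j)); rewrite eqxx].
- rewrite /= (_ : take _ _ = map inl (map inl (enum I))) -?map_comp //.
  by apply: take_size_cat; rewrite size_map -enumT size_enum_ord.
- rewrite /= (_ : take _ _ = map inr (map inr (enum I))) -?map_comp //.
  by apply: take_size_cat; rewrite size_map -enumT size_enum_ord.
Qed.

(** Both sides contract to [K], where [F] and [G] stand side by side and are traced over [X] and [Y]
    at once. The two connections between [F] and [G] are a joining wire and a trace wire, with roles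
    exchanged between the sides; in [K] both are trace wires. *)
Lemma FCsp_trm_slide (X Y A B : Ob (FCspP T)) (f : Hom (tensO A X) (tensO B Y)) (k : Hom Y X) :
  trm X (compm (tensm (idm B) k) f) = trm Y (compm f (tensm (idm A) k)).
Proof.
have [F rF] := rep_ex f; have [G rG] := rep_ex k.
have [fF fG] := (rep_framed rF, rep_framed rG).
have [pX pA pY pB] := And4 (svalP X) (svalP A) (svalP Y) (svalP B).
have [pAX pBX] := (positive_cat pA pX, positive_cat pB pX).
have [pAY pBY] := (positive_cat pA pY, positive_cat pB pY).
have rB := rep_tens (rep_id B) rG; have rA := rep_tens (rep_id A) rG.
have [fB fA] := (rep_framed rB, rep_framed rA).
have rl := rep_comp rF rB; have fl := rep_framed rl.
have rr := rep_comp rA rF; have fr := rep_framed rr.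
have [fIA fIB] := (framed_id (sval A), framed_id (sval B)).
have [ed ec [s1 s2 s3 s4] [[t1 t2 t3 t4] [u1 u2]]] := frame_split fF.
set dA := take _ (domf F) in ed s1 t1 u1; set dX := drop _ (domf F) in ed s2 t2 u2.
set cB := take _ (codf F) in ec s3 t3; set cY := drop _ (codf F) in ec s4 t4.
(* The codomain is ordered so that the trace joins [codf G] to [dX] and [cY] to [domf G]. *)
pose Q := recod (G := cospan_tens F G) (map inl cB ++ (map inr (codf G) ++ map inl cY)).
have fQ : framed (sval A ++ (sval X ++ sval Y)) (sval B ++ (sval X ++ sval Y)) Q.
  rewrite [X in framed X]catA.
  apply: (framed_recod (positive_cat pAX pY) (positive_cat pBY pX)
    (positive_cat pB (positive_cat pX pY)) (framed_tens fF fG)).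
    by rewrite /= ec map_cat -catA perm_cat2l perm_catC.
  by rewrite !map_cat -!map_comp -t3 -t4 -(fr_cod_type fG).
pose K := cospan_tr (sval X ++ sval Y) (sval A) (sval B) Q.
have fK : framed (sval A) (sval B) K by exact: framed_tr.
have RK u v t : link (G := K) u v t = _ :=
  link_trE u v t fQ (positive_cat pA (positive_cat pX pY)) (positive_cat pB (positive_cat pX pY)).
rewrite /= ed map_cat -catA !drop_size_cat ?size_map // in RK.
have RK' (u v : cvert F + cvert G) t : link (G := K) u v t <-> match u, v with
    | inl a, inl b => link a b t
    | inr a, inr b => link a b t
    | inl a, inr b => (b, a) \in zip (domf G) cY /\ wire_mid a t
    | inr a, inl b => (b, a) \in zip dX (codf G) /\ wire_mid a t end.
  rewrite RK zip_cat ?size_map ?s2 ?(size_codf fG) // mem_cat.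
  rewrite [link _ _ _](link_tensE (G := F) (H := G)).
  by case: u v => u [] v; rewrite !zip_sum ?orbF; split=> //; try tauto; case=> // -[].
have zC (R S : eqType) (s : seq R) (r : seq S) x y : ((x, y) \in zip s r) = ((y, x) \in zip r s).
  by elim: s r => [|x' s IH] [|y' r] //=; rewrite !inE !xpair_eqE IH andbC.
have dK : domf K = map inl dA.
  by rewrite /K domf_tr /= ed map_cat -catA take_size_cat ?size_map.
have cK : codf K = map inl cB by rewrite /K codf_tr /= take_size_cat ?size_map.
apply: (rep_eq2 (rep_tr rl) (rep_tr rr) fK).
(* Left-hand side: the identity wires on [B] are contracted onto [cB]. *)
- have [q w] := wires_id pB t3; set W := cospan_id (sval B) in q w fIB.
  have L u v t : link (G := cospan_tr (sval X) (sval A) (sval B) _) u v t = _ :=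
    link_trE u v t fl pAX pBX.
  rewrite (domf_lcomp _ _ fF) (codf_lcomp _ _ fB) codf_tens -map_drop -/dX in L.
  rewrite map_cat drop_size_cat ?size_map -?enumT ?size_enum_ord // in L.
  have dL : domf (cospan_tr (sval X) (sval A) (sval B) (lcomp (sval B ++ sval Y) (sval A ++ sval X)
      (sval B ++ sval X) F (cospan_tens W G))) = map inl dA.
    by rewrite domf_tr (domf_lcomp _ _ fF) -map_take.
  have cL : codf (cospan_tr (sval X) (sval A) (sval B) (lcomp (sval B ++ sval Y) (sval A ++ sval X)
      (sval B ++ sval X) F (cospan_tens W G))) = map inr (map inl (codf W)).
    rewrite codf_tr (codf_lcomp _ _ fB) codf_tens map_cat.
    by rewrite take_size_cat ?size_map -?enumT ?size_enum_ord.
  have L2 u v t := link_lcompE u v t fF fB pAX pBY pBX.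
  have ez : zip (codf F) (domf (cospan_tens W G)) =
      zip cB (map inl (domf W)) ++ zip cY (map inr (domf G)).
    by rewrite domf_tens ec zip_cat // size_map (size_domf fIB).
  contr_by (fun u : cvert F + (cvert W + cvert G) =>
      match u with inl x => inl x | inr (inl w) => inl (q w) | inr (inr y) => inr y end)
    (fun u v : cvert F + (cvert W + cvert G) => match u, v with
      | inr (inl w), inr (inl w') => edgeb w w'
      | inl x, inr (inl w) => (x, w) \in zip cB (domf W)
      | _, _ => false end)
    (fun u : cvert F + (cvert W + cvert G) => match u with
      | inl _ => 0 | inr (inr _) => 0 | inr (inl w) => if w \in domf W then 1 else 2 end).
  + by case=> [u|[u|u]] //; exact: wi_type w u.
  + by case=> z; [exists (inl z)|exists (inr (inr z))].
  + case=> [u|[u|u]] [v|[v|v]] //.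
      move=> h; have [hu hv] := mem_zip h; split; [|by rewrite hv|].
        by congr inl; rewrite -[cB in zip cB](wi_dom w) in h; rewrite (mem_zip_map h).
      have [|t ht] := wire_mid_cod fF pAX pBY (u := u); first by rewrite ec mem_cat hu.
      by exists t; rewrite L; left; rewrite L2; split=> //; rewrite ez mem_cat !zip_sum h.
    case/edgebP=> t h; have [hu hv] := link_lt fIB pB pB (wi_bound w) h.
    rewrite hu (negbTE hv) (wi_link w h); split=> //; exists t.
    by rewrite L; left; rewrite L2 link_tensE.
  + move=> u v t; rewrite L => -[|[]].
      rewrite L2; case: u v => [u|u] [v|v] //; rewrite ?link_tensE.
      * by right; apply/RK'.
      * rewrite ez mem_cat => -[].
        case: v => v; rewrite !zip_sum ?orbF => h wm'; first by left.
        by right; apply/RK'; split=> //; rewrite zC.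
      * case: u v => u [] v // h; first by left; apply/edgebP; exists t.
        by right; apply/RK'.
    case: v => [v|v]; rewrite ?zip_sum //; case: u => [u|[u|u]]; rewrite ?zip_sum // => h wm'.
    by right; apply/RK'.
  + move=> y z t /RK'; case: y z => y [] z h.
    * by exists (inl y), (inl z); rewrite L L2; split=> //; left.
    * exists (inl y), (inr (inr z)); split=> //; rewrite L L2; left; case: h => h wm'; split=> //.
      by rewrite ez mem_cat !zip_sum zC h.
    * exists (inr (inr y)), (inl z); split=> //; rewrite L; right; case: h => h wm'; split=> //.
      by rewrite !zip_sum.
    * by exists (inr (inr y)), (inr (inr z)); rewrite L L2 link_tensE; split=> //; left.
  + have no x : (forall u : cvert F + (cvert W + cvert G),
        ~~ match u with inl y => (y, x) \in zip cB (domf W)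
           | inr (inl y) => edgeb y x | _ => false end) -> False.
      move=> h; have hd : x \in domf W.
        by apply: no_edge_dom (wi_bound w x) _ => // y; apply: (h (inr (inl y))).
      have [|y hy] := nth_mem_zip' _ hd (s := cB); first by rewrite s3 (size_domf fIB).
      by case/negP: (h (inl y)).
    case=> [u|[u|u]] [v|[v|v]] //= e h1 h2; try by case: e => ->.
    * by case: (no v).
    * by case: (no u).
    * by case: (no u).
  + by rewrite [RHS](congr1 (map _) dL) -map_comp; exact: dK.
  + apply: (etrans cK); apply: (etrans _ (congr1 (map _) (esym cL))).
    by rewrite -(wi_cod w) -!map_comp; apply: eq_map.
(* Right-hand side: the identity wires on [A] are contracted onto [dA]. *)
have [q w] := wires_id pA t1; set W := cospan_id (sval A) in q w fIA.
have L u v t : link (G := cospan_tr (sval Y) (sval A) (sval B) _) u v t = _ :=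
  link_trE u v t fr pAY pBY.
rewrite (domf_lcomp _ _ fA) (codf_lcomp _ _ fF) domf_tens -!map_drop -/cY in L.
rewrite drop_size_cat ?size_map -?enumT ?size_enum_ord // in L.
have dL : domf (cospan_tr (sval Y) (sval A) (sval B) (lcomp (sval A ++ sval X) (sval A ++ sval Y)
    (sval B ++ sval Y) (cospan_tens W G) F)) = map inl (map inl (domf W)).
  rewrite domf_tr (domf_lcomp _ _ fA) domf_tens map_cat.
  by rewrite take_size_cat ?size_map -?enumT ?size_enum_ord.
have cL : codf (cospan_tr (sval Y) (sval A) (sval B) (lcomp (sval A ++ sval X) (sval A ++ sval Y)
    (sval B ++ sval Y) (cospan_tens W G) F)) = map inr cB.
  by rewrite codf_tr (codf_lcomp _ _ fF) -map_take.
have L2 u v t := link_lcompE u v t fA fF pAY pAX pBY.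
have ez : zip (codf (cospan_tens W G)) (domf F) =
    zip (map inl (codf W)) dA ++ zip (map inr (codf G)) dX.
  by rewrite codf_tens ed zip_cat // size_map (size_codf fIA).
contr_by (fun u : (cvert W + cvert G) + cvert F =>
    match u with inr x => inl x | inl (inl w) => inl (q w) | inl (inr y) => inr y end)
  (fun u v : (cvert W + cvert G) + cvert F => match u, v with
    | inl (inl w), inl (inl w') => edgeb w w'
    | inl (inl w), inr x => (w, x) \in zip (codf W) dA
    | _, _ => false end)
  (fun u : (cvert W + cvert G) + cvert F => match u with
    | inr _ => 2 | inl (inr _) => 0 | inl (inl w) => if w \in domf W then 0 else 1 end).
- by case=> [[u|u]|u] //; exact: wi_type w u.
- by case=> z; [exists (inr z)|exists (inl (inr z))].
- case=> [[u|u]|u] [[v|v]|v] //.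
    case/edgebP=> t h; have [hu hv] := link_lt fIA pA pA (wi_bound w) h.
    rewrite hu (negbTE hv) (wi_link w h); split=> //; exists t.
    by rewrite L; left; rewrite L2 link_tensE.
  move=> h; have [hu hv] := mem_zip h; split; [|by case: ifP|].
    by congr inl; rewrite -[dA in zip _ dA](wi_cod w) in h; rewrite (mem_zip_map' h).
  have [t ht] := wire_mid_cod fIA pA pA hu; exists t; rewrite L; left; rewrite L2; split=> //.
  by rewrite ez mem_cat !zip_sum h.
- move=> u v t; rewrite L => -[|[]].
    rewrite L2; case: u v => [u|u] [v|v] //; rewrite ?link_tensE.
    + case: u v => u [] v // h; first by left; apply/edgebP; exists t.
      by right; apply/RK'.
    + rewrite ez mem_cat => -[].
      case: u => u; rewrite !zip_sum ?orbF => h wm'; first by left.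
      by right; apply/RK'; split=> //; rewrite zC.
    + by right; apply/RK'.
  case: u => u; first by rewrite zip_r0.
  case: v => [[v|v]|v]; rewrite ?zip_sum // => h wm'.
  by right; apply/RK'.
- move=> y z t /RK'; case: y z => y [] z h.
  + by exists (inr y), (inr z); rewrite L L2; split=> //; left.
  + exists (inr y), (inl (inr z)); split=> //; rewrite L; right; case: h => h wm'; split=> //.
    by rewrite !zip_sum.
  + exists (inl (inr y)), (inr z); split=> //; rewrite L L2; left; case: h => h wm'; split=> //.
    by rewrite ez mem_cat !zip_sum zC h.
  + by exists (inl (inr y)), (inl (inr z)); rewrite L L2 link_tensE; split=> //; left.
- have uq : uniq (map q (domf W)) by rewrite (wi_dom w).
  have no1 x : (forall u : (cvert W + cvert G) + cvert F,
      ~~ match u with inl (inl y) => edgeb y x | _ => false end) -> x \in domf W.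
    move=> h; apply: no_edge_dom (wi_bound w x) _ => // y; exact: (h (inl (inl y))).
  have no2 y : (forall u : (cvert W + cvert G) + cvert F,
      ~~ match u with inl (inl x) => (x, y) \in zip (codf W) dA | _ => false end) -> y \notin dA.
    move=> h; apply/negP => hy; have [|x hx] := nth_mem_zip' _ hy (s := codf W).
      by rewrite (size_codf fIA).
    by case/negP: (h (inl (inl x))).
  have qX x : x \in domf W -> q x \in dA by move=> hx; rewrite -(wi_dom w) map_f.
  case=> [[u|u]|u] [[v|v]|v] //= e h1 h2; try by case: e => ->.
  + by case: e => /(map_uniq_inj uq (no1 _ h1) (no1 _ h2)) ->.
  + by case: e => e; have := no2 _ h2; rewrite -e qX // no1.
  + by case: e => e; have := no2 _ h1; rewrite e qX // no1.
- apply: (etrans dK); apply: (etrans _ (congr1 (map _) (esym dL))).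
  by rewrite -(wi_dom w) -!map_comp; apply: eq_map.
- by rewrite [RHS](congr1 (map _) cL) -map_comp; exact: cK.
Qed.

Lemma is_sst_FCspP : is_sst (FCspP T).
Proof.
split.
- exact: FCsp_comp1m.
- exact: FCsp_compm1.
- exact: FCsp_compmA.
- exact: FCsp_tensm_id.
- exact: FCsp_tensm_comp.
- exact: FCsp_tensmA.
- exact: FCsp_tens1m.
- exact: FCsp_tensm1.
- exact: FCsp_symm_nat.
- exact: FCsp_symmK.
- exact: FCsp_hexagon.
- exact: FCsp_trm_natl.
- exact: FCsp_trm_natr.
- exact: FCsp_trm_slide.
- exact: FCsp_trm_unit.
- exact: FCsp_trm_tens.
- exact: FCsp_trm_super.
- exact: FCsp_trm_yank.
Qed.

End TraceLaws.

(** * Arrows and permutations in a symmetric traced category *)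

(* Arrows bundled with their endpoints, so that the strict associativity and
   unit laws become plain equations without casts. *)
Record arr (V : sst_data) := Arr { adom : Ob V; acod : Ob V; ahom : Hom adom acod }.
Arguments Arr {V adom acod} ahom.

Section Arrows.
Variable V : sst_data.
Local Open Scope sst_scope.
Implicit Types (A B D X Y : Ob V) (f g h k : arr V).

Lemma Arr_castm A B A' B' (eA : A = A') (eB : B = B') (f : Hom A B) :
  Arr (castm eA eB f) = Arr f.
Proof. by subst. Qed.

Lemma castm_irr A B (eA : A = A) (eB : B = B) (f : Hom A B) : castm eA eB f = f.
Proof. by rewrite (proof_irrelevance _ eA erefl) (proof_irrelevance _ eB erefl). Qed.

(** The casts that come out of an equality of bundles are along loops, which proof irrelevance makes
    trivial. *)
Lemma Arr_inj A B (f f' : Hom A B) : Arr f = Arr f' -> f = f'.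
Proof.
move=> e; suff h a (eA : adom a = A) (eB : acod a = B) :
    Arr f = a -> castm eA eB (ahom a) = f.
  by rewrite -(h (Arr f') erefl erefl e).
by move=> ea; subst a; rewrite castm_irr.
Qed.

(** Total composition, decided by excluded middle. The junk value [f] keeps [adom_comp] free of a
    side condition, as [aid A] does for [atr] and [adom_tr]. *)
Definition acomp g f : arr V :=
  match excluded_middle_informative (acod f = adom g) with
  | left e => Arr (ahom g ∘ castm erefl e (ahom f))
  | right _ => f
  end.

Definition atens f g : arr V := Arr (ahom f ⊠ ahom g).
Definition aid A : arr V := Arr (idm A).
Definition asym A B : arr V := Arr (symm A B).

Definition atr X A B f : arr V :=
  match excluded_middle_informative (adom f = A ⊗ X /\ acod f = B ⊗ X) with
  | left e => Arr (trm X (castm (proj1 e) (proj2 e) (ahom f)))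
  | right _ => aid A
  end.

Lemma acompE A B D (g : Hom B D) (f : Hom A B) : acomp (Arr g) (Arr f) = Arr (g ∘ f).
Proof.
rewrite /acomp /=; case: excluded_middle_informative => // e.
by rewrite (proof_irrelevance _ e erefl).
Qed.

Lemma atrE X A B (f : Hom (A ⊗ X) (B ⊗ X)) : atr X A B (Arr f) = Arr (trm X f).
Proof.
rewrite /atr; case: excluded_middle_informative => [e|[]//].
by rewrite (proof_irrelevance _ (proj1 e) erefl) (proof_irrelevance _ (proj2 e) erefl).
Qed.

Definition ty f A B := adom f = A /\ acod f = B.

Lemma adom_comp g f : adom (acomp g f) = adom f.
Proof. by rewrite /acomp; case: excluded_middle_informative. Qed.
Lemma acod_comp g f : acod f = adom g -> acod (acomp g f) = acod g.
Proof. by rewrite /acomp; case: excluded_middle_informative. Qed.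
Lemma adom_tens f g : adom (atens f g) = adom f ⊗ adom g. Proof. by []. Qed.
Lemma acod_tens f g : acod (atens f g) = acod f ⊗ acod g. Proof. by []. Qed.
Lemma adom_tr X A B f : adom (atr X A B f) = A.
Proof. by rewrite /atr; case: excluded_middle_informative. Qed.
Lemma acod_tr X A B f : adom f = A ⊗ X -> acod f = B ⊗ X -> acod (atr X A B f) = B.
Proof. by move=> h h'; rewrite /atr; case: excluded_middle_informative => // -[]. Qed.

Hypothesis HV : is_sst V.

Lemma acompA f g h : acod f = adom g -> acod g = adom h ->
  acomp h (acomp g f) = acomp (acomp h g) f.
Proof.
case: f => A B f; case: g => A' D g; case: h => A'' E h /= e e'; subst.
by rewrite !acompE (compmA HV).
Qed.

Lemma acomp1l A f : acod f = A -> acomp (aid A) f = f.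
Proof. by case: f => B D f /= e; subst; rewrite acompE (comp1m HV). Qed.
Lemma acomp1r A f : adom f = A -> acomp f (aid A) = f.
Proof. by case: f => B D f /= e; subst; rewrite acompE (compm1 HV). Qed.

Lemma atensA f g h : atens f (atens g h) = atens (atens f g) h.
Proof. by rewrite [RHS]/atens -(tensmA HV) Arr_castm. Qed.
Lemma atens1l f : atens (aid unitO) f = f.
Proof. by case: f => A B f; rewrite -[in RHS](tens1m HV f) Arr_castm. Qed.
Lemma atens1r f : atens f (aid unitO) = f.
Proof. by case: f => A B f; rewrite -[in RHS](tensm1 HV f) Arr_castm. Qed.
Lemma atens_id A B : atens (aid A) (aid B) = aid (A ⊗ B).
Proof. by rewrite /aid -(tensm_id HV). Qed.

Lemma atens_comp f g f' g' : acod f = adom g -> acod f' = adom g' ->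
  atens (acomp g f) (acomp g' f') = acomp (atens g g') (atens f f').
Proof.
case: f => A B f; case: g => A' D g; case: f' => C E f'; case: g' => C' E' g' /= e e'; subst.
by rewrite /atens !acompE /= (tensm_comp HV).
Qed.

Lemma asym_nat f g :
  acomp (asym (acod f) (acod g)) (atens f g) = acomp (atens g f) (asym (adom f) (adom g)).
Proof.
case: f => A B f; case: g => A' D g; rewrite /asym /atens /= !acompE.
by rewrite (symm_nat HV).
Qed.

Lemma asymK A B : acomp (asym B A) (asym A B) = aid (A ⊗ B).
Proof. by rewrite acompE (symmK HV). Qed.

Lemma asym_tensr A B D : asym A (B ⊗ D) =
  acomp (atens (aid B) (asym A D)) (atens (asym A B) (aid D)).
Proof.
rewrite /asym (symm_hexagon HV) -acompE !Arr_castm; congr acomp.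
Qed.

Lemma atr_natl X A B f a : adom f = A ⊗ X -> acod f = B ⊗ X -> acod a = A ->
  atr X (adom a) B (acomp f (atens a (aid X))) = acomp (atr X A B f) a.
Proof.
case: f => D E f; case: a => A' A'' a /= e e' e''; subst.
by rewrite /atens /= acompE !atrE acompE (trm_natl HV).
Qed.

Lemma atr_natr X A B f b : adom f = A ⊗ X -> acod f = B ⊗ X -> adom b = B ->
  atr X A (acod b) (acomp (atens b (aid X)) f) = acomp b (atr X A B f).
Proof.
case: f => D E f; case: b => A' A'' a /= e e' e''; subst.
by rewrite /atens /= acompE !atrE acompE (trm_natr HV).
Qed.

Lemma atr_slide X Y A B f k : adom f = A ⊗ X -> acod f = B ⊗ Y -> adom k = Y -> acod k = X ->
  atr X A B (acomp (atens (aid B) k) f) = atr Y A B (acomp f (atens (aid A) k)).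
Proof.
case: f => D E f; case: k => A' A'' a /= e e' e2 e3; subst.
by rewrite /atens /= !acompE !atrE (trm_slide HV).
Qed.

Lemma atr_tens X Y A B f : adom f = A ⊗ X ⊗ Y -> acod f = B ⊗ X ⊗ Y ->
  atr (X ⊗ Y) A B f = atr X A B (atr Y (A ⊗ X) (B ⊗ X) f).
Proof.
case: f => D E f /= e e'; subst.
have e : Arr f = Arr (castm (esym (tensOA A X Y)) (esym (tensOA B X Y)) f) by rewrite Arr_castm.
rewrite {1}e !atrE (trm_tens HV); congr Arr; congr trm; congr trm; apply: Arr_inj.
by rewrite !Arr_castm.
Qed.

Lemma atr_super X A B f g : adom f = A ⊗ X -> acod f = B ⊗ X ->
  atr X (adom g ⊗ A) (acod g ⊗ B) (atens g f) = atens g (atr X A B f).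
Proof.
case: f => D E f; case: g => A' B' g /= e e'; subst.
rewrite atrE [RHS]/atens /= -(trm_super HV) -atrE Arr_castm //.
Qed.

Lemma atr_yank X : atr X X X (asym X X) = aid X.
Proof. by rewrite atrE (trm_yank HV). Qed.

End Arrows.

Opaque acomp atr.

Ltac ob := rewrite ?tensOA ?tens1O ?tensO1; try done;
  repeat match goal with
  | H : adom _ = _ |- _ => rewrite ?H /=; clear H
  | H : acod _ = _ |- _ => rewrite ?H /=; clear H
  end; rewrite ?tensOA ?tens1O ?tensO1; try done.
Ltac aty := rewrite /=;
  repeat match goal with
  | |- context [adom (acomp ?g ?f)] => rewrite (adom_comp g f) /=
  | |- context [adom (atr ?X ?A ?B ?f)] => rewrite (adom_tr X A B f) /=
  | |- context [acod (acomp ?g ?f)] => rewrite (@acod_comp _ g f) /=; [|solve [aty]]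
  | |- context [acod (atr ?X ?A ?B ?f)] =>
      rewrite (@acod_tr _ X A B f) /=; [|solve [aty]|solve [aty]]
  end; ob.

(** * Unit and hexagon laws of the symmetry *)

Section SymmetryLaws.
Variables (V : sst_data) (HV : is_sst V).
Local Open Scope sst_scope.
Implicit Types (A B D X Y : Ob V) (f g h k : arr V).
Notation "g \c f" := (acomp g f) (at level 50, left associativity).
Notation "f \x g" := (atens f g) (at level 40, left associativity).

Let acompA := @acompA V HV.
Let acomp1l := @acomp1l V HV.
Let acomp1r := @acomp1r V HV.
Let atens1l := @atens1l V HV.
Let atens1r := @atens1r V HV.
Let atens_id := @atens_id V HV.
Let atens_comp := @atens_comp V HV.
Let asymK := @asymK V HV.
Let asym_tensr := @asym_tensr V HV.

(** With both other factors the unit, the hexagon makes [asym A unitO] idempotent, and it has a left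
    inverse by [asymK]. *)
Lemma asym1r A : asym A unitO = aid A.
Proof.
have h : asym A unitO = asym A unitO \c asym A unitO.
  by rewrite -{1}(tens1O (unitO : Ob V)) asym_tensr atens1l atens1r.
have k : asym unitO A \c asym A unitO = aid A by rewrite asymK tensO1.
rewrite -[LHS](@acomp1l A); last by aty.
by rewrite -[in LHS]k -acompA -?h ?k; aty.
Qed.

Lemma asym1l A : asym unitO A = aid A.
Proof.
have k : asym unitO A \c asym A unitO = aid A by rewrite asymK tensO1.
by rewrite -[in RHS]k asym1r acomp1r //; aty.
Qed.

(** By the hexagon, [asym D (A ⊗ B)] composed with the right-hand side is the identity, as it is
    with the left-hand side in the other order. *)
Lemma asym_tensl A B D : asym (A ⊗ B) D = (asym A D \x aid B) \c (aid A \x asym B D).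
Proof.
have k : asym (A ⊗ B) D \c asym D (A ⊗ B) = aid (D ⊗ (A ⊗ B)) by rewrite asymK.
have e : asym D (A ⊗ B) \c ((asym A D \x aid B) \c (aid A \x asym B D)) = aid (A ⊗ B ⊗ D).
  rewrite asym_tensr acompA; [|aty|aty].
  rewrite -(@acompA (asym A D \x aid B)); [|aty|aty].
  rewrite -atens_comp; [|aty..]; rewrite asymK acomp1l; [|aty].
  rewrite atens_id acomp1r; [|aty].
  rewrite -atens_comp; [|aty..].
  by rewrite asymK acomp1l ?atens_id ?tensOA; aty.
rewrite -[LHS](@acomp1r (A ⊗ B ⊗ D)); last by aty.
by rewrite -[in LHS]e acompA ?k ?acomp1l //; aty.
Qed.

End SymmetryLaws.

(** Two lists are permutations of each other iff every predicate has the same count in both, which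
    turns such goals into linear arithmetic. *)
Ltac pm := first [ assumption | apply: perm_refl |
  let a := fresh in apply/permP => a;
  repeat match goal with
  | H : is_true (perm_eq _ _) |- _ => move/permP/(_ a): H
  end; rewrite ?count_cat /= ?count_cat /=;
  repeat match goal with |- context [count a ?s] => generalize (count a s) end;
  repeat match goal with |- context [nat_of_bool ?b] => generalize (nat_of_bool b) end;
  clear; lia ].

(** * Permutations of labelled tensor factors *)

Section PermutationArrows.
Variables (V : sst_data) (HV : is_sst V).
Local Open Scope sst_scope.
Implicit Types (A B D X Y : Ob V) (f g h k : arr V).
Notation "g \c f" := (acomp g f) (at level 50, left associativity).
Notation "f \x g" := (atens f g) (at level 40, left associativity).
Let acompA := @acompA V HV.
Let acomp1l := @acomp1l V HV.
Let acomp1r := @acomp1r V HV.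
Let atensA := @atensA V HV.
Let atens1l := @atens1l V HV.
Let atens_id := @atens_id V HV.
Let atens_comp := @atens_comp V HV.
Let atr_natl := @atr_natl V HV.
Let atr_natr := @atr_natr V HV.
Let atr_super := @atr_super V HV.
Let asym_nat := @asym_nat V HV.
Let asymK := @asymK V HV.
Let asym_tensr := @asym_tensr V HV.
Let asym_tensl := @asym_tensl V HV.
Let asym1l := @asym1l V HV.
Let asym1r := @asym1r V HV.

Lemma atens_splitl f g : f \x g = (f \x aid (acod g)) \c (aid (adom f) \x g).
Proof. by rewrite -atens_comp ?acomp1l ?acomp1r //; aty. Qed.

Lemma atens_splitr f g : f \x g = (aid (acod f) \x g) \c (f \x aid (adom g)).
Proof. by rewrite -atens_comp ?acomp1l ?acomp1r //; aty. Qed.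

Lemma atens_compl D f g : acod f = adom g -> (g \c f) \x aid D = (g \x aid D) \c (f \x aid D).
Proof. by move=> e; rewrite -atens_comp ?acomp1l. Qed.

Lemma atens_compr D f g : acod f = adom g -> aid D \x (g \c f) = (aid D \x g) \c (aid D \x f).
Proof. by move=> e; rewrite -atens_comp ?acomp1l. Qed.

(** A form of the Yang-Baxter equation: bringing [Y] to the front, then [X] past [A], then
    exchanging the two, equals bringing [X] to the front and then moving [Y] past [A]. *)
Lemma asym_braid A X Y :
  (asym Y X \x aid A) \c ((aid Y \x asym A X) \c asym (A ⊗ X) Y) =
  (aid X \x asym A Y) \c (asym A X \x aid Y).
Proof.
rewrite -asym_tensr [asym (A ⊗ X) Y]asym_tensl.
rewrite (@acompA _ _ (aid Y \x asym A X)); [|aty|aty]; rewrite -asym_tensr.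
have := asym_nat (aid A) (asym X Y); rewrite /= => ->.
rewrite acompA; [|aty|aty]; rewrite -atens_compl; last by aty.
by rewrite asymK atens_id acomp1l //; aty.
Qed.

(** The same with an object [B] between the two and [D] behind them, as it arises when [shuf]
    extracts two labels in succession. *)
Lemma asym_double A X B Y D :
  (asym Y X \x aid (A ⊗ B ⊗ D)) \c
    ((aid Y \x (asym A X \x aid (B ⊗ D))) \c (asym (A ⊗ X ⊗ B) Y \x aid D)) =
  (aid X \x (asym (A ⊗ B) Y \x aid D)) \c (asym A X \x aid (B ⊗ Y ⊗ D)).
Proof.
rewrite -(atens_id (A ⊗ B) D) -(atens_id B D) -(atens_id (B ⊗ Y) D) !atensA.
rewrite -(@atens_compl D); last by aty.
rewrite -(@atens_compl D); last by aty.
rewrite -(@atens_compl D); last by aty.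
congr (_ \x _).
rewrite (asym_tensl (A ⊗ X)) (asym_tensl A B) -[aid (A ⊗ B)]atens_id atensA.
rewrite (@acompA _ _ (_ \x aid B)); [|aty|aty]; rewrite -atens_compl; last by aty.
rewrite acompA; [|aty|aty]; rewrite -atens_compl; last by aty.
rewrite -(@acompA (asym (A ⊗ X) Y)); [|aty|aty].
rewrite asym_braid atens_compr; last by aty.
rewrite -acompA; [|aty|aty].
rewrite atensA [aid X \x (aid A \x _)]atensA atens_id -(atens_id B Y).
rewrite atens_compl; last by aty.
rewrite -acompA; [|aty|aty]; congr acomp.
rewrite -(atensA (asym A X)) atens_id atens_id.
have := atens_splitr (asym A X) (asym B Y); rewrite /= => <-.
by have := atens_splitl (asym A X) (asym B Y); rewrite /= => <-.
Qed.

Section Perm.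
Variables (I : eqType) (F : I -> Ob V).
Implicit Types (s t u : seq I) (x y : I).

Definition tw s : Ob V := tensl [seq F i | i <- s].

Lemma twE s : tw s = tensl [seq F i | i <- s]. Proof. by []. Qed.
Lemma tw_cons x s : tw (x :: s) = F x ⊗ tw s. Proof. by []. Qed.
Lemma tw_cat s t : tw (s ++ t) = tw s ⊗ tw t.
Proof. by elim: s => [|x s IH] /=; rewrite ?tens1O // !tw_cons IH tensOA. Qed.

Definition front x s : arr V :=
  asym (tw (take (index x s) s)) (F x) \x aid (tw (drop (index x s).+1 s)).

(* The canonical permutation of tensor factors: factors with equal labels
   correspond. *)
Fixpoint perm_rec s t : arr V :=
  if t is x :: t' then (aid (F x) \x perm_rec (rem x s) t') \c front x s else aid unitO.
Definition shuf s t := locked (perm_rec s t).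

Lemma front_cat x s t : x \notin s -> front x (s ++ x :: t) = asym (tw s) (F x) \x aid (tw t).
Proof.
move=> nx; rewrite /front index_cat (negbTE nx) /= eqxx addn0 take_size_cat //.
by rewrite drop_cat ltnNge leqnSn /= subSnn /= drop0.
Qed.

Lemma rem_cat x s t : x \notin s -> rem x (s ++ x :: t) = s ++ t.
Proof.
elim: s => [|y s IH] /=; first by rewrite eqxx.
by rewrite inE negb_or => /andP[h /IH ->]; rewrite eq_sym (negbTE h).
Qed.

(** With [shuf] locked, this rule and [shuf_nil] stand in for its definition; the explicit
    decomposition avoids [index], [take] and [drop]. *)
Lemma shuf_cons x s1 s2 t : x \notin s1 -> shuf (s1 ++ x :: s2) (x :: t) =
  (aid (F x) \x shuf (s1 ++ s2) t) \c (asym (tw s1) (F x) \x aid (tw s2)).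
Proof. by move=> nx; rewrite /shuf -!lock /= rem_cat // front_cat. Qed.

Lemma splitx x s : x \in s -> exists s1 s2, s = s1 ++ x :: s2 /\ x \notin s1.
Proof.
move=> xs; exists (take (index x s) s), (drop (index x s).+1 s).
have li : index x s < size s by rewrite index_mem.
split; first by rewrite -{1}(cat_take_drop (index x s) s) (drop_nth x) // nth_index.
by apply: contraTN li => /index_ltn; rewrite ltnn.
Qed.

Lemma uniq_mid x s1 s2 : uniq (s1 ++ x :: s2) -> x \notin s1 /\ uniq (s1 ++ s2).
Proof. by rewrite uniq_catC /= mem_cat negb_or uniq_catC => /andP[/andP[_ ->]]. Qed.

Lemma perm_mid x s1 s2 t : perm_eq (s1 ++ x :: s2) (x :: t) = perm_eq (s1 ++ s2) t.
Proof. by rewrite -[x :: s2]/([:: x] ++ s2) perm_catCA perm_cons. Qed.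

Lemma shuf_nil : shuf [::] [::] = aid unitO.
Proof. by rewrite /shuf -lock. Qed.

Lemma ty_shuf s t : perm_eq s t -> adom (shuf s t) = tw s /\ acod (shuf s t) = tw t.
Proof.
elim: t s => [|x t IH] s st; first by rewrite (perm_nilP st) shuf_nil.
have [s1 [s2 [e nx]]] : exists s1 s2, s = s1 ++ x :: s2 /\ x \notin s1.
  by apply: splitx; rewrite (perm_mem st) mem_head.
subst s; move: st; rewrite perm_mid => st'.
have [h1 h2] := IH _ st'; rewrite shuf_cons //.
split; first by rewrite adom_comp /= tw_cat tw_cons; ob.
by rewrite acod_comp /= ?h2 // h1 tw_cat; ob.
Qed.

Lemma adom_shuf s t : perm_eq s t -> adom (shuf s t) = tw s.
Proof. by case/ty_shuf. Qed.
Lemma acod_shuf s t : perm_eq s t -> acod (shuf s t) = tw t.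
Proof. by case/ty_shuf. Qed.

Lemma shuf_id s : shuf s s = aid (tw s).
Proof.
elim: s => [|x s IH]; rewrite ?shuf_nil // -{1}[x :: s]/([::] ++ x :: s) shuf_cons //= IH.
by rewrite asym1l !atens_id acomp1l ?tw_cons; aty.
Qed.

Ltac atp := rewrite /=;
  repeat match goal with
  | |- context [adom (acomp ?g ?f)] => rewrite (adom_comp g f) /=
  | |- context [adom (atr ?X ?A ?B ?f)] => rewrite (adom_tr X A B f) /=
  | |- context [adom (shuf ?s ?t)] => rewrite (@adom_shuf s t); [|pm]
  | |- context [acod (shuf ?s ?t)] => rewrite (@acod_shuf s t); [|pm]
  | |- context [acod (acomp ?g ?f)] => rewrite (@acod_comp _ g f) /=; [|solve [atp]]
  | |- context [acod (atr ?X ?A ?B ?f)] =>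
      rewrite (@acod_tr _ X A B f) /=; [|solve [atp]|solve [atp]]
  end; rewrite ?tw_cat ?tw_cons ?tw_cat ?tw_cons; ob.

(** If [x] comes before [y] in [s], this is [asym_double] together with interchange; the other order
    follows from it by [asymK]. *)
Lemma shuf_swap s x y t : uniq s -> perm_eq s (y :: x :: t) ->
  (asym (F y) (F x) \x aid (tw t)) \c shuf s (y :: x :: t) = shuf s (x :: y :: t).
Proof.
have case1 a b c x' y' : uniq (a ++ x' :: b ++ y' :: c) -> perm_eq (a ++ b ++ c) t ->
    (asym (F y') (F x') \x aid (tw t)) \c shuf (a ++ x' :: b ++ y' :: c) (y' :: x' :: t) =
    shuf (a ++ x' :: b ++ y' :: c) (x' :: y' :: t).
  move=> us pt; have [nx _] := uniq_mid us.
  have [ny _] : y' \notin a ++ x' :: b /\ uniq ((a ++ x' :: b) ++ c).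
    by apply: uniq_mid; rewrite -catA.
  have ny2 : y' \notin a ++ b by move: ny; rewrite !mem_cat inE => /norP[/negbTE-> /norP[_ ->]].
  have -> : shuf (a ++ x' :: b ++ y' :: c) (y' :: x' :: t) =
      (aid (F y') \x ((aid (F x') \x shuf (a ++ b ++ c) t) \c
        (asym (tw a) (F x') \x aid (tw (b ++ c))))) \c (asym (tw (a ++ x' :: b)) (F y') \x aid (tw c)).
    have e z : a ++ x' :: b ++ z = (a ++ x' :: b) ++ z by rewrite -catA.
    by rewrite e shuf_cons // -e shuf_cons.
  have -> : shuf (a ++ x' :: b ++ y' :: c) (x' :: y' :: t) =
      (aid (F x') \x ((aid (F y') \x shuf (a ++ b ++ c) t) \c
        (asym (tw (a ++ b)) (F y') \x aid (tw c)))) \c (asym (tw a) (F x') \x aid (tw (b ++ y' :: c))).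
    by rewrite shuf_cons // [a ++ b ++ y' :: c]catA shuf_cons // -catA.
  rewrite !atens_compr; [|atp..].
  rewrite !atensA !atens_id.
  rewrite -acompA; [|atp..]; rewrite acompA; [|atp..].
  have := atens_splitl (asym (F y') (F x')) (shuf (a ++ b ++ c) t).
  have := atens_splitr (asym (F y') (F x')) (shuf (a ++ b ++ c) t).
  rewrite acod_shuf // adom_shuf // /= => h1 h2.
  rewrite -h2 h1 -!acompA; [|atp..].
  congr acomp.
  have := asym_double (tw a) (F x') (tw b) (F y') (tw c).
  by rewrite ?tw_cat ?tw_cons ?tw_cat ?tensOA ?atensA.
move=> us pt.
have [xs ys] : x \in s /\ y \in s by rewrite !(perm_mem pt) !inE !eqxx orbT.
have nxy : x != y.
  by move: us; rewrite (perm_uniq pt) /= inE eq_sym => /andP[/norP[]].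
have [a [b [es nx]]] := splitx xs; subst s.
move: ys; rewrite mem_cat inE eq_sym (negbTE nxy) /= orbC => /orP[yb|ya].
  have [b1 [b2 [eb ny]]] := splitx yb; subst b; apply: case1 => //; pm.
have [a1 [a2 [ea ny]]] := splitx ya; subst a.
rewrite -catA cat_cons in us pt *.
rewrite -(case1 a1 a2 b y x) //; last by pm.
rewrite acompA; [|atp..]; rewrite -atens_comp; [|atp..].
by rewrite asymK acomp1l // atens_id acomp1l //; atp.
Qed.

(** The label [x] moves leftwards through [t1], one [shuf_swap] at a time. *)
Lemma shuf_front s x t1 t2 : uniq s -> perm_eq s (t1 ++ x :: t2) ->
  (asym (tw t1) (F x) \x aid (tw t2)) \c shuf s (t1 ++ x :: t2) = shuf s (x :: t1 ++ t2).
Proof.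
elim: t1 s => [|y t1 IH] s us pt.
  by rewrite asym1l atens_id acomp1l //; atp.
have [a [b [es ny]]] : exists a b, s = a ++ y :: b /\ y \notin a.
  by apply: splitx; rewrite (perm_mem pt) mem_head.
subst s; have [_ us'] := uniq_mid us; move: (pt); rewrite perm_mid => pt'.
rewrite cat_cons shuf_cons // tw_cons asym_tensl atens_compl; last by atp.
rewrite -acompA; [|atp..].
rewrite (@acompA _ _ (aid (F y) \x asym (tw t1) (F x) \x aid (tw t2))); [|atp..].
rewrite -(atensA (aid (F y))) -atens_compr; last by atp.
rewrite IH // -shuf_cons // -[X in X \c _]atensA atens_id -tw_cat shuf_swap //.
by apply: perm_trans pt _; pm.
Qed.

(** By induction on [u]: its first label is brought to the front of [t] by [shuf_front], after which
    both permutations extract it first. *)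
Lemma shuf_comp s t u : uniq s -> perm_eq s t -> perm_eq t u -> shuf t u \c shuf s t = shuf s u.
Proof.
elim: u s t => [|x u IH] s t us pst ptu.
  have et := perm_nilP ptu; subst t.
  have es := perm_nilP pst; subst s.
  by rewrite shuf_nil acomp1l.
have [t1 [t2 [et nxt]]] : exists a b, t = a ++ x :: b /\ x \notin a.
  by apply: splitx; rewrite (perm_mem ptu) mem_head.
have [s1 [s2 [es nxs]]] : exists a b, s = a ++ x :: b /\ x \notin a.
  by apply: splitx; rewrite (perm_mem pst) (perm_mem ptu) mem_head.
subst s t; have [_ us'] := uniq_mid us; move: (ptu); rewrite perm_mid => ptu'.
have pst' : perm_eq (s1 ++ s2) (t1 ++ t2) by pm.
rewrite [shuf (t1 ++ _) _]shuf_cons // -acompA; [|atp..]; rewrite shuf_front // !shuf_cons //.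
rewrite acompA; [|atp..]; rewrite -atens_compr; last by atp.
by rewrite IH.
Qed.

Lemma shuf_tens s t s' t' : perm_eq s t -> perm_eq s' t' ->
  shuf s t \x shuf s' t' = shuf (s ++ s') (t ++ t').
Proof.
elim: t s => [|x t IH] s pst pst'.
  by have es := perm_nilP pst; subst s; rewrite shuf_nil atens1l.
have [s1 [s2 [es nxs]]] : exists a b, s = a ++ x :: b /\ x \notin a.
  by apply: splitx; rewrite (perm_mem pst) mem_head.
subst s; move: (pst); rewrite perm_mid => pst1.
rewrite -catA !cat_cons !shuf_cons // catA -IH // tw_cat -atens_id !atensA.
rewrite -{1}(acomp1r (f := shuf s' t') (adom_shuf pst')) atens_comp //; atp.
Qed.

Lemma shuf_symm s t : uniq (s ++ t) -> shuf (s ++ t) (t ++ s) = asym (tw s) (tw t).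
Proof.
elim: t => [|x t IH] us; first by rewrite cats0 /= shuf_id asym1r.
have [nx us'] := uniq_mid us.
by rewrite cat_cons shuf_cons // IH // tw_cons asym_tensr.
Qed.
End Perm.

Lemma tw_map (I J : eqType) (F : I -> Ob V) (F' : J -> Ob V) (h : J -> I) s :
  (forall x, F (h x) = F' x) -> tw F (map h s) = tw F' s.
Proof. by move=> e; rewrite /tw -map_comp; congr tensl; apply: eq_map. Qed.

Lemma shuf_map (I J : eqType) (F : I -> Ob V) (F' : J -> Ob V) (h : J -> I) s t :
  (forall x, F (h x) = F' x) -> injective h -> perm_eq s t ->
  shuf F (map h s) (map h t) = shuf F' s t.
Proof.
move=> e hI; elim: t s => [|x t IH] s pst.
  by have es := perm_nilP pst; subst s; rewrite !shuf_nil.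
have [s1 [s2 [es nxs]]] : exists a b, s = a ++ x :: b /\ x \notin a.
  by apply: splitx; rewrite (perm_mem pst) mem_head.
subst s; move: (pst); rewrite perm_mid => pst1.
rewrite map_cat /= -[h x :: map h t]/(h x :: map h t) !shuf_cons ?mem_map //.
by rewrite -map_cat IH // e !(tw_map _ e).
Qed.

(** Superposing is an axiom for a factor on the left. Conjugation with symmetries, taken out of the
    trace by naturality, moves the factor to the right. *)
Lemma atr_superl X A B f g : adom f = A ⊗ X -> acod f = B ⊗ X ->
  atr X A B f \x g = atr X (A ⊗ adom g) (B ⊗ acod g)
    ((aid B \x asym X (acod g)) \c ((f \x g) \c (aid A \x asym (adom g) X))).
Proof.
move=> df cf; set D := adom g; set D' := acod g.
have e1 : (aid B \x asym X D') \c ((f \x g) \c (aid A \x asym D X)) =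
    (asym D' B \x aid X) \c ((g \x f) \c (asym A D \x aid X)).
  have h : (f \x g) \c asym D (A ⊗ X) = asym D' (B ⊗ X) \c (g \x f).
    by have := asym_nat g f; rewrite df cf => ->.
  have e2 : aid A \x asym D X = asym D (A ⊗ X) \c (asym A D \x aid X).
    rewrite asym_tensr -acompA; [|aty..]; rewrite -atens_compl; last by aty.
    by rewrite asymK atens_id acomp1r //; aty.
  have e3 : (aid B \x asym X D') \c asym D' (B ⊗ X) = asym D' B \x aid X.
    rewrite asym_tensr acompA; [|aty..]; rewrite -atens_compr; last by aty.
    by rewrite asymK atens_id acomp1l //; aty.
  rewrite e2 [(f \x g) \c _]acompA; [|aty..]; rewrite h -acompA; [|aty..].
  by rewrite acompA ?e3 //; aty.
rewrite e1.
have := @atr_natr X (A ⊗ D) (D' ⊗ B) ((g \x f) \c (asym A D \x aid X)) (asym D' B).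
rewrite /= => ->; [|aty..].
have := @atr_natl X (D ⊗ A) (D' ⊗ B) (g \x f) (asym A D).
rewrite /= => ->; [|aty..].
rewrite atr_super //; have := asym_nat (atr X A B f) g.
rewrite adom_tr acod_tr // -/D -/D' => <-.
by rewrite acompA ?asymK ?acomp1l //; aty.
Qed.

End PermutationArrows.

Opaque shuf tw.

(** * Networks: traces of permuted boxes *)

Section NetworkCalculus.
Variables (V : sst_data) (HV : is_sst V).
Local Open Scope sst_scope.
Implicit Types (A B D X Y : Ob V) (f g h k : arr V).
Notation "g \c f" := (acomp g f) (at level 50, left associativity).
Notation "f \x g" := (atens f g) (at level 40, left associativity).
Let acompA := @acompA V HV.
Let acomp1l := @acomp1l V HV.
Let acomp1r := @acomp1r V HV.
Let atensA := @atensA V HV.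
Let atens_id := @atens_id V HV.
Let atens_comp := @atens_comp V HV.
Let atr_natl := @atr_natl V HV.
Let atr_natr := @atr_natr V HV.
Let atr_slide := @atr_slide V HV.
Let atr_tens := @atr_tens V HV.
Let atr_super := @atr_super V HV.
Let atr_yank := @atr_yank V HV.
Let asym_nat := @asym_nat V HV.
Let asymK := @asymK V HV.

Let atens_compr := @atens_compr V HV.
Let shuf_id := @shuf_id V HV.
Let shuf_tens := @shuf_tens V HV.
Let shuf_symm := @shuf_symm V HV.
Let atr_superl := @atr_superl V HV.

Section Networks.
Variables (I : eqType) (F : I -> Ob V).
Implicit Types (s t u d c i o a b : seq I) (x y v n : I) (m : arr V).
Notation tw := (tw F).
Notation shuf := (shuf F).

Ltac atp := rewrite /=;
  repeat match goal with
  | |- context [adom (acomp ?g ?f)] => rewrite (adom_comp g f) /=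
  | |- context [adom (atr ?X ?A ?B ?f)] => rewrite (adom_tr X A B f) /=
  | |- context [adom (shuf ?s ?t)] => rewrite (@adom_shuf V _ F s t); [|pm]
  | |- context [acod (shuf ?s ?t)] => rewrite (@acod_shuf V _ F s t); [|pm]
  | |- context [acod (acomp ?g ?f)] => rewrite (@acod_comp _ g f) /=; [|solve [atp]]
  | |- context [acod (atr ?X ?A ?B ?f)] =>
      rewrite (@acod_tr _ X A B f) /=; [|solve [atp]|solve [atp]]
  end; rewrite ?tw_cat ?tw_cons ?tw_cat ?tw_cons; ob;
  rewrite ?tw_cat ?tw_cons; ob.

Let shuf_comp s t u : uniq s -> perm_eq s t -> perm_eq t u ->
  shuf t u \c shuf s t = shuf s u := @shuf_comp V HV _ F s t u.

Lemma id_shuf_r s t u : perm_eq t u -> aid (tw s) \x shuf t u = shuf (s ++ t) (s ++ u).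
Proof. by move=> h; rewrite -shuf_id shuf_tens. Qed.

Lemma id_shuf_l s t u : perm_eq t u -> shuf t u \x aid (tw s) = shuf (t ++ s) (u ++ s).
Proof. by move=> h; rewrite -shuf_id shuf_tens. Qed.

(* The boxes [m : i -> o] are fed back along the wires: each label in [d ++ o]
   is produced once, and each label in [c ++ i] is consumed once. *)
Definition net d c i o m : arr V :=
  atr (tw i) (tw d) (tw c) (shuf (d ++ o) (c ++ i) \c (aid (tw d) \x m)).

Lemma adom_net d c i o m : adom (net d c i o m) = tw d.
Proof. exact: adom_tr. Qed.

Lemma acod_net d c i o m : perm_eq (d ++ o) (c ++ i) -> adom m = tw i -> acod m = tw o ->
  acod (net d c i o m) = tw c.
Proof. by move=> h dm cm; rewrite /net acod_tr //; atp. Qed.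

(** The output permutation merges with the central one; the input permutation is slid round the
    trace and merges there too. *)
Lemma net_slide d c i o i' o' m : uniq (d ++ o) -> perm_eq (d ++ o) (c ++ i) ->
    perm_eq i' i -> perm_eq o o' -> adom m = tw i -> acod m = tw o ->
  net d c i' o' (shuf o o' \c (m \c shuf i' i)) = net d c i o m.
Proof.
move=> us pdc pi po dm cm; rewrite /net.
rewrite atens_compr; last by atp.
rewrite atens_compr; last by atp.
rewrite id_shuf_r // [X in atr _ _ _ X]acompA; [|atp..].
rewrite shuf_comp; [|done|pm|pm].
rewrite [X in atr _ _ _ X]acompA; [|atp..].
rewrite -(@atr_slide (tw i)); [|atp..].
rewrite id_shuf_r // acompA; [|atp..].
by rewrite shuf_comp //; pm.
Qed.

Lemma net_cod d c c' i o m : uniq (d ++ o) -> perm_eq (d ++ o) (c ++ i) ->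
    perm_eq c c' -> adom m = tw i -> acod m = tw o ->
  shuf c c' \c net d c i o m = net d c' i o m.
Proof.
move=> us pdc pc dm cm; rewrite /net -atr_natr; [|atp..].
rewrite acod_shuf // id_shuf_l // acompA; [|atp..].
by rewrite shuf_comp //; pm.
Qed.

(** Here the central permutation is the symmetry of the blocks [d] and [c]; naturality takes [m] out
    of the trace and yanking removes the rest. *)
Lemma net_yank d c m : uniq (d ++ c) -> adom m = tw d -> acod m = tw c -> net d c d c m = m.
Proof.
move=> us dm cm; rewrite /net shuf_symm //.
have := asym_nat (aid (tw d)) m; rewrite /= dm cm => ->.
have := @atr_natr (tw d) (tw d) (tw d) (asym (tw d) (tw d)) m; rewrite cm => -> //.
by rewrite atr_yank acomp1r.
Qed.

(** Both traces are taken out of the tensor product by superposing, one on each side, and merged by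
    vanishing. *)
Lemma net_tens d1 c1 i1 o1 m1 d2 c2 i2 o2 m2 :
    uniq (d1 ++ d2 ++ o1 ++ o2) -> perm_eq (d1 ++ o1) (c1 ++ i1) ->
    perm_eq (d2 ++ o2) (c2 ++ i2) ->
    adom m1 = tw i1 -> acod m1 = tw o1 -> adom m2 = tw i2 -> acod m2 = tw o2 ->
  net d1 c1 i1 o1 m1 \x net d2 c2 i2 o2 m2 =
  net (d1 ++ d2) (c1 ++ c2) (i1 ++ i2) (o1 ++ o2) (m1 \x m2).
Proof.
move=> us p1 p2 dm1 cm1 dm2 cm2.
have us' : uniq ((d1 ++ d2) ++ o1 ++ o2) by rewrite -catA.
have uo : uniq (o1 ++ o2) by move: us; rewrite !catA -catA cat_uniq => /and3P[].
have ui : uniq (i2 ++ i1).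
  have h : perm_eq (d1 ++ d2 ++ o1 ++ o2) ((c1 ++ c2) ++ (i2 ++ i1)) by pm.
  by move: us; rewrite (perm_uniq h) cat_uniq => /and3P[].
(* Superposing puts the trace over [i1] inside the trace over [i2], so the traced word is
   [i2 ++ i1]; the right-hand side is reordered to match. *)
rewrite -(@net_slide (d1 ++ d2) _ (i1 ++ i2) (o1 ++ o2) (i2 ++ i1) (o2 ++ o1)) //; [|pm|pm|pm|atp|atp].
rewrite !shuf_symm //.
have := asym_nat m2 m1; rewrite dm1 dm2 cm1 cm2 => <-.
rewrite acompA; [|atp..]; rewrite asymK acomp1l; last by atp.
rewrite {2}/net; set f2 := (X in atr (tw i2) _ _ X).
have [e1 e2] : adom f2 = tw (d2 ++ i2) /\ acod f2 = tw (c2 ++ i2) by split; rewrite /f2; atp.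
rewrite -atr_super ?e1 ?e2 ?tw_cat // adom_net acod_net //.
rewrite {1}/net atr_superl ?e1 ?e2; [|atp..].
rewrite !tw_cat !tensOA -atr_tens; [|atp..].
rewrite [in RHS]/net !tw_cat; congr atr.
have e3 : ((aid (tw d1) \x m1) \x (aid (tw d2) \x m2)) \c (aid (tw d1) \x asym (tw (d2 ++ i2)) (tw i1)) =
    (aid (tw d1) \x asym (tw (d2 ++ o2)) (tw o1)) \c (aid (tw d1) \x ((aid (tw d2) \x m2) \x m1)).
  rewrite -atensA -!atens_compr; [|atp..].
  have := asym_nat (aid (tw d2) \x m2) m1; rewrite dm1 cm1 /= dm2 cm2 !tw_cat => ->.
  by [].
have u1 : uniq ((d2 ++ o2) ++ o1).
  have h : perm_eq (d1 ++ d2 ++ o1 ++ o2) (d1 ++ ((d2 ++ o2) ++ o1)) by pm.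
  by move: us; rewrite (perm_uniq h) cat_uniq => /and3P[].
have u2 : uniq (i1 ++ c2 ++ i2).
  have h : perm_eq (d1 ++ d2 ++ o1 ++ o2) (c1 ++ (i1 ++ c2 ++ i2)) by pm.
  by move: us; rewrite (perm_uniq h) cat_uniq => /and3P[].
rewrite -!tw_cat -shuf_symm // /f2 atens_comp; [|atp..].
rewrite -[X in _ \c X]acompA; [|atp..].
rewrite e3 -shuf_symm // !id_shuf_r; [|pm..].
rewrite shuf_tens // [X in _ \c X]acompA; [|atp..].
rewrite -!catA.
rewrite shuf_comp; [|by rewrite (perm_uniq (s2 := d1 ++ d2 ++ o1 ++ o2)) //; pm|pm|pm].
rewrite acompA; [|atp..].
rewrite shuf_comp; [|by rewrite (perm_uniq (s2 := d1 ++ d2 ++ o1 ++ o2)) //; pm|pm|pm].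
by rewrite tw_cat -atens_id !atensA !catA.
Qed.

(** The traced words [x] and [y] have different labels but equal objects. The new loop is an
    identity box that consumes [y] and produces [x], so every label is still produced and consumed
    once. *)
Lemma net_tr a b (x y : seq I) i o m : uniq (a ++ x ++ o) -> perm_eq (a ++ x ++ o) (b ++ y ++ i) ->
    adom m = tw i -> acod m = tw o -> tw x = tw y ->
  atr (tw x) (tw a) (tw b) (net (a ++ x) (b ++ y) i o m) =
  net a b (i ++ y) (o ++ x) (m \x aid (tw y)).
Proof.
move=> us p dm cm exy.
have ux : uniq (x ++ o) by move: us; rewrite cat_uniq => /and3P[].
have uy : uniq (i ++ y).
  have h : perm_eq (a ++ x ++ o) (b ++ (i ++ y)) by pm.
  by move: us; rewrite (perm_uniq h) cat_uniq => /and3P[].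
have p' : perm_eq ((a ++ x) ++ o) ((b ++ y) ++ i) by rewrite -!catA.
have hs : adom (shuf ((a ++ x) ++ o) ((b ++ y) ++ i)) = tw a ⊗ tw y ⊗ tw o.
  by rewrite adom_shuf // !tw_cat exy.
rewrite /net !tw_cat exy -atr_tens; last 2 first.
- by rewrite adom_comp /= dm.
- by rewrite acod_comp ?acod_shuf ?hs /= ?cm // !tw_cat.
(* Vanishing yields the traced word [y ++ i], while the right-hand side has [i ++ y]; sliding [k]
   exchanges the blocks. *)
pose k := asym (tw i) (tw y).
pose f := shuf (a ++ o ++ x) (b ++ i ++ y) \c (aid (tw a) \x ((m \x aid (tw y)) \c asym (tw y) (tw i))).
have df : adom f = tw a ⊗ (tw y ⊗ tw i) by rewrite /f; atp.
have e0 : acod ((m \x aid (tw y)) \c asym (tw y) (tw i)) = tw (o ++ x) by atp; rewrite exy.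
have px : perm_eq (a ++ o ++ x) (b ++ i ++ y) by pm.
have hs2 : adom (shuf (a ++ o ++ x) (b ++ i ++ y)) = tw a ⊗ tw (o ++ x).
  by rewrite adom_shuf // tw_cat.
have hs3 : acod (shuf (a ++ o ++ x) (b ++ i ++ y)) = tw b ⊗ tw (i ++ y).
  by rewrite acod_shuf // tw_cat.
have cf : acod f = tw b ⊗ (tw i ⊗ tw y).
  by rewrite /f (@acod_comp _ (shuf _ _)) ?hs3 ?tw_cat // acod_tens e0 hs2.
have e1 : shuf ((a ++ x) ++ o) ((b ++ y) ++ i) \c (aid (tw a ⊗ tw y) \x m) = (aid (tw b) \x k) \c f.
  have pk : acod f = adom (aid (tw b) \x k) by rewrite cf.
  rewrite /k -shuf_symm // id_shuf_r; last by pm.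
  rewrite /f acompA; [|by rewrite acod_tens e0 hs2|by rewrite adom_shuf ?acod_shuf //; pm].
  rewrite shuf_comp; [|by rewrite (perm_uniq (s2 := a ++ x ++ o)) //; pm|pm|pm].
  have := asym_nat (aid (tw y)) m; rewrite /= dm cm => <-.
  rewrite -{2}exy -shuf_symm // atens_compr; last by rewrite adom_shuf ?tw_cat ?exy /= ?cm //; pm.
  rewrite id_shuf_r; last by pm.
  rewrite acompA; last 2 first.
  - by rewrite acod_tens adom_shuf ?tw_cat ?exy /= ?cm //; pm.
  - by rewrite acod_shuf ?adom_shuf //; pm.
  rewrite shuf_comp; [|done|pm|pm].
  by rewrite atensA atens_id !catA.
rewrite e1 (atr_slide df cf (k := k)) //; congr atr; rewrite /f /k -acompA; last 2 first.
- by rewrite acod_tens adom_tens adom_comp.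
- by rewrite acod_tens e0 hs2.
rewrite -atens_compr; last by atp.
by rewrite -acompA ?asymK ?acomp1r //; atp.
Qed.

(** The label [v] leaves by the traced factor and comes back as [n] in the place of [v]. Once
    [shuf s t] and [t1] are taken out by naturality and superposing, yanking applies to what
    remains. *)
Lemma net_split_trace s t t1 t2 v n : uniq s -> perm_eq s t -> t = t1 ++ v :: t2 ->
    n \notin s -> F v = F n ->
  atr (F v) (tw s) (tw t) (shuf (s ++ [:: n]) (t1 ++ n :: t2 ++ [:: v])) = shuf s t.
Proof.
move=> us pst et ns evn; subst t.
have ut : uniq (t1 ++ v :: t2) by rewrite -(perm_uniq pst).
have nt : n \notin t1 ++ v :: t2 by rewrite -(perm_mem pst).
have utn : uniq ((t1 ++ v :: t2) ++ [:: n]) by rewrite cat_uniq ut /= orbF nt.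
have usn : uniq (s ++ [:: n]) by rewrite cat_uniq us /= orbF ns.
have F1 z : tw [:: z] = F z by rewrite tw_cons tensO1.
have [nt1 [nt2 nv]] : n \notin t1 /\ n \notin t2 /\ v != n.
  by move: nt; rewrite mem_cat inE !negb_or eq_sym => /and3P[].
have [vt1 ut12] := uniq_mid ut.
have [vt2 ut2] : v \notin t2 /\ uniq t2 by move: ut; rewrite cat_uniq /= => /and3P[_ _ /andP[]].
have fn : tw [:: n] = F v by rewrite F1 evn.
rewrite -(@shuf_comp _ ((t1 ++ v :: t2) ++ [:: n])) //; [|by rewrite perm_cat2r|pm].
rewrite -[shuf (s ++ _) _]id_shuf_l // fn.
have pn : perm_eq ((t1 ++ v :: t2) ++ [:: n]) (t1 ++ n :: t2 ++ [:: v]) by pm.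
have := @atr_natl (F v) (tw (t1 ++ v :: t2)) (tw (t1 ++ v :: t2))
  (shuf ((t1 ++ v :: t2) ++ [:: n]) (t1 ++ n :: t2 ++ [:: v])) (shuf s (t1 ++ v :: t2)).
rewrite !adom_shuf // !acod_shuf // => ->; last 3 first.
- by rewrite tw_cat fn.
- by rewrite !tw_cat !tw_cons !tw_cat F1 -evn; ob.
- by [].
suff -> : atr (F v) (tw (t1 ++ v :: t2)) (tw (t1 ++ v :: t2))
    (shuf ((t1 ++ v :: t2) ++ [:: n]) (t1 ++ n :: t2 ++ [:: v])) = aid (tw (t1 ++ v :: t2)).
  by rewrite acomp1l // acod_shuf.
have p2 : perm_eq (v :: t2 ++ [:: n]) (n :: t2 ++ [:: v]) by pm.
rewrite -catA cat_cons -id_shuf_r // tw_cat tw_cons.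
have d2 : adom (shuf (v :: t2 ++ [:: n]) (n :: t2 ++ [:: v])) = F v ⊗ tw t2 ⊗ F v.
  by rewrite adom_shuf // tw_cons tw_cat fn; ob.
have c2 : acod (shuf (v :: t2 ++ [:: n]) (n :: t2 ++ [:: v])) = F v ⊗ tw t2 ⊗ F v.
  by rewrite acod_shuf // tw_cons tw_cat F1 -evn; ob.
have := atr_super (aid (tw t1)) d2 c2; rewrite /= => ->; rewrite -atens_id; congr atens.
(* Move [v] past [t2], exchange it with [n], and move [n] back: the exchange is the symmetry to be
   yanked. *)
have e : shuf (v :: t2 ++ [:: n]) (n :: t2 ++ [:: v]) =
    (shuf (t2 ++ [:: n]) (n :: t2) \x aid (F v)) \c
    ((aid (tw t2) \x asym (F v) (F v)) \c (shuf (v :: t2) (t2 ++ [:: v]) \x aid (F v))).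
  have u1 : uniq (v :: t2 ++ [:: n]).
    by rewrite /= mem_cat negb_or vt2 inE nv cat_uniq ut2 /= orbF nt2.
  have u2 : uniq ([:: v] ++ [:: n]) by rewrite /= inE nv.
  have a1 : shuf (t2 ++ [:: n]) (n :: t2) \x aid (F v) = shuf ((t2 ++ [:: n]) ++ [:: v]) ((n :: t2) ++ [:: v]).
    by rewrite -(F1 v) id_shuf_l //; pm.
  have a2 : aid (tw t2) \x asym (F v) (F v) = shuf (t2 ++ [:: v] ++ [:: n]) (t2 ++ [:: n] ++ [:: v]).
    by rewrite -id_shuf_r ?shuf_symm ?fn ?F1 //; pm.
  have a3 : shuf (v :: t2) (t2 ++ [:: v]) \x aid (F v) = shuf ((v :: t2) ++ [:: n]) ((t2 ++ [:: v]) ++ [:: n]).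
    by rewrite -fn id_shuf_l //; pm.
  rewrite a1 a2 a3 -!catA shuf_comp; [|done|pm|pm].
  by rewrite shuf_comp //; pm.
have [q1 q2] : perm_eq (t2 ++ [:: n]) (n :: t2) /\ perm_eq (v :: t2) (t2 ++ [:: v]) by split; pm.
have [b1 b2] : adom (shuf (t2 ++ [:: n]) (n :: t2)) = tw t2 ⊗ F v /\
    acod (shuf (t2 ++ [:: n]) (n :: t2)) = F v ⊗ tw t2.
  by rewrite adom_shuf // acod_shuf // tw_cat fn tw_cons evn.
have [b3 b4] : adom (shuf (v :: t2) (t2 ++ [:: v])) = F v ⊗ tw t2 /\
    acod (shuf (v :: t2) (t2 ++ [:: v])) = tw t2 ⊗ F v.
  by rewrite adom_shuf // acod_shuf // tw_cat F1 tw_cons.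
set q := shuf (t2 ++ [:: n]) (n :: t2) in b1 b2 e *.
set p := shuf (v :: t2) (t2 ++ [:: v]) in b3 b4 e *.
pose w := aid (tw t2) \x asym (F v) (F v).
have [d3 c3] : adom (w \c (p \x aid (F v))) = F v ⊗ tw t2 ⊗ F v /\
    acod (w \c (p \x aid (F v))) = tw t2 ⊗ F v ⊗ F v.
  have h : acod (p \x aid (F v)) = adom w by rewrite /= b4 tensOA.
  by rewrite adom_comp acod_comp // /= b3 tensOA.
have := atr_natr d3 c3 b1; rewrite b2 -e => ->.
have := @atr_natl (F v) (tw t2 ⊗ F v) (tw t2 ⊗ F v) w p; rewrite b3 => -> //; last 2 first.
- by rewrite /= tensOA.
- by rewrite /= tensOA.
have := atr_super (aid (tw t2)) (erefl : adom (asym (F v) (F v)) = _) erefl.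
rewrite /= -/w => ->; rewrite atr_yank atens_id acomp1l ?b4 // /q /p.
have -> : shuf (t2 ++ [:: n]) (n :: t2) = asym (tw t2) (F v).
  by rewrite -fn -shuf_symm // cat_uniq ut2 /= orbF nt2.
have -> : shuf (v :: t2) (t2 ++ [:: v]) = asym (F v) (tw t2).
  by rewrite -(F1 v) -shuf_symm //= vt2.
by rewrite asymK.
Qed.

(** The consumer of [v] now consumes [n], and a new identity box consumes [v] and produces [n].
    Vanishing isolates the trace over the new factor, which is [net_split_trace]. *)
Lemma net_split d c i o t1 t2 v n m c' i' : uniq (d ++ o) -> perm_eq (d ++ o) (c ++ i) ->
    c ++ i = t1 ++ v :: t2 -> c' ++ i' = t1 ++ n :: t2 -> size c' = size c ->
    n \notin d ++ o -> F v = F n -> adom m = tw i -> acod m = tw o ->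
  net d c' (i' ++ [:: v]) (o ++ [:: n]) (m \x aid (F v)) = net d c i o m.
Proof.
move=> us p e e' sc nn evn dm cm.
(* The words differ in one label with the same object, so the endpoints of [m] are unaffected. *)
have [tc ti] : tw c' = tw c /\ tw i' = tw i.
  have h : [seq F z | z <- c'] ++ [seq F z | z <- i'] = [seq F z | z <- c] ++ [seq F z | z <- i].
    by rewrite -!map_cat e e' !map_cat /= evn.
  have h1 : [seq F z | z <- c'] = [seq F z | z <- c].
    by have := congr1 (take (size c)) h; rewrite -{1}sc !take_size_cat ?size_map.
  have h2 : [seq F z | z <- i'] = [seq F z | z <- i].
    by have := congr1 (drop (size c)) h; rewrite -{1}sc !drop_size_cat ?size_map.
  by rewrite !twE h1 h2.
have F1 z : tw [:: z] = F z by rewrite tw_cons tensO1.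
have n' : n \notin t1 ++ v :: t2 by rewrite -e -(perm_mem p).
have p' : perm_eq ((d ++ o) ++ [:: n]) (c' ++ (i' ++ [:: v])).
  move: p; rewrite e => p; rewrite (catA c') e'; pm.
rewrite /net !tw_cat F1 evn tc ti.
have hs : acod (shuf (d ++ o ++ [:: n]) (c' ++ i' ++ [:: v])) = tw c ⊗ tw i ⊗ F n.
  by rewrite catA acod_shuf // !tw_cat F1 tc ti tensOA evn.
have hd : adom (shuf (d ++ o ++ [:: n]) (c' ++ i' ++ [:: v])) = tw d ⊗ tw o ⊗ F n.
  by rewrite catA adom_shuf // !tw_cat F1.
have hc : acod (aid (tw d) \x (m \x aid (F n))) = adom (shuf (d ++ o ++ [:: n]) (c' ++ i' ++ [:: v])).
  by rewrite hd /= cm tensOA.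
rewrite atr_tens; last 2 first.
- by rewrite adom_comp /= dm tensOA.
- by rewrite acod_comp.
congr atr; rewrite atensA.
have := @atr_natl (F n) (tw d ⊗ tw o) (tw c ⊗ tw i) (shuf (d ++ o ++ [:: n]) (c' ++ i' ++ [:: v])) (aid (tw d) \x m).
rewrite /= dm => ->; [|exact hd|exact hs|by rewrite cm].
congr (_ \c _).
have := @net_split_trace (d ++ o) (c ++ i) t1 t2 v n us p e nn evn.
by rewrite evn !tw_cat -!catA (catA c') e' -catA => ->.
Qed.
End Networks.

End NetworkCalculus.

(** * Tensor products of lists of boxes *)

Section BoxLists.
Variables (V : sst_data) (HV : is_sst V).
Local Open Scope sst_scope.
Implicit Types (A B D X Y : Ob V) (f g h k : arr V).
Notation "g \c f" := (acomp g f) (at level 50, left associativity).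
Notation "f \x g" := (atens f g) (at level 40, left associativity).
Let acompA := @acompA V HV.
Let acomp1l := @acomp1l V HV.
Let acomp1r := @acomp1r V HV.
Let atensA := @atensA V HV.
Let atens1l := @atens1l V HV.
Let atens_comp := @atens_comp V HV.
Let asym_nat := @asym_nat V HV.

Let shuf_id := @shuf_id V HV.
Let shuf_symm := @shuf_symm V HV.

Let id_shuf_l := @id_shuf_l V HV.
Let id_shuf_r := @id_shuf_r V HV.
Let net_slide := @net_slide V HV.

Section Boxes.
Variable J : eqType.
Implicit Types js : seq J.

Section Networks.
Variables (I : eqType) (F : I -> Ob V).
Implicit Types (s t u d c i o a b : seq I) (x y v n : I) (m : arr V).
Notation tw := (tw F).
Notation shuf := (shuf F).

Ltac atp := rewrite /=;
  repeat match goal with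
  | |- context [adom (acomp ?g ?f)] => rewrite (adom_comp g f) /=
  | |- context [adom (atr ?X ?A ?B ?f)] => rewrite (adom_tr X A B f) /=
  | |- context [adom (shuf ?s ?t)] => rewrite (@adom_shuf V _ F s t); [|pm]
  | |- context [acod (shuf ?s ?t)] => rewrite (@acod_shuf V _ F s t); [|pm]
  | |- context [acod (acomp ?g ?f)] => rewrite (@acod_comp _ g f) /=; [|solve [atp]]
  | |- context [acod (atr ?X ?A ?B ?f)] =>
      rewrite (@acod_tr _ X A B f) /=; [|solve [atp]|solve [atp]]
  end; rewrite ?tw_cat ?tw_cons ?tw_cat ?tw_cons; ob;
  rewrite ?tw_cat ?tw_cons; ob.

Let shuf_comp s t u : uniq s -> perm_eq s t -> perm_eq t u ->
  shuf t u \c shuf s t = shuf s u := @shuf_comp V HV _ F s t u.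

Section Bigt.
Variables (p q : J -> seq I) (bx : J -> arr V).
Definition ins (f : J -> seq I) js := flatten (map f js).
Definition bigt js : arr V := foldr (fun j (r : arr V) => bx j \x r) (aid unitO) js.

Lemma bigt_cat js js' : bigt (js ++ js') = bigt js \x bigt js'.
Proof. by elim: js => [|j js IH] /=; rewrite ?atens1l // IH atensA. Qed.

Lemma ins_cat (f : J -> seq I) js js' : ins f (js ++ js') = ins f js ++ ins f js'.
Proof. by rewrite /ins map_cat flatten_cat. Qed.

Lemma ins_cons (f : J -> seq I) j js : ins f (j :: js) = f j ++ ins f js.
Proof. by []. Qed.

Lemma perm_ins (f : J -> seq I) js js' : perm_eq js js' -> perm_eq (ins f js) (ins f js').
Proof. by move=> h; apply: perm_flatten; apply: perm_map. Qed.

Lemma adom_bigt js : (forall j, j \in js -> adom (bx j) = tw (p j)) -> adom (bigt js) = tw (ins p js).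
Proof.
elim: js => [|j js IH] h //=; rewrite ins_cons tw_cat h ?mem_head // IH // => j' hj.
by rewrite h // inE hj orbT.
Qed.

Lemma acod_bigt js : (forall j, j \in js -> acod (bx j) = tw (q j)) -> acod (bigt js) = tw (ins q js).
Proof.
elim: js => [|j js IH] h //=; rewrite ins_cons tw_cat h ?mem_head // IH // => j' hj.
by rewrite h // inE hj orbT.
Qed.

(** Naturality of permuting whole boxes: the first box of [js'] is moved to the front past [bigt s1]
    by [asym_nat], and the rest is the induction hypothesis. *)
Lemma bigt_perm js js' : perm_eq js js' -> uniq (ins p js) -> uniq (ins q js) ->
    (forall j, j \in js -> adom (bx j) = tw (p j) /\ acod (bx j) = tw (q j)) ->
  bigt js' \c shuf (ins p js) (ins p js') = shuf (ins q js) (ins q js') \c bigt js.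
Proof.
elim: js' js => [|j js' IH] js pj up uq h.
  by rewrite (perm_nilP pj) /= !shuf_id.
have [s1 [s2 [e nx]]] : exists s1 s2 : seq J, js = s1 ++ j :: s2 /\ j \notin s1.
  by apply: splitx; rewrite (perm_mem pj) mem_head.
have pj' : perm_eq (s1 ++ s2) js' by rewrite -(perm_mid j) -e.
have dj (k : J) : k \in js -> adom (bx k) = tw (p k) by case/h.
have cj (k : J) : k \in js -> acod (bx k) = tw (q k) by case/h.
have m1 (k : J) : k \in s1 -> k \in js by rewrite e mem_cat => ->.
have m2 (k : J) : k \in s2 -> k \in js by rewrite e mem_cat inE => ->; rewrite !orbT.
have mj : j \in js by rewrite e mem_cat mem_head orbT.
have d1 : adom (bigt s1) = tw (ins p s1) by apply: adom_bigt => k /m1/dj.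
have d2 : adom (bigt s2) = tw (ins p s2) by apply: adom_bigt => k /m2/dj.
have c1 : acod (bigt s1) = tw (ins q s1) by apply: acod_bigt => k /m1/cj.
have c2 : acod (bigt s2) = tw (ins q s2) by apply: acod_bigt => k /m2/cj.
have m' (k : J) : k \in js' -> k \in js by rewrite (perm_mem pj) inE => ->; rewrite orbT.
have d' : adom (bigt js') = tw (ins p js') by apply: adom_bigt => k /m'/dj.
have c' : acod (bigt js') = tw (ins q js') by apply: acod_bigt => k /m'/cj.
have [dx cx] := h j mj.
have pp := perm_ins p pj'; have pq := perm_ins q pj'.
rewrite e !ins_cat !ins_cons bigt_cat /= in up uq *.
have up' : uniq (ins p s1 ++ ins p s2).
  have hh : perm_eq (ins p s1 ++ p j ++ ins p s2) (p j ++ (ins p s1 ++ ins p s2)) by pm.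
  by move: up; rewrite (perm_uniq hh) cat_uniq => /and3P[].
have uq' : uniq (ins q s1 ++ ins q s2).
  have hh : perm_eq (ins q s1 ++ q j ++ ins q s2) (q j ++ (ins q s1 ++ ins q s2)) by pm.
  by move: uq; rewrite (perm_uniq hh) cat_uniq => /and3P[].
have upj : uniq (ins p s1 ++ p j) by move: up; rewrite catA cat_uniq => /and3P[].
have uqj : uniq (ins q s1 ++ q j) by move: uq; rewrite catA cat_uniq => /and3P[].
have := IH (s1 ++ s2) pj'; rewrite !ins_cat bigt_cat => IH'.
rewrite !ins_cat in pp pq; clear pj pj'.
rewrite -(@shuf_comp (ins p s1 ++ p j ++ ins p s2) (p j ++ ins p s1 ++ ins p s2) (p j ++ ins p js')) //; [|pm|pm].
rewrite -(@shuf_comp (ins q s1 ++ q j ++ ins q s2) (q j ++ ins q s1 ++ ins q s2) (q j ++ ins q js')) //; [|pm|pm].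
rewrite -!id_shuf_r //.
have -> : shuf (ins p s1 ++ p j ++ ins p s2) (p j ++ ins p s1 ++ ins p s2) =
    asym (tw (ins p s1)) (tw (p j)) \x aid (tw (ins p s2)).
  by rewrite -shuf_symm // id_shuf_l -?catA // perm_catC.
have -> : shuf (ins q s1 ++ q j ++ ins q s2) (q j ++ ins q s1 ++ ins q s2) =
    asym (tw (ins q s1)) (tw (q j)) \x aid (tw (ins q s2)).
  by rewrite -shuf_symm // id_shuf_l -?catA // perm_catC.
set sp := shuf _ _ in IH' *; set sq := shuf _ _ in IH' *.
have [dsp csp] : adom sp = tw (ins p s1) ⊗ tw (ins p s2) /\ acod sp = tw (ins p js').
  by rewrite /sp adom_shuf // acod_shuf // tw_cat.
have [dsq csq] : adom sq = tw (ins q s1) ⊗ tw (ins q s2) /\ acod sq = tw (ins q js').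
  by rewrite /sq adom_shuf // acod_shuf // tw_cat.
rewrite acompA; [|by rewrite /= dsp; ob|by rewrite /= dx csp d'].
rewrite -atens_comp; [|by rewrite dx|by rewrite csp d'].
rewrite IH' //; last first.
  by move=> k; rewrite mem_cat => /orP[/m1/h|/m2/h].
rewrite -[RHS]acompA; [|by rewrite /= c1 c2 cx; ob|by rewrite /= dsq; ob].
have -> : bigt s1 \x (bx j \x bigt s2) = (bigt s1 \x bx j) \x bigt s2 by rewrite atensA.
rewrite -[in RHS]atens_comp; [|by rewrite /= c1 cx|by rewrite c2].
have := asym_nat (bigt s1) (bx j); rewrite d1 c1 dx cx => ->.
rewrite acomp1r // acomp1l //.
have -> : bigt s2 = bigt s2 \c aid (tw (ins p s2)) by rewrite acomp1r.
rewrite [in RHS]atens_comp; [|by rewrite /= d1 dx|by rewrite d2].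
rewrite acomp1r // -(atensA (bx j)) [RHS]acompA; last 2 first.
- by rewrite /= dx d1 d2; ob.
- by rewrite /= cx c1 c2 dsq.
rewrite -(atens_comp (f := bx j) (g := aid (tw (q j)))) ?acomp1l //; last by rewrite /= c1 c2 dsq.
Qed.

(** [bigt_perm] trades the order of the boxes for permutations of their ports, which [net_slide]
    absorbs. *)
Lemma net_perm d c js js' : perm_eq js js' -> uniq (d ++ ins q js) ->
    perm_eq (d ++ ins q js) (c ++ ins p js) ->
    (forall j, j \in js -> adom (bx j) = tw (p j) /\ acod (bx j) = tw (q j)) ->
  net F d c (ins p js') (ins q js') (bigt js') = net F d c (ins p js) (ins q js) (bigt js).
Proof.
move=> pj us pdc h.
have uq : uniq (ins q js) by move: us; rewrite cat_uniq => /and3P[].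
have up : uniq (ins p js) by move: us; rewrite (perm_uniq pdc) cat_uniq => /and3P[].
have [d1 c1] : adom (bigt js) = tw (ins p js) /\ acod (bigt js) = tw (ins q js).
  by split; [apply: adom_bigt|apply: acod_bigt] => k /h[].
have d' : adom (bigt js') = tw (ins p js') by apply: adom_bigt => k; rewrite -(perm_mem pj) => /h[].
have [pp pq] := (perm_ins p pj, perm_ins q pj).
rewrite -[RHS](@net_slide _ F d c (ins p js) (ins q js) (ins p js') (ins q js')) //; last by rewrite perm_sym.
have uq' : uniq (ins p js') by rewrite -(perm_uniq pp).
congr net; rewrite acompA; [|by rewrite acod_shuf // perm_sym|by rewrite c1 adom_shuf].
rewrite -bigt_perm // -acompA; last 2 first.
- by rewrite acod_shuf // ?adom_shuf // perm_sym.
- by rewrite acod_shuf.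
by rewrite shuf_comp ?shuf_id ?acomp1r // perm_sym.
Qed.

Lemma ins_in (f : J -> seq I) js x : reflect (exists2 j, j \in js & x \in f j) (x \in ins f js).
Proof. exact: flatten_mapP. Qed.

End Bigt.
End Networks.
End Boxes.

Lemma net_map (I I' : eqType) (F : I -> Ob V) (F' : I' -> Ob V) (h : I' -> I) d c i o m :
    (forall x, F (h x) = F' x) -> injective h -> perm_eq (d ++ o) (c ++ i) ->
  net F (map h d) (map h c) (map h i) (map h o) m = net F' d c i o m.
Proof.
move=> e hi p; rewrite /net -!map_cat !(@tw_map V _ _ F F' h) //.
by rewrite (@shuf_map V _ _ F F' h).
Qed.

End BoxLists.

Opaque net.

(** * The value of a string graph *)

Section Ins.
Variables (J K : eqType) (I : eqType).

Lemma uniq_ins (f : J -> seq I) js : uniq js -> (forall j, j \in js -> uniq (f j)) ->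
    (forall j j' x, j \in js -> j' \in js -> x \in f j -> x \in f j' -> j = j') ->
  uniq (ins f js).
Proof.
elim: js => [|j js IH] //= /andP[nj us] h1 h2; rewrite ins_cons cat_uniq h1 ?mem_head //=.
rewrite IH ?andbT //; last 2 first.
- by move=> k hk; apply: h1; rewrite inE hk orbT.
- by move=> k k' x hk hk'; apply: h2; rewrite inE ?hk ?hk' orbT.
apply/hasPn => x /ins_in[k hk xk]; apply/negP => xj.
by case/negP: nj; rewrite (h2 j k x) ?mem_head // inE hk orbT.
Qed.

Lemma ins_map (I' : eqType) (f : J -> seq I) (g : K -> seq I') (hj : J -> K) (hv : I -> I') js :
  (forall j, j \in js -> g (hj j) = map hv (f j)) -> ins g (map hj js) = map hv (ins f js).
Proof.
elim: js => [|j js IH] h //=; rewrite !ins_cons map_cat h ?mem_head // IH // => k hk.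
by rewrite h // inE hk orbT.
Qed.

Lemma bigt_map V (b : J -> arr V) (b' : K -> arr V) (hj : J -> K) js :
  (forall j, j \in js -> b' (hj j) = b j) -> bigt b' (map hj js) = bigt b js.
Proof.
elim: js => [|j js IH] h //=; rewrite h ?mem_head // IH // => k hk.
by rewrite h // inE hk orbT.
Qed.
End Ins.

Section Interp.
Variables (T : signature).
Implicit Types (G H : cospan T) (s : bool) (f : smor T) (t : type_edge T).

(* With [s = true] the ports are outputs of a box, with [s = false] inputs; the
   near end of an edge at such a port is its wire-vertex. *)
Definition near s G (e : cedge G) := if s then ctgt e else csrc e.
Definition far s G (e : cedge G) := if s then csrc e else ctgt e.
Definition sort s f := if s then scod f else sdom f.
Definition port s f : 'I_(size (sort s f)) -> type_edge T :=
  match s return 'I_(size (sort s f)) -> type_edge T with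
  | true => @out_edge T f
  | false => @in_edge T f
  end.
Definition nearT s t := if s then tgt (g := typegraph T) t else src (g := typegraph T) t.
Definition farT s t := if s then src (g := typegraph T) t else tgt (g := typegraph T) t.
Definition is_mid t := if t is mid_edge _ then true else false.
(** Edge types carry no decidable equality; comparing positions is enough to tell the ports on one
    side of a box apart. *)
Definition slot t : nat := match t with mid_edge _ => 0 | in_edge _ i => i | out_edge _ i => i end.

Definition node G : eqType := (cedge G + cvert G)%type.
Definition is_node G (j : node G) :=
  match j with inl e => is_mid (etype e) | inr v => ~~ is_wire v end.

Definition ports s G (v : cvert G) (es : seq (cedge G)) : Prop :=
  forall f, vtype v = inr f -> (forall e, e \in es -> far s e = v) /\
    [seq etype e | e <- es] = [seq port i | i <- enum 'I_(size (sort s f))].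

(** [ports] constrains box-vertices only. In a string graph it has exactly one solution there, by
    [ports_ex] and [ports_fun], so [epsilon] makes no real choice. *)
Definition box_ports s G (v : cvert G) : seq (cedge G) := epsilon (inhabits [::]) (ports s v).

Definition node_edges s G (j : node G) : seq (cedge G) :=
  match j with inl e => [:: e] | inr v => box_ports s v end.

Definition node_ports s G (j : node G) : seq (cvert G) := [seq near s e | e <- node_edges s j].

(** By [mem_node_edges], the nodes partition the edges whose near end is a wire-vertex; this is the
    part to which an edge belongs. *)
Definition owner s G (e : cedge G) : node G :=
  if is_mid (etype e) then inl e else inr (far s e).

Definition nodes G : seq (node G) := [seq j <- map inl (enum (cedge G)) ++ map inr (enum (cvert G)) | is_node j].

Lemma nodes_uniq G : uniq (nodes G).
Proof. by rewrite filter_uniq // uniq_inlr !enum_uniq. Qed.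

Lemma mem_nodes G (j : node G) : (j \in nodes G) = is_node j.
Proof.
rewrite mem_filter mem_cat; case: (is_node j) => //=; case: j => x.
  by rewrite mem_inl mem_enum.
by rewrite mem_inr mem_enum orbT.
Qed.

Section StringGraph.
Variables (G : cospan T) (sG : string_graph G).
Implicit Types (e : cedge G) (v x : cvert G) (j : node G).

Lemma near_type s e : vtype (near s e) = nearT s (etype e).
Proof. by case: s; rewrite /near /nearT; case: (sg_typed sG e). Qed.
Lemma far_type s e : vtype (far s e) = farT s (etype e).
Proof. by case: s; rewrite /far /farT; case: (sg_typed sG e). Qed.

Lemma port_near s f i : nearT s (port i) = inl (tnth (in_tuple (sort s f)) i).
Proof. by case: s i. Qed.
Lemma port_far s f (i : 'I_(size (sort s f))) : farT s (port i) = inr f.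
Proof. by case: s i. Qed.
Lemma slot_port s f (i : 'I_(size (sort s f))) : slot (port i) = i.
Proof. by case: s i. Qed.

Lemma mid_port s e : is_wire (near s e) ->
  is_mid (etype e) \/ exists f (i : 'I_(size (sort s f))), etype e = port i.
Proof.
rewrite /is_wire near_type; case: s; case: (etype e) => //=.
- by left.
- by move=> f i _; right; exists f, i.
- by left.
- by move=> f i _; right; exists f, i.
Qed.

Lemma near_inj s e e' : is_wire (near s e) -> near s e = near s e' -> e = e'.
Proof. by case: s; [apply: sg_in|apply: sg_out]. Qed.

Lemma far_inj s f e e' (i : 'I_(size (sort s f))) : far s e = far s e' ->
  etype e = port i -> etype e' = port i -> e = e'.
Proof.
move=> ef te te'; set v := far s e in ef.
have tv : vtype v = inr f by rewrite far_type te port_far.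
have nv : ~~ is_wire v by rewrite /is_wire tv.
have ht : src (g := typegraph T) (port i) = vtype v \/ tgt (g := typegraph T) (port i) = vtype v.
  by rewrite tv -(port_far i); case: (s) i {ef te te' tv nv v} => i; rewrite /farT; [left|right].
have [e0 [_ u]] := sg_box sG nv ht.
have he e1 : far s e1 = v -> csrc e1 = v \/ ctgt e1 = v.
  by case: (s) => /= ->; [left|right].
by transitivity e0; [symmetry|]; apply: u; split=> //; apply: he.
Qed.

Lemma port_fun s v f : vtype v = inr f ->
  exists ef : 'I_(size (sort s f)) -> cedge G, forall i, far s (ef i) = v /\ etype (ef i) = port i.
Proof.
move=> tv; apply: (choose_fun (P := fun i e => far s e = v /\ etype e = port i)) => i.
have nv : ~~ is_wire v by rewrite /is_wire tv.
have ht : src (g := typegraph T) (port i) = vtype v \/ tgt (g := typegraph T) (port i) = vtype v.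
  by rewrite tv -(port_far i); case: (s) i => i; rewrite /farT; [left|right].
have [e [[he te] _]] := sg_box sG nv ht.
(* The edge given by [sg_box] could have [v] at either end; typing excludes the near end, which is a
   wire-vertex. *)
exists e; split=> //; case: he => he.
  case: (s) i te ht => i te ht //=; have := near_type false e.
  by rewrite /near he tv te.
case: (s) i te ht => i te ht //=; have := near_type true e.
by rewrite /near he tv te.
Qed.

Lemma ports_map s v f (ef : 'I_(size (sort s f)) -> cedge G) : vtype v = inr f ->
  (forall i, far s (ef i) = v /\ etype (ef i) = port i) ->
  ports s v [seq ef i | i <- enum 'I_(size (sort s f))].
Proof.
move=> tv h f'; rewrite tv => -[<-]; split; first by move=> e /mapP[i _ ->]; case: (h i).
by rewrite -map_comp; apply: eq_map => i /=; case: (h i).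
Qed.

Lemma ports_ex s v : exists es, ports s v es.
Proof.
case tv: (vtype v) => [o|f]; first by exists [::] => f; rewrite tv.
have [ef h] := port_fun s tv.
by exists [seq ef i | i <- enum 'I_(size (sort s f))]; apply: ports_map.
Qed.

Lemma ports_fun s v es es' : ~~ is_wire v -> ports s v es -> ports s v es' -> es = es'.
Proof.
rewrite /is_wire; case tv: (vtype v) => [//|f] _ /(_ f tv)[h1 h2] /(_ f tv)[h1' h2'].
have : forall e, e \in es -> exists i : 'I_(size (sort s f)), etype e = port i.
  (* Edge types form no [eqType], hence [List.In]. *)
  move=> e he; have : List.In (etype e) [seq etype e | e <- es].
    elim: (es) he => //= a l IH; rewrite inE => /orP[/eqP ->|/IH]; by [left|right].
  rewrite h2; elim: (enum _) => //= i l IH [<-|/IH //]; by exists i.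
rewrite -h2' in h2; clear h2'; elim: es es' h1 h1' h2 => [|e es IH] [|e' es'] //= h1 h1' [ht hl] hp.
have [i ti] := hp e (mem_head _ _).
have ee : e = e'.
  apply: (@far_inj s f e e' i) => //; last by rewrite -ht.
  by rewrite (h1 e (mem_head _ _)) (h1' e' (mem_head _ _)).
subst e'; congr cons.
by apply: IH => // a ha; [apply: h1|apply: h1'|apply: hp]; rewrite inE ha orbT.
Qed.

Lemma box_portsP s v : ports s v (box_ports s v).
Proof. exact: epsilon_spec (ports_ex s v). Qed.

Lemma box_ports_eq s v es : ~~ is_wire v -> ports s v es -> box_ports s v = es.
Proof. by move=> nv; apply: ports_fun nv (@box_portsP s v). Qed.

Lemma mem_ports s v f e : vtype v = inr f ->
  e \in box_ports s v <-> exists i : 'I_(size (sort s f)), far s e = v /\ etype e = port i.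
Proof.
move=> tv; have [h1 h2] := box_portsP s tv; split=> [he|[i [fe te]]].
  have : List.In (etype e) [seq etype e | e <- box_ports s v].
    elim: (box_ports s v) he => //= a l IH; rewrite inE => /orP[/eqP ->|/IH]; by [left|right].
  rewrite h2 => h; suff [i hi] : exists i : 'I_(size (sort s f)), etype e = port i.
    by exists i; rewrite h1.
  elim: (enum _) h => //= i l IH [<-|/IH //]; by exists i.
have : List.In (port i) [seq port i | i <- enum 'I_(size (sort s f))].
  have := mem_enum 'I_(size (sort s f)) i; rewrite inE.
  elim: (enum _) => //= a l IH; rewrite inE => /orP[/eqP ->|/IH]; by [left|right].
rewrite -h2; elim: (box_ports s v) (h1) => //= a l IH h [ta|hl]; last first.
  by rewrite inE IH ?orbT // => b hb; apply: h; rewrite inE hb orbT.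
by rewrite (@far_inj s f e a i) ?mem_head // fe h ?mem_head.
Qed.

Lemma uniq_ports s v : ~~ is_wire v -> uniq (box_ports s v).
Proof.
rewrite /is_wire; case tv: (vtype v) => [//|f] _; have [_ h] := box_portsP s tv.
apply: (@map_uniq _ _ (fun e => slot (etype e))).
have -> : [seq slot (etype e) | e <- box_ports s v] = map slot [seq etype e | e <- box_ports s v].
  by rewrite -map_comp.
rewrite h -map_comp (eq_map (g := val)); last by move=> i; apply: slot_port.
by rewrite map_inj_uniq ?enum_uniq //; exact: val_inj.
Qed.

Lemma mem_node_edges s j e : is_node j ->
  e \in node_edges s j <-> is_wire (near s e) /\ owner s e = j.
Proof.
rewrite /owner; case: j => [e'|v] /= nj; rewrite ?inE.
  split=> [/eqP->|[_]]; last by case: ifP => // _ [->].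
  rewrite nj /is_wire near_type; split=> //.
  by case: (s); case: (etype e') nj.
move: nj; rewrite /is_wire; case tv: (vtype v) => [//|f] _; rewrite (mem_ports _ _ tv).
split=> [[i [fe te]]|[]].
  by rewrite near_type te port_near fe; split=> //; case: (s) i te.
move=> w; case: ifP => // nm [ev]; have [|[f' [i ti]]] := mid_port (s := s) w; first by rewrite nm.
have := far_type s e; rewrite ti port_far ev tv => -[ef]; subst f'.
by exists i.
Qed.

Lemma owner_node s e : is_wire (near s e) -> is_node (owner s e).
Proof.
move=> w; rewrite /owner; case: ifP => // nm.
have [|[f' [i ti]]] := mid_port w; first by rewrite nm.
by rewrite /= /is_wire far_type ti port_far.
Qed.

Section Nodes.
Variables (s : bool) (js : seq (node G)).
Hypotheses (ujs : uniq js) (mjs : forall j, (j \in js) = is_node j).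

Lemma ins_ports : ins (@node_ports s G) js = [seq near s e | e <- ins (@node_edges s G) js].
Proof. by rewrite -[in LHS](map_id js); apply: ins_map. Qed.

Lemma mem_edges e : (e \in ins (@node_edges s G) js) = is_wire (near s e).
Proof.
apply/ins_in/idP => [[j]|w]; first by rewrite mjs => nj /(mem_node_edges _ _ nj)[].
exists (owner s e); first by rewrite mjs owner_node.
by apply/mem_node_edges => //; exact: owner_node.
Qed.

Lemma uniq_edges : uniq (ins (@node_edges s G) js).
Proof.
apply: uniq_ins => // [[e|v]|j j' e]; rewrite ?mjs //=; first exact: uniq_ports.
by move=> nj nj' /(mem_node_edges _ _ nj)[_ <-] /(mem_node_edges _ _ nj')[_ <-].
Qed.

Lemma uniq_ports_all : uniq (ins (@node_ports s G) js).
Proof.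
rewrite ins_ports map_inj_in_uniq ?uniq_edges // => e e'; rewrite mem_edges => w _.
exact: near_inj.
Qed.

Lemma mem_ports_all x : (x \in ins (@node_ports s G) js) = is_wire x && [exists e, near s e == x].
Proof.
rewrite ins_ports; apply/mapP/andP => [[e]|[w /existsP[e /eqP ee]]].
  by rewrite mem_edges => w ->; split=> //; apply/existsP; exists e.
by exists e; rewrite ?mem_edges ?ee.
Qed.
End Nodes.
End StringGraph.

Variables (V : sst_data) (HV : is_sst V) (F : sighom T V).

(** The unit at box-vertices is a dummy: in a framed graph only wire-vertices occur as labels. *)
Definition vert_ob G (v : cvert G) : Ob V := match vtype v with inl o => F o | inr _ => unitO end.

Definition node_arr G (j : node G) : arr V :=
  match j with
  | inl e => aid (vert_ob (csrc e))
  | inr v => match vtype v with inr f => Arr (sm F f) | inl _ => aid unitO end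
  end.

(** The order of the nodes is a parameter, so that each operation can be computed in the order that
    suits it; [val_ofE] removes the dependence. *)
Definition netval G (js : seq (node G)) : arr V :=
  net (@vert_ob G) (domf G) (codf G) (ins (@node_ports false G) js) (ins (@node_ports true G) js)
    (bigt (@node_arr G) js).

Definition val_of G : arr V := netval (nodes G).

Lemma tw_ports s G (sG : string_graph G) (v : cvert G) f : vtype v = inr f ->
  tw (@vert_ob G) (node_ports s (inr v : node G)) = tensl [seq F a | a <- sort s f].
Proof.
move=> tv; rewrite twE /node_ports /=; congr tensl.
have [_ h] := @box_portsP G sG s v f tv.
have -> : [seq vert_ob v | v <- [seq near s e | e <- box_ports s v]] =
    [seq match nearT s t with inl o => F o | inr _ => unitO end | t <- [seq etype e | e <- box_ports s v]].
  by rewrite -!map_comp; apply: eq_map => e /=; rewrite /vert_ob near_type.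
have -> : sort s f = [seq tnth (in_tuple (sort s f)) i | i <- enum 'I_(size (sort s f))].
  by rewrite map_tnth_enum.
rewrite h -!map_comp; apply: eq_map => i /=.
by rewrite port_near.
Qed.

Lemma barr_ty G (sG : string_graph G) (j : node G) : is_node j ->
  adom (node_arr j) = tw (@vert_ob G) (node_ports false j) /\
  acod (node_arr j) = tw (@vert_ob G) (node_ports true j).
Proof.
case: j => [e|v] /=.
  move=> m; rewrite !twE /= !tensO1; split=> //.
  have [h k] := sg_typed sG e; rewrite /vert_ob h k; by case: (etype e) m.
rewrite /is_wire; case tv: (vtype v) => [//|f] _.
by rewrite (tw_ports false sG tv) (tw_ports true sG tv).
Qed.

Section Framed.
Variables (X Y : seq (bool * sobj T)) (G : cospan T) (fG : framed X Y G).
Hypotheses (pX : positive X) (pY : positive Y).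
Variable js : seq (node G).
Hypotheses (ujs : uniq js) (mjs : forall j, (j \in js) = is_node j).
Let sG := fr_string fG.

Lemma net_uniq : uniq (domf G ++ ins (@node_ports true G) js).
Proof.
rewrite cat_uniq uniq_ports_all // andbT; apply/andP; split.
  by have := fr_uniq fG; rewrite cat_uniq => /andP[].
apply/hasPn => x; rewrite mem_ports_all // => /andP[_ hx]; rewrite (pos_dom _ fG) //.
by rewrite /is_input /has_in hx andbF.
Qed.

Lemma net_uniq' : uniq (codf G ++ ins (@node_ports false G) js).
Proof.
rewrite cat_uniq uniq_ports_all // andbT; apply/andP; split.
  by have := fr_uniq fG; rewrite cat_uniq => /and3P[].
apply/hasPn => x; rewrite mem_ports_all // => /andP[_ hx]; rewrite (pos_cod _ fG) //.
by rewrite /is_output /has_out hx andbF.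
Qed.

(** A wire-vertex is either an input or the target of an edge, and either an output or the source of
    one; both lists thus contain every wire-vertex once. *)
Lemma net_perm_eq :
  perm_eq (domf G ++ ins (@node_ports true G) js) (codf G ++ ins (@node_ports false G) js).
Proof.
apply: uniq_perm; [exact: net_uniq|exact: net_uniq'|] => x.
rewrite !mem_cat !mem_ports_all // (pos_dom _ fG) // (pos_cod _ fG) //.
rewrite /is_input /is_output /has_in /has_out /near.
by case: is_wire => //=; rewrite !orNb.
Qed.

Lemma val_ofE : val_of G = netval js.
Proof.
have pj : perm_eq js (nodes G).
  by apply: uniq_perm; rewrite ?nodes_uniq // => j; rewrite mjs mem_nodes.
apply: net_perm => //; [exact: net_uniq|exact: net_perm_eq|] => j; rewrite mjs.
exact: barr_ty.
Qed.

Lemma bigt_ty :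
  adom (bigt (@node_arr G) js) = tw (@vert_ob G) (ins (@node_ports false G) js) /\
  acod (bigt (@node_arr G) js) = tw (@vert_ob G) (ins (@node_ports true G) js).
Proof. by split; [apply: adom_bigt|apply: acod_bigt] => j; rewrite mjs => /(barr_ty sG)[]. Qed.
End Framed.
End Interp.

(** * Invariance of the value under wire-homeomorphism *)

Section Invariance.
Variables (T : signature) (V : sst_data) (HV : is_sst V) (F : sighom T V).
Implicit Types (G H : cospan T) (s : bool).
Notation vob := (@vert_ob _ _ F _).
Notation barr := (@node_arr _ _ F _).
Notation val_of := (val_of F).

Section Embed.
Variables (G H : cospan T) (sG : string_graph G) (sH : string_graph H).
Variables (hv : cvert G -> cvert H) (he : cedge G -> cedge H).
Hypotheses (het : forall e, etype (he e) = etype e) (hvt : forall v, vtype (hv v) = vtype v).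
Hypothesis hfar : forall s e, ~~ is_wire (far s e) -> far s (he e) = hv (far s e).

(** By [hfar] only box ends are preserved exactly; near ends may be moved by a further map, as
    happens to the out-edge of a vertex that is split. *)
Definition emb (j : node G) : node H :=
  match j with inl e => inl (he e) | inr v => inr (hv v) end.

Lemma emb_node j : is_node (emb j) = is_node j.
Proof. by case: j => [e|v] /=; rewrite /is_wire ?het ?hvt. Qed.

Lemma emb_inj : injective hv -> injective he -> injective emb.
Proof. by move=> iv ie [e|v] [e'|v'] //= [] => [/ie|/iv] ->. Qed.

Lemma emb_edges s j : is_node j -> node_edges s (emb j) = map he (node_edges s j).
Proof.
case: j => [e|v] //= nv; apply: box_ports_eq => //; first by rewrite /is_wire hvt.
move=> f; rewrite hvt => tv; have [h1 h2] := @box_portsP _ G sG s v f tv; split.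
  by move=> e' /mapP[e /h1 fe ->]; rewrite hfar fe.
by rewrite -h2 -map_comp; apply: eq_map => e /=; rewrite het.
Qed.

Lemma emb_ports s g j : (forall e, near s (he e) = g (near s e)) -> is_node j ->
  node_ports s (emb j) = map g (node_ports s j).
Proof.
by move=> hg nj; rewrite /node_ports emb_edges // -!map_comp; apply: eq_map => e /=; rewrite hg.
Qed.

Lemma emb_barr j : is_node j -> barr (emb j) = barr j.
Proof.
case: j => [e|v] /= nj; last by rewrite hvt.
have [h _] := sg_typed sG e; have [h' _] := sg_typed sH (he e).
by rewrite /vert_ob h h' het; case: (etype e) nj.
Qed.
End Embed.

Variables X Y : seq (bool * sobj T).
Hypotheses (pX : positive X) (pY : positive Y).

Lemma val_iso G H : framed X Y G -> framed X Y H -> cospan_iso G H -> val_of H = val_of G.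
Proof.
move=> fG fH [fv [fe [[bv be] hst ht het [hd hc]]]].
have [sG sH] := (fr_string fG, fr_string fH).
have hn s e : near s (fe e) = fv (near s e) by case: s; case: (hst e).
have hf s e : far s (fe e) = fv (far s e) by case: s; case: (hst e).
pose hj := emb fv fe; have ij : injective hj := emb_inj (bij_inj bv) (bij_inj be).
have uj : uniq (map hj (nodes G)) by rewrite map_inj_uniq // nodes_uniq.
have mj j : (j \in map hj (nodes G)) = is_node j.
  apply/mapP/idP => [[j' + ->]|nj]; first by rewrite mem_nodes emb_node.
  have [[ge geK feK] [gv gvK fvK]] := (be, bv).
  have [j' ej] : exists j', j = hj j'.
    by case: j {nj} => [e|v]; [exists (inl (ge e))|exists (inr (gv v))]; rewrite /hj /= ?feK ?fvK.
  by exists j' => //; rewrite mem_nodes -(emb_node (hv := fv) het ht) -/hj -ej.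
rewrite (val_ofE HV F fH pX pY uj mj) /netval hd hc.
rewrite (ins_map (f := @node_ports _ false G) (hv := fv)); last first.
  by move=> j; rewrite mem_nodes => nj; apply: emb_ports.
rewrite (ins_map (f := @node_ports _ true G) (hv := fv)); last first.
  by move=> j; rewrite mem_nodes => nj; apply: emb_ports.
rewrite (bigt_map (b := @node_arr _ _ F G)); last by move=> j; rewrite mem_nodes => nj; apply: emb_barr.
apply: net_map; [by move=> v; rewrite /vert_ob ht|exact: bij_inj|].
apply: (net_perm_eq fG pX pY (nodes_uniq G)); exact: mem_nodes.
Qed.

(** Produced labels are renamed by [hv] and consumed ones by [g], which differ only at [v]: its
    consumer now takes the new vertex [n]. The new edge is an identity node from [hv v] to [n], so
    this is an instance of [net_split]. *)
Lemma val_split G H : framed X Y G -> framed X Y H -> splits_to G H -> val_of H = val_of G.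
Proof.
move=> fG fH [v [o [tv [fv [fe [[bv be] hst ht het [hd hc]]]]]]].
have [sG sH] := (fr_string fG, fr_string fH).
pose hv x := fv (Some x); pose he e := fe (Some e); pose n := fv None.
pose g x := if x == v then n else hv x.
have hn1 e : near true (he e) = hv (near true e) by case: (hst (Some e)).
have hn2 e : near false (he e) = g (near false e).
  by rewrite /near /he; case: (hst (Some e)) => -> _ /=; rewrite /g; case: eqP.
have wv : is_wire v by rewrite /is_wire tv.
have hf s e : ~~ is_wire (far s e) -> far s (he e) = hv (far s e).
  case: s => /=; last by case: (hst (Some e)).
  rewrite /he; case: (hst (Some e)) => -> _ /=; case: eqP => // ->; by rewrite wv.
have het' e : etype (he e) = etype e by rewrite /he het.
have hvt' x : vtype (hv x) = vtype x by rewrite /hv ht.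
have ihv : injective hv by move=> x y /(bij_inj bv)[].
have ihe : injective he by move=> x y /(bij_inj be)[].
pose hj := emb hv he; have ij : injective hj := emb_inj ihv ihe.
(* The new edge is listed last, as in [net_split]. *)
pose js := map hj (nodes G) ++ [:: inl (fe None)].
have uj : uniq js.
  rewrite cat_uniq map_inj_uniq // nodes_uniq /= orbF andbT.
  by apply/mapP => -[[e|x] _ //= [/(bij_inj be)]].
have mj j : (j \in js) = is_node j.
  rewrite mem_cat inE; apply/orP/idP => [[/mapP[j' + ->]|/eqP->]|nj].
  - by rewrite mem_nodes emb_node.
  - by rewrite /= het.
  have [[ge geK feK] [gv gvK fvK]] := (be, bv).
  case: j nj => [e|x] nj.
    case ee : (ge e) => [e'|]; last by right; rewrite -ee feK.
    left; apply/mapP; exists (inl e'); rewrite /hj /= /he -?ee ?feK //.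
    by rewrite mem_nodes /= -het' /he -ee feK.
  case ex : (gv x) => [x'|].
    left; apply/mapP; exists (inr x'); rewrite /hj /= /hv -?ex ?fvK //.
    by rewrite mem_nodes /= /is_wire -hvt' /hv -ex fvK.
  by move: nj; rewrite /= /is_wire -(fvK x) ex ht.
have hdom : domf H = map hv (domf G).
  rewrite hd -map_comp; apply/eq_in_map => x; rewrite (pos_dom _ fG) //= => ix.
  by case: ifP => // /andP[/eqP ex ox]; have := fr_isolated fG x; rewrite /is_isolated ix ex ox.
have hcod : codf H = map g (codf G).
  rewrite hc -map_comp; apply/eq_in_map => x; rewrite (pos_cod _ fG) //= => ox.
  by rewrite /g; case: eqP => //= ex; rewrite -ex ox.
have nU := nodes_uniq G; have nM := @mem_nodes _ G.
rewrite (val_ofE HV F fH pX pY uj mj) /netval hdom hcod.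
rewrite !ins_cat bigt_cat // /= !atens1r //.
rewrite (ins_map (f := @node_ports _ false G) (hv := g)); last first.
  by move=> j; rewrite mem_nodes => nj; apply: emb_ports.
rewrite (ins_map (f := @node_ports _ true G) (hv := hv)); last first.
  by move=> j; rewrite mem_nodes => nj; apply: emb_ports.
rewrite (bigt_map (b := @node_arr _ _ F G)); last by move=> j; rewrite mem_nodes => nj; apply: emb_barr.
rewrite /ins /= /node_ports /=; case: (hst None) => -> -> /=; rewrite -/n -/(hv v).
rewrite /val_of /netval /ins.
set d := domf G; set c := codf G.
set i := flatten [seq node_ports false j | j <- nodes G].
set o' := flatten [seq node_ports true j | j <- nodes G].
have us : uniq (d ++ o') := net_uniq fG pX pY nU nM.
have ud : uniq (c ++ i) := net_uniq' fG pX pY nU nM.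
have pp : perm_eq (d ++ o') (c ++ i) := net_perm_eq fG pX pY nU nM.
have vin : v \in c ++ i.
  rewrite mem_cat (@mem_ports_all _ _ sG false _ nM) /c (pos_cod _ fG) // /is_output /has_out /near wv /=.
  by rewrite orNb.
have [t1 [t2 [et nv]]] := splitx vin.
have [nv1 ut] : v \notin t1 /\ v \notin t2.
  by move: ud; rewrite et cat_uniq /= => /and3P[_ + /andP[]]; rewrite negb_or => /andP[].
have gt t : v \notin t -> map g t = map hv t.
  by move=> nt; apply/eq_in_map => x xt; rewrite /g; case: eqP => // ex; rewrite -ex xt in nt.
have nn (r : seq (cvert G)) : n \notin map hv r by apply/mapP => -[x _ /(bij_inj bv)].
have fn : vob (hv v) = vob n by rewrite /vert_ob ht /n ht /= tv.
have fvo x : vob (hv x) = vob x by rewrite /vert_ob hvt'.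
have [bd bc] := bigt_ty F fG nM.
have := @net_split V HV _ vob (map hv d) (map hv c) (map hv i) (map hv o') (map hv t1) (map hv t2)
  (hv v) n (bigt barr (nodes G)) (map g c) (map g i).
rewrite -!map_cat map_inj_uniq // perm_map // (nn (d ++ o')).
rewrite !(@tw_map V _ _ vob (@vert_ob _ _ F G) hv) // !size_map et map_cat /=.
have gv : g v = n by rewrite /g eqxx.
move=> -> //; first [by rewrite map_cat | by rewrite gv !gt |
  by rewrite (@net_map V _ _ vob (@vert_ob _ _ F G) hv)].
Qed.

Lemma val_homeo (G H : fcospan X Y) : wire_homeo G H -> val_of (sval G) = val_of (sval H).
Proof.
elim=> [[K fK] [L fL] /= [h|h]|//|G' H' _ ->//|G' H' K _ -> _ ->//].
  by rewrite (val_iso fK fL h).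
by rewrite (val_split fK fL h).
Qed.

Definition wob (Z : seq (bool * sobj T)) : Ob V := tensl [seq F z.2 | z <- Z].

Lemma tw_frame (Z : seq (bool * sobj T)) G (r : seq (cvert G)) :
  [seq vtype v | v <- r] = [seq inl z.2 | z <- Z] -> tw vob r = wob Z.
Proof.
move=> h; rewrite twE /wob; congr tensl.
have -> : [seq vob v | v <- r] = [seq (if t is inl o then F o else unitO) | t <- [seq vtype v | v <- r]].
  by rewrite -map_comp; apply: eq_map => v; rewrite /= /vert_ob; case: (vtype v).
by rewrite h -map_comp.
Qed.

Lemma val_ty G : framed X Y G -> adom (val_of G) = wob X /\ acod (val_of G) = wob Y.
Proof.
move=> fG; have nU := nodes_uniq G; have nM := @mem_nodes _ G.
have [bd bc] := bigt_ty F fG nM.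
have pp := net_perm_eq fG pX pY nU nM.
rewrite /val_of /netval adom_net acod_net //.
by split; apply: tw_frame; [apply: fr_dom_type fG|apply: fr_cod_type fG].
Qed.

Lemma val_recod G (c : seq (cvert G)) : framed X Y G -> perm_eq (codf G) c ->
  val_of (recod c) = acomp (shuf vob (codf G) c) (val_of G).
Proof.
move=> fG pc; have nU := nodes_uniq G; have nM := @mem_nodes _ G.
have [bd bc] := bigt_ty F fG nM.
have pp := net_perm_eq fG pX pY nU nM.
have us := net_uniq fG pX pY nU nM.
by rewrite [in RHS]/val_of /netval net_cod.
Qed.
End Invariance.

Lemma ins_single (J K I : eqType) (f : J -> seq I) (h : K -> J) (k : K -> I) ks :
  (forall i, f (h i) = [:: k i]) -> ins f (map h ks) = map k ks.
Proof. by move=> e; elim: ks => [|i ks IH] //=; rewrite ins_cons e IH. Qed.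

Lemma bigt_id V (HV : is_sst V) (J I : eqType) (F : I -> Ob V) (b : J -> arr V) (p : J -> seq I) js :
  (forall j, j \in js -> b j = aid (tw F (p j))) -> bigt b js = aid (tw F (ins p js)).
Proof.
elim: js => [|j js IH] h; first by [].
rewrite ins_cons tw_cat // -atens_id // -IH /= ?h ?mem_head // => k hk.
by rewrite h // inE hk orbT.
Qed.

Lemma zip_ends (A B : Type) (u : seq (bool * A)) (d c : seq B) :
    size d = size u -> size c = size u -> all fst u ->
  [seq if p.1.1 then p.2.1 else p.2.2 | p <- zip u (zip d c)] = d /\
  [seq if p.1.1 then p.2.2 else p.2.1 | p <- zip u (zip d c)] = c.
Proof.
elim: u d c => [|[b x] u IH] [|a d] [|e c] //= [sd] [sc] /andP[-> pu].
by have [-> ->] := IH d c sd sc pu.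
Qed.

Lemma perm_catACA4 (I : eqType) (a b c d : seq I) : perm_eq ((a ++ b) ++ c ++ d) (a ++ c ++ b ++ d).
Proof. pm. Qed.

(** * The value respects the operations *)

Section Operations.
Variables (T : signature) (V : sst_data) (HV : is_sst V) (F : sighom T V).
Implicit Types (G H : cospan T) (X Y Z A B U : seq (bool * sobj T)).
Notation vob := (@vert_ob _ _ F _).
Notation barr := (@node_arr _ _ F _).
Notation val_of := (val_of F).
Notation wob := (wob F).
Notation "g \c f" := (acomp g f) (at level 50, left associativity).
Notation "f \x g" := (atens f g) (at level 40, left associativity).

Lemma val_tens X Y X' Y' G H : framed X Y G -> framed X' Y' H ->
    positive X -> positive Y -> positive X' -> positive Y' ->
  val_of (cospan_tens G H) = val_of G \x val_of H.
Proof.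
move=> fG fH pX pY pX' pY'; have fK := framed_tens fG fH.
have [pXX pYY] : positive (X ++ X') /\ positive (Y ++ Y') by rewrite !positive_cat.
set K := cospan_tens G H in fK *.
have [[sG sH] sK] := (fr_string fG, fr_string fH, fr_string fK).
pose hl := @emb _ G K inl inl; pose hr := @emb _ H K inr inr.
have il : injective hl by apply: emb_inj => x y [].
have ir : injective hr by apply: emb_inj => x y [].
have hfl s e : ~~ is_wire (far s (e : cedge G)) -> far s (inl e : cedge K) = inl (far s e) by case: s.
have hfr s e : ~~ is_wire (far s (e : cedge H)) -> far s (inr e : cedge K) = inr (far s e) by case: s.
have nl s e : near s (inl e : cedge K) = inl (near s e) by case: s.
have nr s e : near s (inr e : cedge K) = inr (near s e) by case: s.
pose js := map hl (nodes G) ++ map hr (nodes H).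
have uj : uniq js.
  rewrite cat_uniq !map_inj_uniq // !nodes_uniq andbT /=.
  by apply/hasPn => _ /mapP[[a|a] _ ->]; apply/mapP => -[[b|b] _].
have mj j : (j \in js) = is_node j.
  rewrite mem_cat; apply/orP/idP => [[/mapP[j' + ->]|/mapP[j' + ->]]|].
  - by rewrite mem_nodes; case: j'.
  - by rewrite mem_nodes; case: j'.
  case: j => -[x|x] nj; [left|right|left|right]; apply/mapP.
  - by exists (inl x); rewrite ?mem_nodes.
  - by exists (inl x); rewrite ?mem_nodes.
  - by exists (inr x); rewrite ?mem_nodes.
  - by exists (inr x); rewrite ?mem_nodes.
rewrite (val_ofE HV F fK pXX pYY uj mj) /netval !ins_cat bigt_cat //.
rewrite (ins_map (g := @node_ports _ true K) (f := @node_ports _ true G) (hv := inl)); last first.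
  by move=> j; rewrite mem_nodes => nj; apply: emb_ports.
rewrite (ins_map (g := @node_ports _ false K) (f := @node_ports _ false G) (hv := inl)); last first.
  by move=> j; rewrite mem_nodes => nj; apply: emb_ports.
rewrite (ins_map (g := @node_ports _ true K) (f := @node_ports _ true H) (hv := inr)); last first.
  by move=> j; rewrite mem_nodes => nj; apply: emb_ports.
rewrite (ins_map (g := @node_ports _ false K) (f := @node_ports _ false H) (hv := inr)); last first.
  by move=> j; rewrite mem_nodes => nj; apply: emb_ports.
rewrite (bigt_map (b := @node_arr _ _ F G)); last by move=> j; rewrite mem_nodes => nj; apply: emb_barr.
rewrite (bigt_map (b := @node_arr _ _ F H)); last by move=> j; rewrite mem_nodes => nj; apply: emb_barr.
have ppG := net_perm_eq fG pX pY (nodes_uniq G) (@mem_nodes _ G).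
have ppH := net_perm_eq fH pX' pY' (nodes_uniq H) (@mem_nodes _ H).
have usG := net_uniq fG pX pY (nodes_uniq G) (@mem_nodes _ G).
have usH := net_uniq fH pX' pY' (nodes_uniq H) (@mem_nodes _ H).
have [dG cG] := bigt_ty F fG (@mem_nodes _ G).
have [dH cH] := bigt_ty F fH (@mem_nodes _ H).
have vl (x : cvert G) : @vert_ob _ _ F K (inl x) = vob x by [].
have vr (x : cvert H) : @vert_ob _ _ F K (inr x) = vob x by [].
have jl : injective (inl : cvert G -> cvert K) by move=> x y [].
have jr : injective (inr : cvert H -> cvert K) by move=> x y [].
rewrite /= -net_tens // -?map_cat.
- by rewrite !(@net_map V _ _ (@vert_ob _ _ F K) vob).
- have : uniq ((map inl (domf G ++ ins (@node_ports _ true G) (nodes G)) : seq (cvert K)) ++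
     map inr (domf H ++ ins (@node_ports _ true H) (nodes H))) by rewrite uniq_inlr usG usH.
  by rewrite !map_cat (perm_uniq (perm_catACA4 _ _ _ _)).
- by rewrite perm_map.
- by rewrite perm_map.
- by rewrite (@tw_map V _ _ _ (@vert_ob _ _ F G)).
- by rewrite (@tw_map V _ _ _ (@vert_ob _ _ F G)).
- by rewrite (@tw_map V _ _ _ (@vert_ob _ _ F H)).
- by rewrite (@tw_map V _ _ _ (@vert_ob _ _ F H)).
Qed.

(** The trace wires are additional mid-edges, that is, identity nodes consuming [cU] and producing
    [dU], as in [net_tr]. *)
Lemma val_tr U A B G : framed (A ++ U) (B ++ U) G -> positive U -> positive A -> positive B ->
  val_of (cospan_tr U A B G) = atr (wob U) (wob A) (wob B) (val_of G).
Proof.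
move=> fG pU pA pB; have fK := framed_tr fG.
have [pAU pBU] : positive (A ++ U) /\ positive (B ++ U) by rewrite !positive_cat.
set K := cospan_tr U A B G in fK *.
have [sG sK] := (fr_string fG, fr_string fK).
pose n := size (trace_wires U A B G).
pose hl := @emb _ G K id inl; pose hr (i : 'I_n) : node K := inl (inr i).
have il : injective hl by apply: emb_inj => x y // [].
have ir : injective hr by move=> x y [].
have hfl s e : ~~ is_wire (far s (e : cedge G)) -> far s (inl e : cedge K) = far s e by case: s.
have nl s e : near s (inl e : cedge K) = id (near s e) by case: s.
pose js := map hl (nodes G) ++ map hr (enum 'I_n).
have uj : uniq js.
  rewrite cat_uniq (map_inj_uniq il) (map_inj_uniq ir) nodes_uniq enum_uniq andbT /=.
  by apply/hasPn => _ /mapP[a _ ->]; apply/mapP => -[[b|b] _].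
have mj j : (j \in js) = is_node j.
  rewrite mem_cat; apply/orP/idP => [[/mapP[j' + ->]|/mapP[j' _ ->]]|] //.
    by rewrite mem_nodes; case: j'.
  case: j => [[x|x]|x] nj; [left|right|left]; apply/mapP.
  - by exists (inl x); rewrite ?mem_nodes.
  - by exists x; rewrite ?mem_enum.
  - by exists (inr x); rewrite ?mem_nodes.
pose dU := drop (size A) (domf G); pose cU := drop (size B) (codf G).
have sz : size dU = size U /\ size cU = size U by rewrite (tr_size_dU fG) (tr_size_cU fG).
have ends : [seq ctgt (inr i : cedge K) | i <- enum 'I_n] = dU /\
            [seq csrc (inr i : cedge K) | i <- enum 'I_n] = cU.
  have h : [seq tnth (in_tuple (trace_wires U A B G)) i | i <- enum 'I_n] = zip U (zip dU cU).
    by rewrite map_tnth_enum.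
  have -> : [seq ctgt (inr i : cedge K) | i <- enum 'I_n] =
     [seq if p.1.1 then p.2.1 else p.2.2 | p <- zip U (zip dU cU)].
    by rewrite -h -map_comp; apply: eq_map => i /=; case: (tnth _ i) => x [u v].
  have -> : [seq csrc (inr i : cedge K) | i <- enum 'I_n] =
     [seq if p.1.1 then p.2.2 else p.2.1 | p <- zip U (zip dU cU)].
    by rewrite -h -map_comp; apply: eq_map => i /=; case: (tnth _ i) => x [u v].
  by case: sz => s1 s2; apply: zip_ends.
have [ed ec] := ends.
have mV := bigt_ty F fG (@mem_nodes _ G); have [dG cG] := mV.
have pp := net_perm_eq fG pAU pBU (nodes_uniq G) (@mem_nodes _ G).
have us := net_uniq fG pAU pBU (nodes_uniq G) (@mem_nodes _ G).
have [tA tU] := tr_map (fr_dom_type fG).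
have [tB tU'] := tr_map (fr_cod_type fG).
rewrite (val_ofE HV F fK pA pB uj mj) /netval !ins_cat bigt_cat //.
rewrite (ins_map (g := @node_ports _ true K) (f := @node_ports _ true G) (hv := id)); last first.
  by move=> j; rewrite mem_nodes => nj; apply: emb_ports.
rewrite (ins_map (g := @node_ports _ false K) (f := @node_ports _ false G) (hv := id)); last first.
  by move=> j; rewrite mem_nodes => nj; apply: emb_ports.
rewrite (bigt_map (b := @node_arr _ _ F G)); last by move=> j; rewrite mem_nodes => nj; apply: emb_barr.
rewrite !map_id.
have e1 : ins (@node_ports _ false K) (map hr (enum 'I_n)) = cU.
  by rewrite -ec; apply: ins_single.
have e2 : ins (@node_ports _ true K) (map hr (enum 'I_n)) = dU.
  by rewrite -ed; apply: ins_single.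
have e3 : bigt (@node_arr _ _ F K) (map hr (enum 'I_n)) = aid (tw (@vert_ob _ _ F K) cU).
  rewrite -e1; apply: bigt_id => // _ /mapP[i _ ->].
  by rewrite twE /= tensO1.
rewrite e1 e2 e3.
have kE : @vert_ob _ _ F K = @vert_ob _ _ F G by [].
rewrite kE /=.
have -> : wob U = tw (@vert_ob _ _ F G) dU by rewrite (tw_frame F (Z := U)).
have -> : wob A = tw (@vert_ob _ _ F G) (take (size A) (domf G)) by rewrite (tw_frame F (Z := A)).
have -> : wob B = tw (@vert_ob _ _ F G) (take (size B) (codf G)) by rewrite (tw_frame F (Z := B)).
rewrite -net_tr //.
- by rewrite /dU /cU !cat_take_drop.
- by rewrite /dU catA cat_take_drop.
- by rewrite /dU /cU !catA !cat_take_drop.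
- by rewrite !(tw_frame F (Z := U)).
Qed.

(** Together the wires form one identity box that consumes [domf K] and produces [codf K], to which
    [net_yank] applies. *)
Lemma val_id X : positive X -> val_of (cospan_id X) = aid (wob X).
Proof.
move=> pX; have fK := framed_id X; set K := cospan_id X in fK *.
pose js := map inl (enum (cedge K)) : seq (node K).
have uj : uniq js by rewrite map_inj_uniq ?enum_uniq // => x y [].
have mj j : (j \in js) = is_node j.
  case: j => [e|v]; first by rewrite mem_inl mem_enum.
  by rewrite /= /is_wire /=; case: v => i; apply/mapP => -[].
have p i : (tnth (in_tuple X) i).1 by move: i; apply/all_tnthP.
have e1 : ins (@node_ports _ false K) js = domf K.
  rewrite (ins_single (k := @csrc _ K)) //; apply: eq_map => i /=; by rewrite p.
have e2 : ins (@node_ports _ true K) js = codf K.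
  rewrite (ins_single (k := @ctgt _ K)) //; apply: eq_map => i /=; by rewrite p.
have e3 : bigt (@node_arr _ _ F K) js = aid (tw (@vert_ob _ _ F K) (domf K)).
  rewrite -e1; apply: bigt_id => // _ /mapP[i _ ->].
  by rewrite twE /= tensO1.
have eX : wob X = tw (@vert_ob _ _ F K) (domf K) by rewrite (tw_frame F (Z := X)) //; apply: fr_dom_type fK.
rewrite (val_ofE HV F fK pX pX uj mj) /netval e1 e2 e3 eX net_yank //; first exact: fr_uniq fK.
have eY : tw (@vert_ob _ _ F K) (codf K) = wob X by apply: tw_frame; apply: fr_cod_type fK.
by rewrite eY eX.
Qed.

Lemma val_symm X Y : positive X -> positive Y -> val_of (cospan_symm X Y) = asym (wob X) (wob Y).
Proof.
move=> pX pY; have [fX fY] := (framed_id X, framed_id Y).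
have fK := framed_tens fX fY; set K := cospan_tens _ _ in fK.
have pXY : positive (X ++ Y) by rewrite positive_cat.
pose c1 : seq (cvert K) := map inl (codf (cospan_id X)).
pose c2 : seq (cvert K) := map inr (codf (cospan_id Y)).
have e1 : tw (@vert_ob _ _ F K) c1 = wob X.
  by apply: tw_frame; rewrite -(fr_cod_type fX) -map_comp.
have e2 : tw (@vert_ob _ _ F K) c2 = wob Y.
  by apply: tw_frame; rewrite -(fr_cod_type fY) -map_comp.
have u : uniq (c1 ++ c2) by have := fr_uniq fK; rewrite cat_uniq => /and3P[].
have -> : val_of (cospan_symm X Y) = val_of (@recod _ K (c2 ++ c1)) by [].
rewrite (val_recod HV F pXY pXY fK); last by rewrite perm_catC.
rewrite (val_tens fX fY) // !val_id // shuf_symm // e1 e2.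
by rewrite atens_id // acomp1r.
Qed.

Lemma val_box f : val_of (cospan_box f) = Arr (sm F f).
Proof.
have fK := framed_box f; set K := cospan_box f in fK *; have sK := fr_string fK.
have pw (w : seq (sobj T)) : positive (pos_word w) by elim: w.
pose js : seq (node K) := [:: inr None].
have mj j : (j \in js) = is_node j.
  by rewrite inE; case: j => [[i|i]|[[i|i]|]].
have e1 : box_ports false (None : cvert K) = map inl (enum 'I_(size (sdom f))).
  apply: box_ports_eq => // f' [<-]; split=> [_ /mapP[i _ ->]|] //.
  by rewrite -map_comp.
have e2 : box_ports true (None : cvert K) = map inr (enum 'I_(size (scod f))).
  apply: box_ports_eq => // f' [<-]; split=> [_ /mapP[i _ ->]|] //.
  by rewrite -map_comp.
have i1 : ins (@node_ports _ false K) js = domf K.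
  by rewrite /ins /= cats0 /node_ports /= e1 -map_comp.
have i2 : ins (@node_ports _ true K) js = codf K.
  by rewrite /ins /= cats0 /node_ports /= e2 -map_comp.
have [bd bc] := bigt_ty F fK mj.
rewrite i1 i2 in bd bc.
rewrite (val_ofE HV F fK (pw _) (pw _) (isT : uniq js) mj) /netval i1 i2 net_yank //.
  by rewrite /= atens1r.
exact: fr_uniq fK.
Qed.

(** By the definition of [lcomp] this is the identity tr(σ ∘ (g ⊗ h)) = h ∘ g, which follows from
    naturality and yanking. *)
Lemma val_lcomp X Y Z G H : framed X Y G -> framed Y Z H ->
    positive X -> positive Y -> positive Z ->
  val_of (lcomp Y X Z G H) = val_of H \c val_of G.
Proof.
move=> fG fH pX pY pZ.
have [gd gc] := val_ty F pX pY fG; have [hd hc] := val_ty F pY pZ fH.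
rewrite (val_tr (framed_swapc fG fH)) // /swapc.
have [pXY pYZ] : positive (X ++ Y) /\ positive (Y ++ Z) by rewrite !positive_cat.
set K := cospan_tens G H; have fK := framed_tens fG fH.
rewrite (val_recod HV F pXY pYZ fK); last by rewrite perm_catC.
rewrite (val_tens fG fH) //.
have u : uniq ((map inl (codf G) : seq (cvert K)) ++ map inr (codf H)).
  by have := fr_uniq fK; rewrite cat_uniq => /and3P[].
rewrite shuf_symm //.
have -> : tw (@vert_ob _ _ F K) (map inl (codf G)) = wob Y.
  by apply: tw_frame; rewrite -(fr_cod_type fG) -map_comp.
have -> : tw (@vert_ob _ _ F K) (map inr (codf H)) = wob Z.
  by apply: tw_frame; rewrite -(fr_cod_type fH) -map_comp.
set g := val_of G in gd gc *; set h := val_of H in hd hc *.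
rewrite (@atens_splitr V HV g h) gc hd.
have := asym_nat HV (aid (wob Y)) h; rewrite /= hd hc => h1.
rewrite acompA //= ?gc ?hc ?hd // h1 -acompA //= ?gc ?hd //.
have := @atr_natl V HV (wob Y) (wob Y) (wob Z) ((h \x aid (wob Y)) \c asym (wob Y) (wob Y)) g.
rewrite gd acompA //= ?gc ?hd ?hc // => ->; rewrite ?adom_comp ?acod_comp //= ?hd ?hc //.
have := @atr_natr V HV (wob Y) (wob Y) (wob Y) (asym (wob Y) (wob Y)) h; rewrite hc => -> //.
by rewrite atr_yank // acomp1r.
Qed.
End Operations.

(** * Existence and uniqueness of the functor *)

Lemma sighom_ext (T : signature) (C : sst_data) (h h' : sighom T C) :
  (forall a, h a = h' a) -> (forall f, Arr (sm h f) = Arr (sm h' f)) -> h = h'.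
Proof.
case: h h' => o m [o' m'] /= /functional_extensionality eo; subst o' => em.
by congr SigHom; apply: functional_extensionality_dep => f; apply: Arr_inj; apply: em.
Qed.

Lemma functor_ext (C D : sst_data) (K K' : sst_functor C D) :
  (forall X, K X = K' X) ->
  (forall (X Y : Ob C) (c : Hom X Y), Arr (fhom K c) = Arr (fhom K' c)) -> K = K'.
Proof.
case: K K' => o m p1 p2 p3 p4 p5 p6 p7 [o' m' q1 q2 q3 q4 q5 q6 q7] /= /functional_extensionality eo.
subst o' => em.
have e : m = m'.
  do 3!apply: functional_extensionality_dep => ?; apply: Arr_inj; exact: em.
subst m'.
(* The laws after [fobj_tens] mention it in their statements, so its two proofs are identified
   before theirs. *)
have e4 := proof_irrelevance _ p4 q4; subst q4.
by rewrite (proof_irrelevance _ p1 q1) (proof_irrelevance _ p2 q2) (proof_irrelevance _ p3 q3)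
  (proof_irrelevance _ p5 q5) (proof_irrelevance _ p6 q6) (proof_irrelevance _ p7 q7).
Qed.

(** * The functor extending [F] *)

Section Extension.
Variables (T : signature) (V : sst_data) (HV : is_sst V) (F : sighom T V).
Local Open Scope sst_scope.

Lemma wob_cat (X Y : seq (bool * sobj T)) : wob F (X ++ Y) = wob F X ⊗ wob F Y.
Proof. by elim: X => [|x X IH] /=; rewrite /wob /= ?tens1O //= -tensOA -IH. Qed.

Definition ext_ob (X : Ob (FCspP T)) : Ob V := wob F (sval X).

Lemma ext_ty (X Y : Ob (FCspP T)) (c : Hom X Y) :
  adom (val_of F (sval (rep c))) = ext_ob X /\ acod (val_of F (sval (rep c))) = ext_ob Y.
Proof. exact: (val_ty F (svalP X) (svalP Y) (svalP (rep c))). Qed.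

Definition ext_hom (X Y : Ob (FCspP T)) (c : Hom X Y) : Hom (ext_ob X) (ext_ob Y) :=
  castm (proj1 (ext_ty c)) (proj2 (ext_ty c)) (ahom (val_of F (sval (rep c)))).

(** [val_homeo] allows the value to be read off any representative in place of the chosen one. *)
Lemma ext_homE (X Y : Ob (FCspP T)) (c : Hom X Y) G : rep_by c G -> Arr (ext_hom c) = val_of F G.
Proof.
case=> fG e; rewrite /ext_hom Arr_castm.
have -> : Arr (ahom (val_of F (sval (rep c)))) = val_of F (sval (rep c)) by case: val_of.
have /clsP h : cls (rep c) = cls (exist _ G fG) by rewrite repK.
exact: (val_homeo HV F (svalP X) (svalP Y) h).
Qed.

Lemma ext_id X : ext_hom (idm X) = idm (ext_ob X).
Proof. by apply: Arr_inj; rewrite (ext_homE (rep_id X)) (val_id HV F (svalP X)). Qed.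

Lemma ext_comp (A B E : Ob (FCspP T)) (g : Hom B E) (f : Hom A B) :
  ext_hom (g ∘ f) = ext_hom g ∘ ext_hom f.
Proof.
have [G rG] := rep_ex g; have [L rL] := rep_ex f.
apply: Arr_inj; rewrite (ext_homE (rep_comp rL rG)) -acompE (ext_homE rG) (ext_homE rL).
exact: (val_lcomp HV F (rep_framed rL) (rep_framed rG) (svalP A) (svalP B) (svalP E)).
Qed.

Lemma ext_obM (A B : Ob (FCspP T)) : ext_ob (A ⊗ B) = ext_ob A ⊗ ext_ob B.
Proof. exact: wob_cat. Qed.

Lemma ext_tens (A A' B B' : Ob (FCspP T)) (f : Hom A B) (g : Hom A' B') :
  castm (ext_obM A A') (ext_obM B B') (ext_hom (f ⊠ g)) = ext_hom f ⊠ ext_hom g.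
Proof.
have [G rG] := rep_ex f; have [L rL] := rep_ex g.
apply: Arr_inj; rewrite Arr_castm (ext_homE (rep_tens rG rL)).
rewrite (val_tens HV F (rep_framed rG) (rep_framed rL) (svalP A) (svalP B) (svalP A') (svalP B')).
by rewrite -(ext_homE rG) -(ext_homE rL).
Qed.

Lemma ext_symm (A B : Ob (FCspP T)) :
  castm (ext_obM A B) (ext_obM B A) (ext_hom (symm A B)) = symm (ext_ob A) (ext_ob B).
Proof.
apply: Arr_inj; rewrite Arr_castm (ext_homE (rep_symm A B)).
by rewrite (val_symm HV F (svalP A) (svalP B)).
Qed.

Lemma ext_tr (X A B : Ob (FCspP T)) (f : Hom (A ⊗ X) (B ⊗ X)) :
  ext_hom (trm X f) = trm (ext_ob X) (castm (ext_obM A X) (ext_obM B X) (ext_hom f)).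
Proof.
have [G rG] := rep_ex f.
apply: Arr_inj; rewrite (ext_homE (rep_tr rG)) -atrE Arr_castm (ext_homE rG).
exact: (val_tr HV F (rep_framed rG) (svalP X) (svalP A) (svalP B)).
Qed.

Definition ext : sst_functor (FCspP T) V :=
  @SSTFunctor (FCspP T) V ext_ob ext_hom ext_id ext_comp erefl ext_obM ext_tens ext_symm ext_tr.

Lemma ext_comp_canonical : sighom_comp ext (canonical_sighom T) = F.
Proof.
apply: sighom_ext => [a|f] /=; first by rewrite /ext_ob /= /wob /= tensO1.
rewrite Arr_castm (ext_homE (G := cospan_box f)); first exact: val_box.
exact: (represents_cls (exist _ (cospan_box f) (framed_box_tensl f))).
Qed.
End Extension.

Section FunctorArrows.
Variables (C D : sst_data) (K : sst_functor C D).
Local Open Scope sst_scope.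
Lemma Arr_fcomp (A B E : Ob C) (g : Hom B E) (f : Hom A B) :
  Arr (fhom K (g ∘ f)) = acomp (Arr (fhom K g)) (Arr (fhom K f)).
Proof. by rewrite fhom_comp acompE. Qed.
Lemma Arr_ftens (A A' B B' : Ob C) (f : Hom A B) (g : Hom A' B') :
  Arr (fhom K (f ⊠ g)) = atens (Arr (fhom K f)) (Arr (fhom K g)).
Proof. by rewrite [RHS]/atens /= -fhom_tens Arr_castm. Qed.
Lemma Arr_ftr (X A B : Ob C) (f : Hom (A ⊗ X) (B ⊗ X)) :
  Arr (fhom K (trm X f)) = atr (K X) (K A) (K B) (Arr (fhom K f)).
Proof. by rewrite fhom_tr -atrE Arr_castm. Qed.
Lemma Arr_fsymm (A B : Ob C) : Arr (fhom K (symm A B)) = asym (K A) (K B).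
Proof. by rewrite /asym -fhom_symm Arr_castm. Qed.
Lemma Arr_fid (A : Ob C) : Arr (fhom K (idm A)) = aid (K A).
Proof. by rewrite fhom_id. Qed.
Lemma Arr_fcast (A B A' B' : Ob C) (eA : A = A') (eB : B = B') (f : Hom A B) :
  Arr (fhom K (castm eA eB f)) = Arr (fhom K f).
Proof. by subst. Qed.
End FunctorArrows.

(** * Arrows on which two functors agree *)

Section Generation.
Variables (T : signature) (V : sst_data) (K K' : sst_functor (FCspP T) V).
Hypothesis eob : forall X, K X = K' X.
Hypothesis ebox : forall f, Arr (fhom K (sm (canonical_sighom T) f)) = Arr (fhom K' (sm (canonical_sighom T) f)).
Implicit Types (G H W : cospan T) (X Y Z A B U : seq (bool * sobj T)).

(* The words are kept apart from the proofs that they are positive, so that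
   equations between words can be rewritten. *)
Definition gen X Y G := exists (pX : positive X) (pY : positive Y)
    (c : @Hom (FCspP T) (exist _ X pX) (exist _ Y pY)),
  rep_by c G /\ Arr (fhom K c) = Arr (fhom K' c).

Lemma gen_framed X Y G : gen X Y G -> [/\ framed X Y G, positive X & positive Y].
Proof. by case=> pX [pY [c [/rep_framed fG _]]]. Qed.

Lemma gen_contr X Y G H : gen X Y G -> framed X Y H -> contr G H -> gen X Y H.
Proof.
case=> pX [pY [c [rc e]]] fH h; exists pX, pY, c; split=> //.
exact: (represents_contr pX pY rc fH h).
Qed.

Lemma gen_tens X Y X' Y' G H : gen X Y G -> gen X' Y' H ->
  gen (X ++ X') (Y ++ Y') (cospan_tens G H).
Proof.
case=> pX [pY [c [rc e]]] [pX' [pY' [c' [rc' e']]]].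
pose x : Ob (FCspP T) := exist _ X pX; pose x' : Ob (FCspP T) := exist _ X' pX'.
pose y : Ob (FCspP T) := exist _ Y pY; pose y' : Ob (FCspP T) := exist _ Y' pY'.
exists (positive_cat (svalP x) (svalP x')), (positive_cat (svalP y) (svalP y')).
exists (tensm (s := FCspP T) c c'); split; first exact: rep_tens rc rc'.
have := Arr_ftens K c c'; rewrite e e' -Arr_ftens; exact.
Qed.

Lemma gen_tr U A B G : positive U -> positive A -> positive B ->
  gen (A ++ U) (B ++ U) G -> gen A B (cospan_tr U A B G).
Proof.
move=> pU pA pB [pAU [pBU [c [rc e]]]].
pose u : Ob (FCspP T) := exist _ U pU; pose a : Ob (FCspP T) := exist _ A pA.
pose b : Ob (FCspP T) := exist _ B pB.
(* Positivity is a boolean equation, so its proofs may be replaced by those that [positive_cat]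
   builds. *)
have ea := bool_irrelevance pAU (positive_cat (svalP a) (svalP u)); subst pAU.
have eb := bool_irrelevance pBU (positive_cat (svalP b) (svalP u)); subst pBU.
exists pA, pB, (@trm (FCspP T) u a b c); split; first exact: (@rep_tr _ u a b c).
have e1 : Arr (@fhom _ _ K (tensO a u) (tensO b u) c) = Arr (@fhom _ _ K' (tensO a u) (tensO b u) c) := e.
have ek : atr (K u) (K a) (K b) = atr (K' u) (K' a) (K' b) by rewrite !eob.
have := @Arr_ftr _ _ K u a b c; rewrite e1 ek -Arr_ftr; exact.
Qed.

Lemma gen_id X : positive X -> gen X X (cospan_id X).
Proof.
move=> pX; pose x : Ob (FCspP T) := exist _ X pX; exists pX, pX, (idm x).
split; first exact: (rep_id x).
have ek : aid (K x) = aid (K' x) by rewrite eob.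
have := Arr_fid K x; rewrite ek -Arr_fid; exact.
Qed.

Lemma gen_symm X Y : positive X -> positive Y -> gen (X ++ Y) (Y ++ X) (cospan_symm X Y).
Proof.
move=> pX pY; pose x : Ob (FCspP T) := exist _ X pX; pose y : Ob (FCspP T) := exist _ Y pY.
exists (positive_cat (svalP x) (svalP y)), (positive_cat (svalP y) (svalP x)), (symm x y).
split; first exact: (rep_symm x y).
have ek : asym (K x) (K y) = asym (K' x) (K' y) by rewrite !eob.
have := Arr_fsymm K x y; rewrite ek -Arr_fsymm; exact.
Qed.

Lemma positive_pos_word (w : seq (sobj T)) : positive (pos_word w).
Proof. by elim: w. Qed.

Lemma gen_box f : gen (pos_word (sdom f)) (pos_word (scod f)) (cospan_box f).
Proof.
have e (w : seq (sobj T)) : tensl [seq pos_letter o | o <- w] =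
    exist _ (pos_word w) (positive_pos_word w) :> Ob (FCspP T).
  by apply: sub_ob_eq; apply: sval_tensl.
exists (positive_pos_word _), (positive_pos_word _).
exists (castm (e _) (e _) (sm (canonical_sighom T) f)).
split; last by rewrite !Arr_fcast ebox.
apply: rep_cast; exact: (represents_cls (exist _ (cospan_box f) (framed_box_tensl f))).
Qed.

Lemma gen_absorb X Y Z G W (q : cvert W -> cvert G) c :
  gen Y Z W -> gen X Y G -> wires q (codf G) c -> gen X Z (recod (G := G) c).
Proof.
case=> pY [pZ [w [rw ew]]] [pX [pY' [g [rg eg]]]] wq.
rewrite (bool_irrelevance pY' pY) in g rg eg.
exists pX, pZ, (compm (s := FCspP T) w g); split; first exact: rep_absorb_r rw rg wq.
have := Arr_fcomp K w g; rewrite ew eg -Arr_fcomp; exact.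
Qed.

Lemma positive_take X n : positive X -> positive (take n X).
Proof. by rewrite /positive -{1}(cat_take_drop n X) all_cat => /andP[]. Qed.
Lemma positive_drop X n : positive X -> positive (drop n X).
Proof. by rewrite /positive -{1}(cat_take_drop n X) all_cat => /andP[]. Qed.

Lemma split_frame G X (s t : seq (cvert G)) : positive X ->
    [seq vtype v | v <- s ++ t] = [seq inl x.2 | x <- X] ->
  exists X1 X2, [/\ X = X1 ++ X2, positive X1, positive X2,
    [seq vtype v | v <- s] = [seq inl x.2 | x <- X1] &
    [seq vtype v | v <- t] = [seq inl x.2 | x <- X2]].
Proof.
move=> pX e; exists (take (size s) X), (drop (size s) X); rewrite cat_take_drop.
split=> //; [exact: positive_take|exact: positive_drop| |].
  by rewrite map_take -e map_cat take_size_cat ?size_map.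
by rewrite map_drop -e map_cat drop_size_cat ?size_map.
Qed.

(** A symmetry between two identities moves [x] past [s1]. The new codomain word is left
    existential, since the types of the frame determine it. *)
Lemma gen_front X Y G (p s1 s2 : seq (cvert G)) x : gen X Y G -> codf G = p ++ s1 ++ x :: s2 ->
  exists Z, gen X Z (recod (G := G) (p ++ x :: s1 ++ s2)).
Proof.
move=> gG ec; have [fG pX pY] := gen_framed gG.
have := fr_cod_type fG; rewrite ec => /(split_frame pY)[P [Y1 [eY pP pY1 tp]]].
move=> /(split_frame pY1)[S1 [Y2 [eY1 pS1 pY2 t1]]].
rewrite -[x :: s2]/([:: x] ++ s2) => /(split_frame pY2)[A [S2 [eY2 pA pS2 tx t2]]].
have [q0 w0] := wires_id pP tp; have [q1 w1] := wires_symm pS1 pA t1 tx.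
have [q2 w2] := wires_id pS2 t2.
have w := wires_tens w0 (wires_tens w1 w2).
have gw := gen_tens (gen_id pP) (gen_tens (gen_symm pS1 pA) (gen_id pS2)).
exists (P ++ (A ++ S1) ++ S2).
apply: (@gen_absorb X Y _ G _ _ _ _ gG); last first.
  by move: w; rewrite -!catA /= -ec; apply.
by move: gw; rewrite eY eY1 eY2 -!catA.
Qed.

(** Selection sort: [p] is the part already in place, and [gen_front] brings the next label of [c]
    behind it. *)
Lemma gen_recod X Y G c : gen X Y G -> perm_eq (codf G) c -> exists Z, gen X Z (recod (G := G) c).
Proof.
move=> gG; rewrite -[c]/([::] ++ c); move: gG.
rewrite -[G in gen _ _ G]recodK.
suff h (p s t : seq (cvert G)) Y' : gen X Y' (recod (G := G) (p ++ s)) -> perm_eq s t ->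
    exists Z, gen X Z (recod (G := G) (p ++ t)).
  exact: (h [::]).
elim: t p s Y' => [|x t IH] p s Y' gs pst; first by rewrite -(perm_nilP pst); exists Y'.
have [s1 [s2 [e _]]] : exists s1 s2, s = s1 ++ x :: s2 /\ x \notin s1.
  by apply: splitx; rewrite (perm_mem pst) mem_head.
rewrite e in gs pst.
have [Z gZ] := gen_front gs (erefl : codf (recod _) = _).
rewrite perm_mid in pst; rewrite -cat_rcons.
by apply: IH pst; rewrite cat_rcons; exact: gZ.
Qed.

End Generation.

Lemma enum_ord1 : enum 'I_1 = [:: ord0].
Proof. by apply: (inj_map val_inj); rewrite val_enum_ord. Qed.

Lemma perm_lift (A B : eqType) (f : A -> B) s t :
  perm_eq (map f s) t -> exists2 s', perm_eq s s' & map f s' = t.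
Proof.
elim: t s => [|y t IH] s pst.
  exists [::] => //; move: pst => /perm_size; by case: s.
have [x xs ey] : exists2 x, x \in s & y = f x.
  by apply/mapP; rewrite (perm_mem pst) mem_head.
have ps := perm_to_rem xs.
have pt : perm_eq (map f (rem x s)) t.
  by rewrite -(perm_cons y) {1}ey -[f x :: _]/(map f (x :: rem x s)) -(permPl (perm_map f ps)).
have [s' h1 h2] := IH _ pt; exists (x :: s'); last by rewrite /= h2 ey.
by rewrite (permPl ps) perm_cons.
Qed.

Lemma zip_map_eq (A B C : eqType) (f : A -> C) (g : B -> C) s t x y :
  map f s = map g t -> (x, y) \in zip s t -> f x = g y.
Proof.
elim: s t => [|a s IH] [|b t] //= [e1 e2]; rewrite inE => /orP[/eqP[-> ->] //|].
exact: IH.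
Qed.

Lemma zip_memr (A B : eqType) (s : seq A) (t : seq B) x :
  size s = size t -> x \in s -> exists y, (x, y) \in zip s t.
Proof.
elim: s t => [|a s IH] [|b t] //= [e]; rewrite inE => /orP[/eqP ->|/(IH t e)[y h]].
  by exists b; rewrite mem_head.
by exists y; rewrite inE h orbT.
Qed.

(** * Covering a graph by copies of its nodes *)

Section Covers.
Variables (T : signature) (V : sst_data) (K K' : sst_functor (FCspP T) V).
Hypothesis eob : forall X, K X = K' X.
Hypothesis ebox : forall f, Arr (fhom K (sm (canonical_sighom T) f)) = Arr (fhom K' (sm (canonical_sighom T) f)).
Notation gen := (gen K K').
Variables (X Y : seq (bool * sobj T)) (G : cospan T) (fG : framed X Y G).
Hypotheses (pX : positive X) (pY : positive Y).
Let sG := fr_string fG.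

(** The node of which an edge is a part; unlike [owner], it does not depend on a side. *)
Definition node_of (e : cedge G) : node G :=
  if is_mid (etype e) then inl e else if is_wire (csrc e) then inr (ctgt e) else inr (csrc e).

(** [B] is a disjoint union of copies of the nodes in [js]. A wire-vertex of [G] may have two
    copies, one where it is produced and one where it is consumed; a box-vertex has at most one. *)
Record covers (js : seq (node G)) (B : cospan T) (pv : cvert B -> cvert G) : Prop := Covers {
  cv_type : forall u, vtype (pv u) = vtype u;
  cv_link : forall u v t, link u v t -> link (pv u) (pv v) t;
  cv_edge : forall e, node_of e \in js ->
    exists u v, [/\ pv u = csrc e, pv v = ctgt e & link u v (etype e)];
  cv_dom : map pv (domf B) = ins (@node_ports _ false G) js;
  cv_cod : map pv (codf B) = ins (@node_ports _ true G) js;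
  cv_wire : forall u, is_wire u -> u \in domf B ++ codf B;
  cv_node : forall u, ~~ is_wire u -> inr (pv u) \in js;
  cv_box : forall v, inr v \in js -> exists u, pv u = v;
  cv_inj : forall u u', ~~ is_wire u -> pv u = pv u' -> u = u' }.

Lemma covers_wire js B (pv : cvert B -> cvert G) u : covers js pv -> is_wire (pv u) = is_wire u.
Proof. by case=> ht *; rewrite /is_wire ht. Qed.

Lemma node_of_node e : is_node (node_of e).
Proof.
rewrite /node_of; case: ifP => //= nm; have [h1 h2] := sg_typed sG e.
by case: ifP => /=; rewrite /is_wire h1 ?h2; case: (etype e) nm.
Qed.

Lemma cover_mid e : is_mid (etype e) ->
  exists X' Y' B (pv : cvert B -> cvert G), gen X' Y' B /\ covers [:: inl e] pv.
Proof.
case te: (etype e) => [o|//|//] _.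
have pL : positive [:: (true, o)] by [].
exists [:: (true, o)], [:: (true, o)], (cospan_id [:: (true, o)]).
exists (fun u => match u with inl _ => csrc e | inr _ => ctgt e end); split; first exact: gen_id.
have [h1 h2] := sg_typed sG e.
split.
- by case=> i; rewrite ?h1 ?h2 te ord1.
- move=> u v t /(link_id _ _ _ pL)[i [-> -> ->]]; rewrite ord1 -te; exact: edge_link.
- move=> e'; rewrite inE /node_of; case: ifP => [m /eqP[->]|_]; last by case: ifP.
  exists (inl ord0), (inr ord0); split=> //; apply/link_id => //.
  by exists ord0; rewrite te.
- by rewrite /= enum_ord1.
- by rewrite /= enum_ord1.
- by case=> i _; rewrite mem_cat /= enum_ord1 ord1 !inE ?eqxx ?orbT.
- by case.
- by move=> v; rewrite inE.
- by case.
Qed.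

(** The enumerations [ei] and [eo] of the ports place the box at [v]; an edge at [v] is recovered
    from its type by [far_inj]. *)
Lemma cover_box v : ~~ is_wire v ->
  exists X' Y' B (pv : cvert B -> cvert G), gen X' Y' B /\ covers [:: inr v] pv.
Proof.
move=> nv; move: (nv); rewrite {1}/is_wire; case tv: (vtype v) => [//|f] _.
have [ei hi] := port_fun sG false tv; have [eo ho] := port_fun sG true tv.
exists (pos_word (sdom f)), (pos_word (scod f)), (cospan_box f).
pose pv (u : cvert (cospan_box f)) : cvert G :=
  match u with None => v | Some (inl i) => csrc (ei i) | Some (inr i) => ctgt (eo i) end.
exists pv; split; first exact: gen_box.
have nf i : near false (ei i) = csrc (ei i) by [].
have nt i : near true (eo i) = ctgt (eo i) by [].
have tw' u : vtype (pv u) = vtype u.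
  case: u => [[i|i]|] //=.
    by rewrite -nf near_type //; case: (hi i) => _ ->; rewrite port_near.
  by rewrite -nt near_type //; case: (ho i) => _ ->; rewrite port_near.
split=> //.
- move=> u w t [[i|i] /= [<- <- <-]] /=.
    by case: (hi i) => hf /= <-; rewrite -[in X in link _ X _]hf; apply: edge_link.
  by case: (ho i) => hf /= <-; rewrite -[in X in link X _ _]hf; apply: edge_link.
- move=> e; rewrite inE /node_of; have [h1 h2] := sg_typed sG e.
  case: ifP => // nm; case: ifP => w /eqP[ev].
    move: h2 nm; rewrite ev tv; case te: (etype e) w h1 => [o|f' i|f' i] // w h1 [ef] _; subst f'.
    have [hf ht] := hi i; exists (Some (inl i)), None.
    have -> : e = ei i by apply: (@far_inj _ _ sG false f e (ei i) i); rewrite ?hf.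
    by split=> //; exists (inl i).
  move: h1 nm w; rewrite /is_wire ev tv; case te: (etype e) h2 => [o|f' i|f' i] // h2 [ef] _ _; subst f'.
  have [hf ht] := ho i; exists None, (Some (inr i)).
  have -> : e = eo i by apply: (@far_inj _ _ sG true f e (eo i) i); rewrite ?hf.
  by split=> //; exists (inr i).
- rewrite /ins /= cats0 /node_ports /= (box_ports_eq sG nv (ports_map tv hi)).
  by rewrite -!map_comp.
- rewrite /ins /= cats0 /node_ports /= (box_ports_eq sG nv (ports_map tv ho)).
  by rewrite -!map_comp.
- case=> [[i|i]|] // _; rewrite mem_cat; apply/orP; [left|right]; apply/mapP;
    by exists i; rewrite ?mem_enum.
- by case=> [[i|i]|] // _; rewrite mem_head.
- by move=> w; rewrite inE => /eqP[->]; exists None.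
- case=> [[i|i]|] // u' _ e; move: (tw' u'); rewrite -e /= tv; by case: u' {e} => [[i|i]|].
Qed.

Lemma covers_tens js js' B B' (pv : cvert B -> cvert G) (pv' : cvert B' -> cvert G) :
    (forall j, j \in js -> j \notin js') -> covers js pv -> covers js' pv' ->
  covers (B := cospan_tens B B') (js ++ js')
    (fun u => match u with inl a => pv a | inr b => pv' b end).
Proof.
move=> dj c c'; split.
- by case=> u; [apply: cv_type c _|apply: cv_type c' _].
- by case=> u [] v t; rewrite link_tensE //; [apply: cv_link c _ _ _|apply: cv_link c' _ _ _].
- move=> e; rewrite mem_cat => /orP[/(cv_edge c)|/(cv_edge c')] [u [v [h1 h2 h3]]].
    by exists (inl u), (inl v); rewrite link_tensE.
  by exists (inr u), (inr v); rewrite link_tensE.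
- by rewrite /= map_cat -!map_comp ins_cat -(cv_dom c) -(cv_dom c').
- by rewrite /= map_cat -!map_comp ins_cat -(cv_cod c) -(cv_cod c').
- case=> u w; rewrite !mem_cat ?mem_inl ?mem_inr ?mem_inlr ?mem_inrl.
    by have := cv_wire c w; rewrite mem_cat => /orP[] ->; rewrite ?orbT.
  by have := cv_wire c' w; rewrite mem_cat => /orP[] ->; rewrite ?orbT.
- case=> u nw; rewrite mem_cat.
    by rewrite (cv_node c).
  by rewrite (cv_node c') // orbT.
- move=> v; rewrite mem_cat => /orP[/(cv_box c)[u <-]|/(cv_box c')[u <-]]; [by exists (inl u)|by exists (inr u)].
- have no a b : ~~ is_wire a -> ~~ is_wire b -> pv a <> pv' b.
    by move=> na nb e; have := dj _ (cv_node c na); rewrite e (cv_node c' nb).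
  case=> u [] u' nu e.
  + by congr inl; apply: (cv_inj c).
  + case: (no u u' nu _ e); rewrite -(covers_wire u' c') -e (covers_wire u c); exact: nu.
  + case: (no u' u _ nu (esym e)); rewrite -(covers_wire u' c) -e (covers_wire u c'); exact: nu.
  + by congr inr; apply: (cv_inj c').
Qed.

Lemma cover_nodes (js : seq (node G)) : uniq js -> (forall j, j \in js -> is_node j) ->
  exists X' Y' B (pv : cvert B -> cvert G), gen X' Y' B /\ covers js pv.
Proof.
elim: js => [|j js IH] /= => [_ _|/andP[nj us] h].
  exists [::], [::], (cospan_id [::]).
  have nov : cvert (cospan_id ([::] : seq (bool * sobj T))) -> cvert G by case=> -[].
  exists nov; split; first exact: gen_id.
  by split=> //; first [by case=> -[] | rewrite /= enum_ord0].
have [X1 [Y1 [B1 [pv1 [g1 c1]]]]] : exists X' Y' B (pv : cvert B -> cvert G), gen X' Y' B /\ covers [:: j] pv.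
  by have := h j (mem_head _ _); case: (j) => [e|v]; [apply: cover_mid|apply: cover_box].
have [X2 [Y2 [B2 [pv2 [g2 c2]]]]] : exists X' Y' B (pv : cvert B -> cvert G), gen X' Y' B /\ covers js pv.
  by apply: IH => // k hk; apply: h; rewrite inE hk orbT.
exists (X1 ++ X2), (Y1 ++ Y2), (cospan_tens B1 B2); eexists; split; first exact: gen_tens g1 g2.
rewrite -cat1s; apply: (covers_tens _ c1 c2) => k; by rewrite inE => /eqP ->.
Qed.
End Covers.

Lemma positive_word_eq (T : signature) (X Y : seq (bool * sobj T)) : positive X -> positive Y ->
  [seq inl x.2 : vertex (typegraph T) | x <- X] = [seq inl y.2 | y <- Y] -> X = Y.
Proof.
elim: X Y => [|[b x] X IH] [|[b' y] Y] //= /andP[/= -> pX] /andP[/= -> pY] [<- /IH <- //].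
Qed.

(** * Reassembling a graph from its nodes *)

Section Generated.
Variables (T : signature) (V : sst_data) (K K' : sst_functor (FCspP T) V).
Hypothesis eob : forall X, K X = K' X.
Hypothesis ebox : forall f, Arr (fhom K (sm (canonical_sighom T) f)) = Arr (fhom K' (sm (canonical_sighom T) f)).
Notation gen := (gen K K').
Variables (X Y : seq (bool * sobj T)) (G : cospan T) (fG : framed X Y G).
Hypotheses (pX : positive X) (pY : positive Y).
Let sG := fr_string fG.

Section Assemble.
Variables (I J : seq (bool * sobj T)) (B : cospan T) (pv : cvert B -> cvert G).
Hypotheses (gB : gen I J B) (cB : covers (nodes G) pv).
Variables (q : cvert (cospan_id X) -> cvert G) (wq : wires q (domf G) (domf G)).
(** The identity on [X] supplies the labels produced by the domain, [B] those produced by nodes. *)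
Let D := cospan_tens (cospan_id X) B.
Let pv0 (u : cvert D) : cvert G := match u with inl w => q w | inr b => pv b end.
Variable c : seq (cvert D).
Hypotheses (pc : perm_eq (codf D) c)
  (ec : map pv0 c = codf G ++ ins (@node_ports _ false G) (nodes G)).

Let fB : framed I J B. Proof. by case: (gen_framed gB). Qed.
Let pI : positive I. Proof. by case: (gen_framed gB). Qed.
Let pJ : positive J. Proof. by case: (gen_framed gB). Qed.
Let fD : framed (X ++ I) (X ++ J) D := framed_tens (framed_id X) fB.
Let pXI : positive (X ++ I). Proof. exact: positive_cat. Qed.

Lemma assemble_type u : vtype (pv0 u) = vtype u.
Proof. by case: u => u; [apply: wi_type wq _|apply: cv_type cB _]. Qed.

(** A positive word is determined by the types of its letters, which identifies the word that
    [gen_recod] leaves open. *)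
Lemma assemble_frame Z : framed (X ++ I) Z (recod (G := D) c) -> positive Z -> Z = Y ++ I.
Proof.
move=> fZ pZ; apply: (@positive_word_eq T) => //; first exact: positive_cat.
rewrite -(fr_cod_type fZ) map_cat -(fr_cod_type fG) -(fr_dom_type fB).
have -> : [seq vtype v | v <- domf B] = [seq vtype v | v <- map pv (domf B)].
  by rewrite -map_comp; apply: eq_map => u; rewrite /= (cv_type cB).
rewrite (cv_dom cB) -map_cat -ec -map_comp; apply: eq_map => u; exact: esym (assemble_type u).
Qed.

(** Tracing over [I] joins each label consumed by a node to the place where it is produced.
    Contracting these trace wires and the identity wires on [X] merges the copies of each
    wire-vertex and gives [G]. *)
Lemma assemble : gen (X ++ I) (Y ++ I) (recod (G := D) c) -> gen X Y G.
Proof.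
move=> gR; have [fR _ pYI] := gen_framed gR.
have gN := gen_tr eob pI pX pY gR; have [fN _ _] := gen_framed gN.
apply: (gen_contr gN fG); set R := recod c in fR gR gN fN *.
pose c2 : seq (cvert D) := drop (size Y) c.
have szY : size (codf G) = size Y := size_codf fG.
have szX : size [seq inl i : cvert D | i <- domf (cospan_id X)] = size X.
  by rewrite size_map (size_domf (framed_id X)).
have e2 : map pv0 c2 = map pv (domf B).
  by rewrite (cv_dom cB) /c2 -szY map_drop ec drop_size_cat.
have edR : drop (size X) (domf R) = map inr (domf B) by rewrite /= drop_size_cat.
have linkE u v t : link (G := cospan_tr I X Y R) u v t = (link (G := D) u v t \/
    (v, u) \in zip (map inr (domf B)) c2 /\ wire_mid (G := R) u t).
  by rewrite (link_trE _ _ _ fR) // edR.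
have trE (u v : cvert D) : (v, u) \in zip (map inr (domf B)) c2 ->
    pv0 u = pv0 v /\ exists2 b, v = inr b & b \in domf B.
  move=> h; split; last by have [/mapP[b bd ->] _] := mem_zip h; exists b.
  by symmetry; apply: (zip_map_eq _ h); rewrite e2 -map_comp; apply: eq_map.
have c2c (u v : cvert D) : (v, u) \in zip (map inr (domf B)) c2 -> u \in codf D.
  by case/mem_zip => _ /mem_drop2; rewrite (perm_mem pc).
have uB : uniq (domf B ++ codf B) := fr_uniq fB.
have dcB b : b \in domf B -> b \in codf B -> False.
  by move: uB; rewrite cat_uniq => /and3P[_ /hasPn h _] bd /h; rewrite /= bd.
(* Contracted are the identity wires and the trace wires, while the links of [B] are kept. A path
   runs along an identity wire or starts at a produced copy, and may end in a consumed copy; [rk]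
   increases along it. *)
pose C (u v : cvert D) := match u, v with inl (inl i), inl (inr k) => i == k | _, _ => false end
  || ((v, u) \in zip (map inr (domf B)) c2).
pose rk (u : cvert D) := match u with
  | inl (inl _) => 0 | inl (inr _) => 1 | inr b => if b \in domf B then 2 else 1 end.
have us := net_uniq fG pX pY (nodes_uniq G) (@mem_nodes _ G).
have uo : {in codf B &, injective pv}.
  by move=> x y; apply: map_uniq_inj; rewrite (cv_cod cB);
    move: us; rewrite cat_uniq => /and3P[].
have ud : uniq (domf G) by move: us; rewrite cat_uniq => /and3P[].
have qd : map q (map inl (enum 'I_(size X))) = domf G := wi_dom wq.
have qc : map q (map inr (enum 'I_(size X))) = domf G := wi_cod wq.
have qlr i : q (inl i) = q (inr i).
  by apply: (wi_link wq (t := mid_edge (tnth (in_tuple X) i).2)); apply/link_id => //; exists i.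
have qi i k : q (inl i) = q (inl k) -> i = k.
  move=> e; apply: (map_uniq_inj (q := fun i => q (inl i)) (s := enum 'I_(size X))) => //.
  - by rewrite (map_comp q inl) qd.
  - by rewrite mem_enum.
  - by rewrite mem_enum.
have qD i : q (inl i) \in domf G by rewrite -qd; apply/map_f/map_f; rewrite mem_enum.
have wD x : x \in domf G -> is_wire x.
  by rewrite (pos_dom _ fG) // => /andP[].
(* A label produced by the domain is not produced by a node, so its copy in [B] is a consumed
   one. *)
have qB i b : q (inl i) = pv b -> b \in domf B.
  move=> e; have wb : is_wire b by rewrite -(covers_wire b cB) -e wD.
  have := cv_wire cB wb; rewrite mem_cat => /orP[//|bc].
  have : pv b \in map pv (codf B) by rewrite map_f.
  rewrite (cv_cod cB) -e; move: us; rewrite cat_uniq => /and3P[_ /hasPn h _] /h.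
  by rewrite /= qD.
apply: (@Contr _ (cospan_tr I X Y R) G pv0 C rk).
- exact: assemble_type.
- move=> a; case wa: (is_wire a); last first.
    have [|u eu] := cv_box cB (v := a); last by exists (inr u).
    by rewrite mem_nodes /= wa.
  case ia : (has_in a).
    have : a \in map pv (codf B).
      by rewrite (cv_cod cB) (mem_ports_all sG _ (@mem_nodes _ G)) wa.
    by case/mapP => b _ ->; exists (inr b).
  have : a \in domf G by rewrite (pos_dom _ fG) // /is_input wa ia.
  by rewrite -qd => /mapP[w _ ->]; exists (inl w).
- move=> u v /orP[|h].
    case: u v => [[i|i]|b] // [[k|k]|b'] // /eqP <-; split=> //=.
    by eexists; rewrite linkE link_tensE; left; apply/link_id => //; exists i.
  have [e [b eb bd]] := trE u v h; split=> //.
    rewrite eb /= bd; have := c2c _ _ h; case: (u) => [[i|i]|b'] //.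
    rewrite mem_cat mem_inrl mem_inr /= => bc; case: ifP => // bd'; by case: (dcB _ bd' bc).
  have wu : is_wire (G := R) u.
    rewrite -[is_wire _]/(is_wire (G := D) u).
    have := c2c _ _ h; rewrite (pos_cod _ fD) ?positive_cat // => /andP[//].
  by have [t ht] := wire_midE wu; exists t; rewrite linkE; right.
- move=> u v t; rewrite linkE => -[|[h _]]; last by left; apply/orP; right.
  rewrite link_tensE; case: u v => u [] v //.
    by move/(link_id _ _ _ pX) => [i [-> -> _]]; left; rewrite /C eqxx.
  by move/(cv_link cB); right.
- move=> _ _ t [e [<- <- <-]].
  have [|u [v [<- <- l]]] := cv_edge cB (e := e); first by rewrite mem_nodes; apply: node_of_node fG _.
  exists (inr u), (inr v); split=> //; first by rewrite linkE link_tensE; left.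
  rewrite /C /=; apply/negP => /c2c; rewrite mem_cat mem_inrl mem_inr /=.
  rewrite (pos_cod _ fB) // => /andP[_ /negP]; apply; apply/has_outP; by exists v, (etype e).
(* Every consumed copy receives a trace wire, so it is not the head of a path. *)
- have hd b : b \in domf B -> (forall w, ~~ C w (inr b)) -> False.
    move=> bd nb; have [w hw] : exists w : cvert D, (inr b : cvert D, w) \in zip (map inr (domf B)) c2.
      apply: zip_memr; last by apply: map_f.
      by rewrite size_map -(size_map pv) -e2 size_map.
    by have := nb w; rewrite /C hw orbT.
  have hi i : (forall w, ~~ C w (inl (inr i))) -> False.
    by move/(_ (inl (inl i))); rewrite /C eqxx.
  move=> [[i|i]|b] [[k|k]|b'] //= e nu nv; try by [case: (hi _ nu)|case: (hi _ nv)].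
  + by rewrite (qi _ _ e).
  + by case: (hd _ (qB _ _ e) nv).
  + by case: (hd _ (qB _ _ (esym e)) nu).
  + congr inr; case wb: (is_wire b); last by apply: (cv_inj cB); rewrite ?wb.
    have wb' : is_wire b' by rewrite -(covers_wire b' cB) -e (covers_wire b cB).
    have := cv_wire cB wb; rewrite mem_cat => /orP[h|h]; first by case: (hd _ h nu).
    have := cv_wire cB wb'; rewrite mem_cat => /orP[h'|h']; first by case: (hd _ h' nv).
    exact: uo.
- by rewrite /= take_size_cat // -map_comp -qd -map_comp.
- by rewrite /= map_take ec take_size_cat.
Qed.
End Assemble.

(** The produced labels, as listed by the codomain of the tensor product, are a permutation of the
    consumed ones by [net_perm_eq]; [perm_lift] turns this into a reordering of the codomain
    frame. *)
Lemma generated : gen X Y G.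
Proof.
have [I [J [B [pv [gB cB]]]]] : exists X' Y' B (pv : cvert B -> cvert G), gen X' Y' B /\ covers (nodes G) pv.
  by apply: (cover_nodes eob ebox fG); rewrite ?nodes_uniq // => j; rewrite mem_nodes.
have [q wq] := wires_id pX (fr_dom_type fG).
have gD := gen_tens (gen_id eob pX) gB.
pose pv0 (u : cvert (cospan_tens (cospan_id X) B)) : cvert G :=
  match u with inl w => q w | inr b => pv b end.
have pp := net_perm_eq fG pX pY (nodes_uniq G) (@mem_nodes _ G).
have [|c pc ec] := @perm_lift _ _ pv0 (codf (cospan_tens (cospan_id X) B))
    (codf G ++ ins (@node_ports _ false G) (nodes G)).
  suff -> : map pv0 (codf (cospan_tens (cospan_id X) B)) =
      domf G ++ ins (@node_ports _ true G) (nodes G) by exact: pp.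
  rewrite codf_tens map_cat -(cv_cod cB) -map_comp -(map_comp pv0 inr).
  by congr cat; exact: wi_cod wq.
have [Z gZ] := gen_recod eob gD pc.
have [fZ _ pZ] := gen_framed gZ.
have eZ := assemble_frame gB cB wq ec fZ pZ; subst Z.
exact: (assemble gB cB wq pc ec gZ).
Qed.
End Generated.

(** Words are tensor products of letters, which settles the objects; arrows are settled by
    [generated]. *)
Lemma functor_unique (T : signature) (V : sst_data) (K K' : sst_functor (FCspP T) V) :
  sighom_comp K (canonical_sighom T) = sighom_comp K' (canonical_sighom T) -> K = K'.
Proof.
move=> e.
have eo o : K (pos_letter o) = K' (pos_letter o) by have := congr1 (fun h : sighom T V => h o) e.
have eob X : K X = K' X.
  case: X => w; elim: w => [|[b o] w IH] p.
    have -> : exist _ [::] p = unitO :> Ob (FCspP T) by apply: sub_ob_eq.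
    by rewrite !fobj_unit.
  have pw : positive w by case/andP: (p).
  have -> : exist _ ((b, o) :: w) p = tensO (pos_letter o) (exist _ w pw) :> Ob (FCspP T).
    by apply: sub_ob_eq => /=; move: p => /andP[/= -> _].
  by rewrite !fobj_tens eo IH.
have ebox f : Arr (fhom K (sm (canonical_sighom T) f)) = Arr (fhom K' (sm (canonical_sighom T) f)).
  by have := congr1 (fun h : sighom T V => Arr (sm h f)) e; rewrite /= !Arr_castm.
apply: functor_ext => // -[X pX] [Y pY] c.
have [G rG] := rep_ex c.
have [pX' [pY' [d [rd ed]]]] := generated eob ebox (rep_framed rG) pX pY.
have eX := bool_irrelevance pX' pX; subst pX'.
have eY := bool_irrelevance pY' pY; subst pY'.
by rewrite (rep_fun rG rd).
Qed.

Unset Implicit Arguments.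
Set Strict Implicit.
Set Printing Implicit Defensive.
Local Open Scope sst_scope.

(** The first three clauses ensure that the choice of representatives in [FCsp] does not affect
    composition, tensor product and trace. *)
Theorem theorem5p5p10 (T : signature) :
  (forall (X Y Z : Ob (FCspP T))
      (H : fcospan (sval Y) (sval Z)) (G : fcospan (sval X) (sval Y)),
    pcls H ∘ pcls G = pcls (fcospan_comp H G)) /\
  (forall (X Y X' Y' : Ob (FCspP T))
      (G : fcospan (sval X) (sval Y)) (H : fcospan (sval X') (sval Y')),
    pcls G ⊠ pcls H = @pcls T (X ⊗ X') (Y ⊗ Y') (fcospan_tens G H)) /\
  (forall (U A B : Ob (FCspP T))
      (G : fcospan (sval A ++ sval U) (sval B ++ sval U)),
    trm U (@pcls T (A ⊗ U) (B ⊗ U) G) = pcls (fcospan_tr G)) /\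
  is_sst (FCspP T) /\
  (forall V : sst_data, is_sst V -> forall F : sighom T V,
    exists! Fhat : sst_functor (FCspP T) V,
      sighom_comp Fhat (canonical_sighom T) = F).
Proof.
split; first exact: pcls_comp.
split; first exact: pcls_tens.
split; first exact: pcls_tr.
split; first exact: is_sst_FCspP.
move=> V HV F; exists (ext HV F); split; first exact: ext_comp_canonical.
by move=> K eK; apply: functor_unique; rewrite ext_comp_canonical eK.
Qed.
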